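(* Let $k=\bar{\mathbf F}_2$, let $\mathcal M_{1,2}\to\mathcal M_{1,1}$ be the forgetful morphism $(E,P)\mapsto E$ between coarse moduli spaces over $k$, and let $C_0$ be its fiber above the point of $\mathcal M_{1,1}$ corresponding to the supersingular elliptic curve over $k$ (that is, the point $j=0$). Let $\mathcal L(k)\subset\mathcal M_{1,2}(k)$ be the Lamé locus. Then $\mathcal L(k)=C_0(k)$.
   Context: $\mathcal M_{1,1}\cong\mathbf A^1_k$ (via the $j$-invariant) is the coarse moduli space of elliptic curves over $k$, and $\mathcal M_{1,2}$ is the coarse moduli space of pairs $(E,P)$ with $E$ an elliptic curve over $k$ and $P\in E(k)$, $P\neq 0_E$; thus $\mathcal M_{1,2}(k)$ is the set of $k$-isomorphism classes of such pairs. Over $\bar{\mathbf F}_2$ there is a unique supersingular elliptic curve up to isomorphism; it has $j$-invariant $0$. Lamé curves: let $P\in E(k)$ be a torsion point of exact order $n>1$, $n$ not divisible by the characteristic of $k$. There is $f_P\in k(E)$, unique up to a multiplicative constant, with divisor $n(P)-n(0_E)$; it induces a degree $n$ cover $f_P:E\to\mathbf P^1_k$. The pair $(E,P)$ is a Lamé curve of order $n$ if $f_P$ is tamely ramified and is ramified exactly at $0_E$ and $P$, with ramification index $n$, and at one third point $Q$, with ramification index $3$. The Lamé locus $\mathcal L(k)\subset\mathcal M_{1,2}(k)$ is the set of points corresponding to Lamé curves of arbitrary order $n>1$ over $k$. *)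

(* Defs.v *)
From HB Require Import structures.
From mathcomp Require Import all_boot all_order all_algebra all_field.
From mathcomp Require Import ring zify.
From mathcomp Require Import boolp classical_sets.

Set Implicit Arguments.
Unset Strict Implicit.
Unset Printing Implicit Defensive.

Import GRing.Theory.
Local Open Scope ring_scope.
Local Open Scope classical_set_scope.

Local Notation "x %:F" := (@FracField.tofrac _ x).

(* y^2 + a1 x y + a3 y = x^3 + a2 x^2 + a4 x + a6 *)
Record weierstrass (k : Type) :=
  Weierstrass { a1 : k; a2 : k; a3 : k; a4 : k; a6 : k }.

Section Invariants.
Context {k : fieldType}.
Implicit Type W : weierstrass k.

Definition b2 W := a1 W ^+ 2 + 4%:R * a2 W.
Definition b4 W := 2%:R * a4 W + a1 W * a3 W.
Definition b6 W := a3 W ^+ 2 + 4%:R * a6 W.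
Definition b8 W :=
  a1 W ^+ 2 * a6 W + 4%:R * a2 W * a6 W - a1 W * a3 W * a4 W
    + a2 W * a3 W ^+ 2 - a4 W ^+ 2.
Definition c4 W := b2 W ^+ 2 - 24%:R * b4 W.
Definition discriminant W :=
  - (b2 W ^+ 2 * b8 W) - 8%:R * b4 W ^+ 3 - 27%:R * b6 W ^+ 2
    + 9%:R * b2 W * b4 W * b6 W.
Definition j_invariant W := c4 W ^+ 3 / discriminant W.

End Invariants.

Record elliptic_curve (k : fieldType) := EllipticCurve {
  model :> weierstrass k;
  discriminant_neq0 : discriminant model != 0 }.

Section Points.
Context {k : fieldType} (E : elliptic_curve k).

(* [None] is the point at infinity [0 : 1 : 0]. *)
Definition on_curve (P : option (k * k)) : bool :=
  if P is Some (x, y) then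
    y ^+ 2 + a1 E * x * y + a3 E * y
      == x ^+ 3 + a2 E * x ^+ 2 + a4 E * x + a6 E
  else true.

Record point := Point { coords :> option (k * k); _ : on_curve coords }.

HB.instance Definition _ := [isSub for coords].
HB.instance Definition _ := [Choice of point by <:].

Definition origin : point := Point (isT : on_curve None).

Definition slope (x1 y1 x2 y2 : k) : k :=
  if x1 == x2 then
    (3%:R * x1 ^+ 2 + 2%:R * a2 E * x1 + a4 E - a1 E * y1)
      / (2%:R * y1 + a1 E * x1 + a3 E)
  else (y2 - y1) / (x2 - x1).

Definition add_coords (P Q : option (k * k)) : option (k * k) :=
  match P, Q with
  | None, _ => Q
  | _, None => P
  | Some (x1, y1), Some (x2, y2) =>
    if (x1 == x2) && (y2 == - y1 - a1 E * x1 - a3 E) then None else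
    let l := slope x1 y1 x2 y2 in
    let x3 := l ^+ 2 + a1 E * l - a2 E - x1 - x2 in
    let y3 := y1 + l * (x3 - x1) in
    Some (x3, - y3 - a1 E * x3 - a3 E)
  end.

Lemma add_coords_on_curve (P Q : point) : on_curve (add_coords P Q).
Proof.
case: P Q => [[[x1 y1]|] H1] [[[x2 y2]|] H2] //=.
move: H1 H2 => /= /eqP H1 /eqP H2.
case: ifPn => //= NO; set l := slope _ _ _ _.
set x3 := (X in - (y1 + l * (X - x1))).
(* the restriction of the equation to the line has no linear term *)
have G : l * (2%:R * y1 + a1 E * x1 + a3 E) + a1 E * y1 + l ^+ 2 * (x2 - x1)
         + a1 E * l * (x2 - x1)
       = (x1 ^+ 2 + x1 * x2 + x2 ^+ 2) + a2 E * (x1 + x2) + a4 E.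
  rewrite /l /slope; case: eqP NO => [e /= NO|/eqP ne _]; last first.
    have d0 : x2 - x1 != 0 by rewrite subr_eq0 eq_sym.
    apply: (mulIf d0).
    have -> : (x1 ^+ 2 + x1 * x2 + x2 ^+ 2 + a2 E * (x1 + x2) + a4 E)
              * (x2 - x1)
            = (x2 ^+ 3 + a2 E * x2 ^+ 2 + a4 E * x2 + a6 E)
              - (x1 ^+ 3 + a2 E * x1 ^+ 2 + a4 E * x1 + a6 E) by ring.
    by rewrite -H1 -H2; field.
  have D0 : 2%:R * y1 + a1 E * x1 + a3 E != 0.
    have/eqP : (y2 - y1) * (y2 - (- y1 - a1 E * x1 - a3 E)) = 0.
      have -> : (y2 - y1) * (y2 - (- y1 - a1 E * x1 - a3 E)) =
         (y2 ^+ 2 + a1 E * x1 * y2 + a3 E * y2)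
         - (y1 ^+ 2 + a1 E * x1 * y1 + a3 E * y1) by ring.
      by rewrite H1 e H2; ring.
    rewrite mulf_eq0 !subr_eq0 (negPf NO) orbF => /eqP ey.
    move: NO; rewrite ey -subr_eq0; apply: contraNN => /eqP z.
    by apply/eqP; rewrite -z; ring.
  by rewrite -e; field.
apply/eqP/subr0_eq; move: G => /(congr1 (fun z => z * (x3 - x1))) G.
transitivity ((y1 ^+ 2 + a1 E * x1 * y1 + a3 E * y1
      - (x1 ^+ 3 + a2 E * x1 ^+ 2 + a4 E * x1 + a6 E))
    + ((l * (2%:R * y1 + a1 E * x1 + a3 E) + a1 E * y1
        + l ^+ 2 * (x2 - x1) + a1 E * l * (x2 - x1)) * (x3 - x1)
      - ((x1 ^+ 2 + x1 * x2 + x2 ^+ 2) + a2 E * (x1 + x2) + a4 E)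
        * (x3 - x1))); first by rewrite /x3; ring.
by rewrite G H1 !subrr addr0.
Qed.

Definition add_point (P Q : point) : point := Point (add_coords_on_curve P Q).

Definition mul_point (n : nat) (P : point) : point :=
  iter n (add_point P) origin.

Definition has_exact_order (P : point) (n : nat) : Prop :=
  [/\ (0 < n)%N, mul_point n P = origin
    & forall m, (0 < m < n)%N -> mul_point m P <> origin].

End Points.

Lemma fraction_numden (R : idomainType) (z : {fraction R}) :
  exists n m : R, m != 0 /\ z = n%:F / m%:F.
Proof.
elim/quotW: z => z; exists (frac z).1, (frac z).2.
split; first exact: denom_ratioP.
unlock FracField.tofrac; rewrite -[X in _ = _ * X]FracField.pi_inv.
rewrite -[RHS]FracField.pi_mul /FracField.mulf /FracField.invf.
rewrite !numden_Ratio ?oner_neq0 ?denom_ratioP // mulr1 mul1r.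
by rewrite FracField.Ratio_numden.
Qed.

Lemma clear_denominator (R : comNzRingType) (F : fieldType)
    (i : {rmorphism R -> F}) (n m h f : R) : injective i -> i m != 0 ->
  (i n / i m) ^+ 2 + i h * (i n / i m) - i f = 0 ->
  n ^+ 2 + h * n * m = f * m ^+ 2.
Proof.
move=> inj m0 e; apply: inj; rewrite !(rmorphD, rmorphM, rmorphXn) /=.
by apply/subr0_eq; rewrite -(mulr0 (i m ^+ 2)) -e; field.
Qed.

(* The function field k(E) = k(x)[y] / (Weierstrass equation) *)
Section FunctionField.
Context {k : fieldType} (E : elliptic_curve k).

Definition weierstrass_poly : {poly {fraction {poly k}}} :=
  'X ^+ 2 + (((a1 E) *: 'X + (a3 E)%:P)%:F)%:P * 'X
    - (('X ^+ 3 + a2 E *: 'X ^+ 2 + a4 E *: 'X + (a6 E)%:P)%:F)%:P.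

Let size_cubic :
  size ('X ^+ 3 + a2 E *: 'X ^+ 2 + a4 E *: 'X + (a6 E)%:P : {poly k}) = 4%N.
Proof.
rewrite -!addrA size_polyDl size_polyXn //.
rewrite (leq_ltn_trans (size_polyD _ _)) // gtn_max.
rewrite (leq_ltn_trans (size_scale_leq _ _)) ?size_polyXn //=.
rewrite (leq_ltn_trans (size_polyD _ _)) // gtn_max.
rewrite (leq_ltn_trans (size_scale_leq _ _)) ?size_polyX //=.
by rewrite (leq_ltn_trans (size_polyC_leq1 _)).
Qed.

(* Compare the degrees of the three terms. *)
Let no_fraction_root (n m : {poly k}) : m != 0 ->
  n ^+ 2 + (a1 E *: 'X + (a3 E)%:P) * n * m
    != ('X ^+ 3 + a2 E *: 'X ^+ 2 + a4 E *: 'X + (a6 E)%:P) * m ^+ 2.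
Proof.
pose h : {poly k} := a1 E *: 'X + (a3 E)%:P.
pose f : {poly k} := 'X ^+ 3 + a2 E *: 'X ^+ 2 + a4 E *: 'X + (a6 E)%:P.
rewrite -/h -/f => m0; have f0 : f != 0 by rewrite -size_poly_eq0 size_cubic.
have sh : (size h <= 2)%N.
  rewrite (leq_trans (size_polyD _ _)) // geq_max.
  rewrite (leq_trans (size_scale_leq _ _)) ?size_polyX //=.
  by rewrite (leq_trans (size_polyC_leq1 _)).
have sf : size (f * m ^+ 2) = (size m).*2.+2.
  rewrite size_mul ?expf_neq0 // size_cubic expr2 size_mul //.
  have : (0 < size m)%N by rewrite size_poly_gt0.
  by case: (size m) => // a _; rewrite addnS /= -addnn addnS !addSn.
apply/eqP => e.
have n0 : n != 0.
  apply: contra_eqN e => /eqP ->; rewrite expr0n /= mulr0 mul0r addr0 eq_sym.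
  by rewrite mulf_neq0 ?expf_neq0.
have sn : size (n ^+ 2) = (size n).*2.-1 by rewrite expr2 size_mul // addnn.
have shnm : (size (h * n * m)%R <= size n + size m)%N.
  rewrite -mulrA (leq_trans (size_polyMleq _ _)) // size_mul //.
  have : (0 < size m)%N by rewrite size_poly_gt0.
  by move: (size m) (size n) (size h) sh; lia.
have n_gt0 : (0 < size n)%N by rewrite size_poly_gt0.
have [le|lt] := leqP (size n) (size m).+1.
  have := size_polyD (n ^+ 2) (h * n * m).
  by rewrite e sf sn; move: (size _) (size m) (size n) le shnm n_gt0; lia.
have := size_polyDl (p := n ^+ 2) (q := h * n * m).
by rewrite e sf sn; move: (size _) (size m) (size n) lt shnm n_gt0; lia.
Qed.

Lemma weierstrass_poly_irreducible : monic_irreducible_poly weierstrass_poly.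
Proof.
rewrite /weierstrass_poly; set h := _ + _%:P; set f := _ + (a6 E)%:P.
have s2 : (size ((h%:F)%:P * 'X - (f%:F)%:P)%R <= 2)%N.
  rewrite (leq_trans (size_polyD _ _)) // geq_max size_polyN.
  rewrite (leq_trans (size_polyC_leq1 _)) // andbT.
  rewrite (leq_trans (size_polyMleq _ _)) // size_polyX addn2 /=.
  by rewrite ltnS size_polyC_leq1.
have lt : (size ((h%:F)%:P * 'X - (f%:F)%:P)%R
           < size ('X ^+ 2 : {poly {fraction {poly k}}})%R)%N.
  by rewrite size_polyXn ltnS.
rewrite -addrA; split; last first.
  by rewrite monicE lead_coefDl // lead_coefXn.
apply: cubic_irreducible; first by rewrite size_polyDl // size_polyXn.
move=> z; rewrite rootE !hornerE.
have [n [m [m0 ->]]] := fraction_numden z.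
have m1 : m%:F != 0 by rewrite tofrac_eq0.
have := no_fraction_root n m0; rewrite -/h -/f; clear s2 lt; clearbody h f.
apply: contraNN => /eqP e; apply/eqP.
apply: (clear_denominator (i := @FracField.tofrac {poly k})) m1 e.
by move=> p q /eqP; rewrite tofrac_eq => /eqP.
Qed.

Definition function_field : fieldType :=
  {poly %/ weierstrass_poly with weierstrass_poly_irreducible}.

Definition constf (c : k) : function_field :=
  in_qpoly weierstrass_poly (c%:P%:F)%:P.
Definition coordx : function_field :=
  in_qpoly weierstrass_poly ('X%:F)%:P.
Definition coordy : function_field :=
  in_qpoly weierstrass_poly 'X.

End FunctionField.

Section Curves.
Context {k : closedFieldType}.
Implicit Type E : elliptic_curve k.

(* Over the algebraically closed field k of characteristic p: E[p] = 0. *)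
Definition supersingular E : Prop :=
  exists2 p, p \in [pchar k] &
    forall P : point E, mul_point p P = origin E -> P = origin E.

Definition eval2 (R : comNzRingType) (g : {poly {poly R}}) (s t : R) : R :=
  g.[t%:P].[s].

(* Coordinates of an affine chart of the projective plane containing R: x and y
   if R is affine, X/Y = x/y and Z/Y = 1/y (which vanish at R) at infinity. *)
Definition chart E (R : point E) : function_field E * function_field E :=
  if coords R is Some _ then (coordx E, coordy E)
  else (coordx E / coordy E, (coordy E)^-1).

Definition chart_value E (R : point E) : k * k :=
  if coords R is Some p then p else (0, 0).

Definition eval_chart E (R : point E) (g : {poly {poly k}}) : function_field E :=
  eval2 (map_poly (map_poly (constf E)) g) (chart R).1 (chart R).2.

Definition eval_value E (R : point E) (g : {poly {poly k}}) : k :=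
  eval2 g (chart_value R).1 (chart_value R).2.

(* [f] belongs to the local ring of E at R. *)
Definition regular_at E (R : point E) (f : function_field E) : Prop :=
  exists g h, eval_value R h != 0 /\ f = eval_chart R g / eval_chart R h.

Definition unit_at E (R : point E) (f : function_field E) : Prop :=
  [/\ f != 0, regular_at R f & regular_at R f^-1].

(* [f] belongs to the maximal ideal of the local ring at R. *)
Definition vanishes_at E (R : point E) (f : function_field E) : Prop :=
  regular_at R f /\ ~ unit_at R f.

Definition uniformizer_at E (R : point E) (t : function_field E) : Prop :=
  vanishes_at R t /\
  forall f, vanishes_at R f -> exists2 g, regular_at R g & f = g * t.

(* ord_R(f) = m, for f != 0 (no m is an order of 0) *)
Definition has_ord E (R : point E) (f : function_field E) (m : int) : Prop :=
  exists t u, [/\ uniformizer_at R t, unit_at R u & f = u * t ^ m].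

Definition has_divisor E (f : function_field E) (D : point E -> int) : Prop :=
  forall R, has_ord R f (D R).

(* The ramification index at R of f, seen as a map to the projective line: the
   order of vanishing at R of f - f(R), or of 1/f if f has a pole at R *)
Definition has_ramification_index E (f : function_field E) (R : point E)
    (e : nat) : Prop :=
  (0 < e)%N /\
  ((exists c, has_ord R (f - constf E c) e%:Z) \/ has_ord R f^-1 e%:Z).

Definition tamely_ramified E (f : function_field E) : Prop :=
  forall R e, has_ramification_index f R e -> [pchar k]^'.-nat e.

(* The divisor determines f_P up to a multiplicative constant. *)
Definition is_lame_curve_of_order E (P : point E) (n : nat) : Prop :=
  [/\ (1 < n)%N, has_exact_order P n, [pchar k]^'.-nat n &
   exists f : function_field E,
   [/\ has_divisor f
         (fun R => (R == P)%:Z *+ n - (R == origin E)%:Z *+ n),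
       tamely_ramified f,
       has_ramification_index f (origin E) n,
       has_ramification_index f P n &
       exists Q, [/\ Q != origin E, Q != P, has_ramification_index f Q 3 &
         forall R, R != origin E -> R != P -> R != Q ->
           has_ramification_index f R 1]]].

(* An isomorphism of curves over k: a bijection on points together with an
   isomorphism of function fields over k, compatible with all local rings *)
Definition is_curve_isomorphism E E' (phi : point E -> point E')
    (phi_ : {rmorphism function_field E' -> function_field E}) : Prop :=
  [/\ bijective phi, bijective phi_,
      forall c, phi_ (constf E' c) = constf E c &
      forall R f, regular_at (phi R) f <-> regular_at R (phi_ f)].

Definition isomorphic E E' : Prop :=
  exists phi phi_, is_curve_isomorphism phi phi_ /\ phi (origin E) = origin E'.

(* The supersingular point of the j-line in characteristic 2 is j = 0. *)
Lemma supersingular_j0 E : 2%N \in [pchar k] ->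
  supersingular E <-> j_invariant E = 0.
Proof.
move=> c2; have two0 : 2%:R = 0 :> k by exact: pcharf0.
have dbl (z : k) : z + z = 0 by rewrite -mulr2n -mulr_natl two0 mul0r.
have c4E : c4 E = a1 E ^+ 4.
  rewrite /c4 /b2 /b4 (_ : 4%:R = 2%:R * 2%:R :> k); last by ring.
  rewrite (_ : 24%:R = 2%:R * 12%:R :> k); last by ring.
  by rewrite two0; ring.
have two_torsion (P : point E) : mul_point 2 P = origin E <->
    add_coords E (coords P) (coords P) = None.
  have -> : mul_point 2 P = add_point P P.
    by congr add_point; apply: val_inj; rewrite /=; case: (coords P) => [[]|].
  by split=> [/(congr1 (@coords _ E))|H] //; apply: val_inj.
split=> [[p cp ss]|/eqP].
  have {cp} p2 : p = 2%N by apply/eqP; move: cp; rewrite (pcharf_eq c2).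
  rewrite {p}p2 in ss.
  rewrite /j_invariant c4E; have [->|a1n0] := eqVneq (a1 E) 0.
    by rewrite !expr0n /= mul0r.
  pose x := - (a3 E / a1 E).
  have [y Hy] := @solve_monicpoly k 2
    (fun i => if i == 0%N then
       x ^+ 3 + a2 E * x ^+ 2 + a4 E * x + a6 E else 0) isT.
  rewrite 2!big_ord_recl big_ord0 /= expr0 mulr1 mul0r !addr0 in Hy.
  have x0 : a1 E * x + a3 E = 0 by rewrite /x; field.
  have oc : on_curve E (Some (x, y)).
    by rewrite /= -Hy -addrA -mulrDl x0 mul0r addr0.
  have ey : y == - y - a1 E * x - a3 E.
    rewrite -subr_eq0; apply/eqP; transitivity (y + y + (a1 E * x + a3 E)).
      by ring.
    by rewrite dbl x0 addr0.
  have /ss/(congr1 (@coords _ E)) // : mul_point 2 (Point oc) = origin E.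
  by rewrite two_torsion /= eqxx ey.
rewrite /j_invariant c4E mulf_eq0 invr_eq0 (negPf (discriminant_neq0 E)) orbF.
rewrite !expf_eq0 /= => /eqP a10; exists 2%N => // -[[[x y]|] oc]; last first.
  by move=> _; apply: val_inj.
rewrite two_torsion /= eqxx /=; case: eqP => // H _.
have a30 : a3 E = 0.
  transitivity (- y - (- y - a1 E * x - a3 E)); first by rewrite a10; ring.
  by rewrite -H -opprD dbl oppr0.
have /eqP[] := discriminant_neq0 E.
rewrite /discriminant /b2 /b4 /b6 /b8 a10 a30.
rewrite (_ : 4%:R = 2%:R * 2%:R :> k); last by ring.
rewrite (_ : 8%:R = 2%:R * 4%:R :> k); last by ring.
by rewrite two0; ring.
Qed.

End Curves.

Section Moduli.
Context (k : closedFieldType).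

Record pointed_curve := PointedCurve {
  curve : elliptic_curve k;
  marked : point curve;
  marked_neq0 : marked != origin curve }.

Definition isomorphic_pairs (x y : pointed_curve) : Prop :=
  exists (phi : point (curve x) -> point (curve y)) phi_,
  [/\ is_curve_isomorphism phi phi_, phi (origin _) = origin _ &
      phi (marked x) = marked y].

(* The k-points of the coarse spaces are the isomorphism classes. *)
Definition class1 (E : elliptic_curve k) : set (elliptic_curve k) :=
  [set E' | isomorphic E E'].

Definition class2 (x : pointed_curve) : set pointed_curve :=
  [set y | isomorphic_pairs x y].

Definition M12 : set (set pointed_curve) := range class2.

Definition forget (c : set pointed_curve) : set (elliptic_curve k) :=
  curve @` c.

Lemma forget_class2 (x : pointed_curve) : forget (class2 x) = class1 (curve x).
Proof.
apply/seteqP; split=> [_ [y [phi [phi_ [iso phi0 _]]] <-]|E].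
  by exists phi, phi_.
move=> [phi [phi_ [iso phi0]]].
have nz : phi (marked x) != origin E.
  apply: contra (marked_neq0 x) => /eqP; rewrite -phi0 => e.
  by case: iso => /bij_inj inj _ _ _; rewrite (inj _ _ e).
by exists (PointedCurve nz) => //; exists phi, phi_.
Qed.

Definition forget_fiber (s : set (elliptic_curve k)) : set (set pointed_curve) :=
  M12 `&` forget @^-1` [set s].

Definition lame_locus : set (set pointed_curve) :=
  [set class2 x | x in [set x | exists n, is_lame_curve_of_order (marked x) n]].

End Moduli.

Arguments lame_locus k : clear implicits.

(* Main.v *)
From HB Require Import structures.
Require Import Defs.
From mathcomp Require Import all_boot all_order all_algebra all_field.
From mathcomp Require Import ring zify.
From mathcomp Require Import boolp classical_sets.
Require Import Defs.

(** Why the theorem is true.  In characteristic 2 a curve is supersingular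
    exactly when [a1 = 0], and all curves with [a1 = 0] are isomorphic.  So the
    fiber consists of the pairs [(E, P)] with [a1 E = 0], and it is enough to
    show that [(E, P)] is a Lame curve if and only if [a1 E = 0].

    Over an algebraic closure of the prime field every point is torsion (its
    multiples have coordinates in one finite field).  Let [n] be the order of
    [P].  It is odd: by hypothesis for a Lame curve, and when [a1 = 0] because
    there is no 2-torsion.  Hence [P = Q + Q] with [Q] also killed by [n], and
    after translation by [Q] the function [f_P] becomes the function [F] with
    divisor [n(Q) - n(-Q)], which is much more symmetric.  Indeed
    [F = G / conj G], where [G] has divisor [n(Q) - n(0)] and [conj] is the
    involution of the function field induced by [-1].  Since [G] has its only
    pole at [0] it is a polynomial [U(x) + V(x) y], and in characteristic 2

      [F - 1 = (G - conj G) / conj G = V(x) (a1 x + a3) / conj G].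

    Everything follows from this formula.
    - At [0], a pole of [G] of odd order [n], the function [V(x) y] has order
      [-n], so that [F - 1] has order 3 if [a1 = 0] and order 1 otherwise.
    - At a point [T] of order 2, which exists only if [a1 <> 0], functions of
      [x] alone have even order, so [F - 1] has even order.
    - At any other point [R] besides [Q] and [-Q], write [n = 2m + 1].  The
      product [G * conj G] is a constant times [(x - x_Q)^n], hence
      [F = c (x - x_Q) B^2] with [B] a unit at [R].  Modulo squares of elements
      of the maximal ideal, squares are constants in characteristic 2, so
      [F - F(R)] has the same order as [x - x_R], namely 1.
    Therefore [F] has the required ramification when [a1 = 0], the third point
    being [0] (that is [Q] before translation), while index 3 never occurs when
    [a1 <> 0].

    The proof needs the elementary theory of the function field.  Each local
    ring is a discrete valuation ring ([parameter_exists]), with order function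
    [ord].  Functions regular at all affine points are polynomials in [x] and
    [y] ([affine_regularP]), so no function has exactly one simple pole
    ([principal_pt_inj]), while chords and tangents show that the divisor
    [(A) + (B) - (A + B) - (0)] is principal ([add_point_principal]); these two
    facts give the group law and the functions with prescribed divisors.  A
    surjective homomorphism of function fields that maps one local ring into
    another, preserving values, preserves orders ([dominate_reg], [ord_transfer]); this
    is how the involution, the translations ([translation_exists]) and the
    changes of variables ([cov_lift]) act on divisors.  Finally an isomorphism
    of curves respects supersingularity because a point [T] of order 2 is
    visible in the function field: [2(T) - 2(0)] is principal
    ([a1_eq0_isomorphic]). *)

Set Implicit Arguments.
Unset Strict Implicit.
Unset Printing Implicit Defensive.

Import Order.TTheory GRing.Theory Num.Theory.
Local Open Scope ring_scope.

(** * Presentations of the function field *)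
Section CoordField.
Context {k : fieldType}.

Definition lin (E : elliptic_curve k) : {poly k} := a1 E *: 'X + (a3 E)%:P.
Definition cubic (E : elliptic_curve k) : {poly k} :=
  'X ^+ 3 + a2 E *: 'X ^+ 2 + a4 E *: 'X + (a6 E)%:P.

(** The theory below uses only this interface: a field generated by [k[x]] and
    [y], in which [1] and [y] are independent over [k[x]].  Working with an
    abstract field keeps algebraic computations away from the quotient
    construction of [function_field]; see [standard] for the instance. *)
Record coord_field (E : elliptic_curve k) := CoordField {
  cf_field :> fieldType;
  polyf : {rmorphism {poly k} -> cf_field};
  cy : cf_field;
  cf_equation : cy ^+ 2 + polyf (lin E) * cy = polyf (cubic E);
  cf_span : forall f : cf_field, exists a b d : {poly k},
    polyf d != 0 /\ f = (polyf a + polyf b * cy) / polyf d;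
  cf_free : forall a b : {poly k}, polyf a + polyf b * cy = 0 ->
    a = 0 /\ b = 0 }.

Context {E : elliptic_curve k} (F : coord_field E).

Definition cst : {rmorphism k -> F} := polyf F \o polyC.
Definition cx : F := polyf F 'X.
Arguments cst : simpl never.

Lemma polyf_eq0 p : (polyf F p == 0) = (p == 0).
Proof.
apply/eqP/eqP => [e|->]; last by rewrite rmorph0.
by have [] := @cf_free E F p 0; rewrite ?rmorph0 ?mul0r ?addr0.
Qed.

Lemma cst_eq0 c : (cst c == 0) = (c == 0).
Proof. by rewrite /cst /= polyf_eq0 polyC_eq0. Qed.

Lemma polyf_horner p : polyf F p = (map_poly cst p).[cx].
Proof.
elim/poly_ind: p => [|p c IH]; first by rewrite !rmorph0 hornerC.
by rewrite !rmorphD !rmorphM /= IH map_polyX map_polyC !hornerE.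
Qed.

Lemma polyf_lin : polyf F (lin E) = cst (a1 E) * cx + cst (a3 E).
Proof. by rewrite /lin rmorphD /= -mul_polyC rmorphM. Qed.

Lemma polyf_cubic : polyf F (cubic E) =
  cx ^+ 3 + cst (a2 E) * cx ^+ 2 + cst (a4 E) * cx + cst (a6 E).
Proof. by rewrite /cubic !rmorphD /= -!mul_polyC !rmorphM /=; ring. Qed.

Lemma weierstrassE : cy F ^+ 2 + cst (a1 E) * cx * cy F + cst (a3 E) * cy F
  = cx ^+ 3 + cst (a2 E) * cx ^+ 2 + cst (a4 E) * cx + cst (a6 E).
Proof. by rewrite -polyf_cubic -cf_equation polyf_lin; ring. Qed.

Lemma cy_neq0 : cy F != 0.
Proof.
apply/eqP => y0; have [] := @cf_free E F 0 1.
  by rewrite y0 rmorph0 mulr0 addr0.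
by move=> _ /eqP; rewrite oner_eq0.
Qed.

Lemma cx_cst_neq0 c : cx - cst c != 0.
Proof. by rewrite /cst /cx /= -rmorphB polyf_eq0 polyXsubC_eq0. Qed.

Lemma cx_neq0 : cx != 0.
Proof. by rewrite polyf_eq0 polyX_eq0. Qed.

Section Lift.
Context (L : fieldType) (kappa : {rmorphism {poly k} -> L}) (Y : L).
Hypothesis kappa_neq0 : forall p, p != 0 -> kappa p != 0.
Hypothesis Y_on_curve : Y ^+ 2 + kappa (lin E) * Y = kappa (cubic E).

Let cf_rep (f : F) : { t : {poly k} * {poly k} * {poly k} |
  polyf F t.2 != 0 /\ f
    = (polyf F t.1.1 + polyf F t.1.2 * cy F) / polyf F t.2 }.
Proof. by apply: cid; have [a [b [d H]]] := cf_span f; exists (a, b, d). Qed.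

Definition cf_lift (f : F) : L :=
  let t := sval (cf_rep f) in (kappa t.1.1 + kappa t.1.2 * Y) / kappa t.2.

Lemma cf_liftE a b d : d != 0 ->
  cf_lift ((polyf F a + polyf F b * cy F) / polyf F d)
    = (kappa a + kappa b * Y) / kappa d.
Proof.
move=> d0; rewrite /cf_lift; case: cf_rep => -[[a' b'] d'] /= [d0' e].
rewrite polyf_eq0 in d0'.
have pd0 : polyf F d != 0 by rewrite polyf_eq0.
have pd0' : polyf F d' != 0 by rewrite polyf_eq0.
have [] := @cf_free E F (a * d' - a' * d) (b * d' - b' * d).
  move/eqP: e; rewrite eqr_div // => /eqP e.
  rewrite !rmorphB !rmorphM /=.
  transitivity ((polyf F a + polyf F b * cy F) * polyf F d' - (polyf F a'
    + polyf F b' * cy F) * polyf F d); first by ring.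
  by rewrite e subrr.
move=> /subr0_eq/(congr1 kappa) ea /subr0_eq/(congr1 kappa) eb.
apply/eqP; rewrite eqr_div ?kappa_neq0 //; apply/eqP.
rewrite !rmorphM in ea eb.
transitivity (kappa a' * kappa d + (kappa b' * kappa d) * Y); first by ring.
by rewrite -ea -eb; ring.
Qed.

(** The universal property: the field is the fraction field of [k[x, y]] modulo
    the equation, so a point of the curve over [L] whose first coordinate is
    transcendental extends to a homomorphism. *)
Lemma cf_lift_exists : exists phi : {rmorphism F -> L},
  (forall p, phi (polyf F p) = kappa p) /\ phi (cy F) = Y.
Proof.
have lift_add : zmod_morphism cf_lift.
  move=> f g; have [a [b [d [d0 ->]]]] := cf_span f.
  have [a' [b' [d' [d0' ->]]]] := cf_span g.
  have -> : (polyf F a + polyf F b * cy F) / polyf F d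
     - (polyf F a' + polyf F b' * cy F) / polyf F d'
     = (polyf F (a * d' - a' * d)
       + polyf F (b * d' - b' * d) * cy F) / polyf F (d * d').
    by rewrite !rmorphB !rmorphM /=; field; rewrite d0 d0'.
  rewrite !polyf_eq0 in d0 d0'.
  rewrite !cf_liftE ?mulf_neq0 // !rmorphB !rmorphM /=; field.
  by rewrite !kappa_neq0.
have lift_poly a b : cf_lift (polyf F a + polyf F b * cy F)
  = kappa a + kappa b * Y.
  by have := cf_liftE a b (oner_neq0 {poly k}); rewrite !rmorph1 !divr1.
have lift_mul : monoid_morphism cf_lift.
  split=> [|f g].
    by have := lift_poly 1 0; rewrite !rmorph0 !mul0r !addr0 !rmorph1.
  have [a [b [d [d0 ->]]]] := cf_span f.
  have [a' [b' [d' [d0' ->]]]] := cf_span g.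
  move: Y_on_curve (cf_equation F); move: (lin E) (cubic E) => li cu eY ey.
  have -> : (polyf F a + polyf F b * cy F) / polyf F d
     * ((polyf F a' + polyf F b' * cy F) / polyf F d')
     = (polyf F (a * a' + b * b' * cu) + polyf F (a * b'
       + a' * b - b * b' * li) * cy F)
        / polyf F (d * d').
    by rewrite !(rmorphB, rmorphD, rmorphM) /= -ey; field; rewrite d0 d0'.
  rewrite !polyf_eq0 in d0 d0'.
  rewrite !cf_liftE ?mulf_neq0 // !(rmorphB, rmorphD, rmorphM) /= -eY; field.
  by rewrite !kappa_neq0.
pose add := GRing.isZmodMorphism.Build _ _ cf_lift lift_add.
pose mul := GRing.isMonoidMorphism.Build _ _ cf_lift lift_mul.
pose phi : {rmorphism F -> L} := HB.pack cf_lift add mul.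
exists phi; split=> [p|] /=.
  by have := lift_poly p 0; rewrite !rmorph0 !mul0r !addr0.
by have := lift_poly 0 1; rewrite !rmorph0 !rmorph1 !mul1r !add0r.
Qed.

End Lift.

Lemma cf_rmorph_eq (L : fieldType) (phi psi : {rmorphism F -> L}) :
  (forall p, phi (polyf F p) = psi (polyf F p)) -> phi (cy F) = psi (cy F) ->
  phi =1 psi.
Proof.
move=> ex ey f; have [a [b [d [_ ->]]]] := cf_span f.
rewrite 2!fmorph_div !ex; congr (_ / _).
by rewrite 2!rmorphD !ex 2!rmorphM ex ey.
Qed.

End CoordField.
Arguments cst {k E} F : simpl never.
Arguments cx {k E} F : simpl never.

(** * Values of functions at points *)
Section Bivariate.
Context (k : fieldType) (L : fieldType) (phi : {rmorphism k -> L}) (s t : L).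

Definition eval_xy : {rmorphism {poly {poly k}} -> L} :=
  horner_eval s \o horner_eval t%:P \o map_poly (map_poly phi).

Lemma eval_xyE g : eval_xy g = eval2 (map_poly (map_poly phi) g) s t.
Proof. by []. Qed.

Lemma eval_xy_Y : eval_xy 'X = t.
Proof. by rewrite eval_xyE /eval2 map_polyX hornerX hornerC. Qed.

Lemma eval_xy_C p : eval_xy p%:P = (map_poly phi p).[s].
Proof. by rewrite eval_xyE /eval2 map_polyC hornerC. Qed.

Lemma eval_xy_X : eval_xy ('X%:P) = s.
Proof. by rewrite eval_xy_C map_polyX hornerX. Qed.

Lemma eval_xy_CC c : eval_xy (c%:P%:P) = phi c.
Proof. by rewrite eval_xy_C map_polyC hornerC. Qed.

Lemma eval_xy_ind (P : L -> Prop) : (forall c, P (phi c)) -> P s -> P t ->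
  (forall f g, P f -> P g -> P (f + g)) ->
  (forall f g, P f -> P g -> P (f * g)) -> forall g, P (eval_xy g).
Proof.
move=> Pc Ps Pt PD PM; elim/poly_ind => [|g p IH].
  by rewrite rmorph0 -(rmorph0 phi); exact: Pc.
rewrite rmorphD rmorphM eval_xy_Y eval_xy_C; apply: (PD); first exact: PM.
elim/poly_ind: p => [|p c IHp];
  first by rewrite rmorph0 horner0 -(rmorph0 phi); exact: Pc.
rewrite rmorphD rmorphM /= map_polyX map_polyC hornerD hornerM hornerX hornerC.
by apply: (PD _ _ _ (Pc c)); exact: PM.
Qed.

End Bivariate.

(** The maximal ideal of the point [(s0, t0)] of the plane is generated by the
    two translated coordinates. *)
Lemma eval2_split (k : fieldType) (g : {poly {poly k}}) s0 t0 :
  exists g1 g2, g = (eval2 g s0 t0)%:P%:P + ('X%:P - s0%:P%:P) * g1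
                    + ('X - t0%:P%:P) * g2.
Proof.
have /factor_theorem [g2 e2] : root (g - (g.[t0%:P])%:P) t0%:P.
  by rewrite rootE !hornerE subrr.
have /factor_theorem [g1 e1] : root (g.[t0%:P] - (eval2 g s0 t0)%:P) s0.
  by rewrite rootE !hornerE subrr.
exists g1%:P, g2; move: e1 e2; move: (eval2 g s0 t0) (g.[_]) => c h.
move=> /eqP; rewrite subr_eq => /eqP -> /eqP; rewrite subr_eq => /eqP ->.
by rewrite !(polyCD, polyCM, polyCN); ring.
Qed.

Section LocalRing.
Context {k : closedFieldType} {E : elliptic_curve k} (F : coord_field E).
Implicit Types (R : point E) (f g : F) (c : k).
Local Notation C := (cst F).
Local Notation x := (cx F).
Local Notation y := (cy F).

Definition cchart R : F * F :=
  if coords R is Some _ then (x, y) else (x / y, y^-1).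

Definition ceval R : {rmorphism {poly {poly k}} -> F} :=
  eval_xy C (cchart R).1 (cchart R).2.

Definition veval R : {rmorphism {poly {poly k}} -> k} :=
  eval_xy idfun (chart_value R).1 (chart_value R).2.

Lemma vevalE R (g : {poly {poly k}}) : veval R g = eval_value R g.
Proof.
rewrite /veval eval_xyE /eval_value map_poly_id // => p _.
by rewrite map_poly_id.
Qed.

(** Divide by the equation, which is monic in [y]: the remainder [a + b y] is zero
    in the function field only if [a = b = 0].  So a relation between [x] and [y]
    is a multiple of the equation, which holds at every affine point. *)
Lemma eval_xy_affine_eq0 (g : {poly {poly k}}) (x0 y0 : k) :
  on_curve E (Some (x0, y0)) ->
  eval_xy C x y g = 0 -> eval_xy idfun x0 y0 g = 0.
Proof.
move=> oc; pose W : {poly {poly k}} :=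
  'X ^+ 2 + ((lin E)%:P * 'X - (cubic E)%:P).
have sW : (size ((lin E)%:P * 'X - (cubic E)%:P :
  {poly {poly k}})%R < size ('X ^+ 2 : {poly {poly k}})%R)%N.
  rewrite size_polyXn ltnS (leq_trans (size_polyD _ _)) // geq_max size_polyN.
  rewrite (leq_trans (size_polyC_leq1 _)) // andbT.
  rewrite (leq_trans (size_polyMleq _ _)) // size_polyX addn2 /=.
  by rewrite ltnS size_polyC_leq1.
have mW : W \is monic by rewrite monicE lead_coefDl // lead_coefXn.
have sizeW : size W = 3%N by rewrite size_polyDl // size_polyXn.
have W0 : eval_xy C x y W = 0.
  rewrite rmorphD rmorphB !rmorphM eval_xy_Y !eval_xy_C.
  by rewrite -!polyf_horner -cf_equation; ring.
have W1 : eval_xy idfun x0 y0 W = 0.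
  rewrite rmorphD rmorphB !rmorphM eval_xy_Y !eval_xy_C.
  rewrite !map_poly_id // /lin /cubic !hornerE.
  move/eqP: oc => /= oc.
  transitivity (y0 ^+ 2 + a1 E * x0 * y0 + a3 E * y0
    - (x0 ^+ 3 + a2 E * x0 ^+ 2 + a4 E * x0 + a6 E)); first by ring.
  by rewrite oc subrr.
clear sW; clearbody W.
rewrite (Pdiv.RingMonic.rdivp_eq mW g); set q := Pdiv.CommonRing.rdivp _ _.
set r := Pdiv.CommonRing.rmodp _ _.
rewrite !rmorphD !rmorphM W0 W1 !mulr0 !add0r.
have sr : (size r <= 2)%N.
  by rewrite -ltnS -sizeW Pdiv.CommonRing.ltn_rmodp -size_poly_eq0 sizeW.
have -> : r = (r`_0)%:P + (r`_1)%:P * 'X.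
  apply/polyP => -[|[|i]];
    rewrite coefD coefC coefCM coefX ?mulr0 ?addr0 ?mulr1 ?add0r //.
  by rewrite nth_default // (leq_trans sr).
rewrite !rmorphD !rmorphM !eval_xy_Y !eval_xy_C -!polyf_horner.
by move=> /cf_free [-> ->]; rewrite !rmorph0 !horner0 mul0r addr0.
Qed.

(** With weight 2 for [x] and 3 for [y], these are the quotients of negative
    weight, i.e., the maximal ideal at infinity.  Membership is tested by
    degrees, which shows directly that they form a proper ideal in a ring
    containing [x / y] and [1 / y]. *)
Definition vanishing_at_infinity f := exists a b d : {poly k},
  [/\ f = (polyf F a + polyf F b * y) / polyf F d, (size a < size d)%N
    & (size b < (size d).-1)%N].

Lemma polyf_neq0_of_size (d : {poly k}) n : (n < size d)%N -> polyf F d != 0.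
Proof. by move=> h; rewrite polyf_eq0 -size_poly_gt0 (leq_ltn_trans _ h). Qed.

Lemma size_mulS (p q : {poly k}) : p != 0 -> q != 0 ->
  (size (p * q)%R).+1 = (size p + size q)%N.
Proof.
move=> p0 q0; rewrite size_mul // prednK //.
by rewrite addn_gt0 size_poly_gt0 p0.
Qed.

Lemma size_mul_le (p q : {poly k}) : (size (p * q)%R <= (size p + size q).-1)%N.
Proof. exact: size_polyMleq. Qed.

Lemma size_mul_lt (p q : {poly k}) m n : (size p < m)%N -> (size q < n)%N ->
  size (p * q)%R = 0%N \/ ((size (p * q)%R).+2 < m + n)%N.
Proof.
move=> hp hq; have [->|p0] := eqVneq p 0; first by rewrite mul0r size_poly0;
  left.
have [->|q0] := eqVneq q 0; first by rewrite mulr0 size_poly0; left.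
by right; rewrite size_mulS //; move: (size p) (size q) hp hq; lia.
Qed.

Lemma size_add (p q : {poly k}) n : (size p < n)%N -> (size q < n)%N ->
  (size (p + q)%R < n)%N.
Proof. by move=> hp hq;
  rewrite (leq_ltn_trans (size_polyD _ _)) // gtn_max hp. Qed.

Lemma size_lin : (size (lin E) <= 2)%N.
Proof.
rewrite /lin (leq_trans (size_polyD _ _)) // geq_max.
rewrite (leq_trans (size_scale_leq _ _)) ?size_polyX //=.
by rewrite (leq_trans (size_polyC_leq1 _)).
Qed.

Lemma size_cubic : size (cubic E) = 4%N.
Proof.
rewrite /cubic -!addrA size_polyDl size_polyXn //.
rewrite (leq_ltn_trans (size_polyD _ _)) // gtn_max.
rewrite (leq_ltn_trans (size_scale_leq _ _)) ?size_polyXn //=.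
rewrite (leq_ltn_trans (size_polyD _ _)) // gtn_max.
rewrite (leq_ltn_trans (size_scale_leq _ _)) ?size_polyX //=.
by rewrite (leq_ltn_trans (size_polyC_leq1 _)).
Qed.

Lemma vanishing_at_infinityD f g : vanishing_at_infinity f ->
  vanishing_at_infinity g -> vanishing_at_infinity (f + g).
Proof.
move=> [a [b [d [-> la lb]]]] [a' [b' [d' [-> la' lb']]]].
have d0 := polyf_neq0_of_size la; have d0' := polyf_neq0_of_size la'.
exists (a * d' + a' * d), (b * d' + b' * d), (d * d'); split.
- by rewrite !rmorphD !rmorphM /=; field; rewrite d0 d0'.
- rewrite polyf_eq0 in d0; rewrite polyf_eq0 in d0'.
  have sd := size_mulS d0 d0'; apply: size_add.
  + have := size_mul_lt la (ltnSn (size d')).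
    by move: (size _) (size _) (size _) (size _) la la' sd; lia.
  + have := size_mul_lt la' (ltnSn (size d)).
    by move: (size _) (size _) (size _) (size _) la la' sd; lia.
rewrite polyf_eq0 in d0; rewrite polyf_eq0 in d0'.
have sd := size_mulS d0 d0'; apply: size_add.
+ have := size_mul_lt lb (ltnSn (size d')).
  by move: (size _) (size _) (size _) (size _) lb lb' sd; lia.
+ have := size_mul_lt lb' (ltnSn (size d)).
  by move: (size _) (size _) (size _) (size _) lb lb' sd; lia.
Qed.

Lemma vanishing_at_infinityM f g : vanishing_at_infinity f ->
  vanishing_at_infinity g -> vanishing_at_infinity (f * g).
Proof.
move=> [a [b [d [-> la lb]]]] [a' [b' [d' [-> la' lb']]]].
have d0 := polyf_neq0_of_size la; have d0' := polyf_neq0_of_size la'.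
have := cf_equation F; have := size_cubic; have := size_lin.
move: (lin E) (cubic E) => li cu sl sc eq.
have [nl enl snl] : exists2 nl, polyf F nl = - polyf F li & (size nl <= 2)%N.
  by exists (- li); rewrite ?rmorphN // size_polyN.
exists (a * a' + b * b' * cu), (a * b' + a' * b + b * b' * nl), (d * d'); split.
- by rewrite !rmorphD !rmorphM /= enl -eq; field; rewrite d0 d0'.
- rewrite polyf_eq0 in d0; rewrite polyf_eq0 in d0'.
  have sd := size_mulS d0 d0'; have sbb := size_mul_lt lb lb'; apply: size_add.
    by have := size_mul_lt la la'; lia.
  have := size_mul_le (b * b') cu; rewrite sc.
  have [->|bb0] := eqVneq (b * b') 0; first by rewrite mul0r size_poly0; lia.
  by move: bb0; rewrite -size_poly_gt0; lia.
rewrite polyf_eq0 in d0; rewrite polyf_eq0 in d0'.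
have sd := size_mulS d0 d0'; have sbb := size_mul_lt lb lb'; apply: size_add;
  first apply: size_add.
- by have := size_mul_lt la lb'; lia.
- by have := size_mul_lt la' lb; lia.
have := size_mul_le (b * b') nl.
have [->|bb0] := eqVneq (b * b') 0; first by rewrite mul0r size_poly0; lia.
have : (0 < size (b * b')%R)%N by rewrite size_poly_gt0.
move: lb lb' sd sbb snl;
  move: (size (b * b' * nl)%R) (size (d * d')%R) (size (b * b')%R) (size nl).
by lia.
Qed.

Lemma vanishing_at_infinityZ c f : vanishing_at_infinity f ->
  vanishing_at_infinity (C c * f).
Proof.
move=> [a [b [d [-> la lb]]]]; exists (c%:P * a), (c%:P * b), d; split.
- by rewrite !rmorphM /= mulrA mulrDr mulrA.
- by rewrite mul_polyC (leq_ltn_trans (size_scale_leq _ _)).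
- by rewrite mul_polyC (leq_ltn_trans (size_scale_leq _ _)).
Qed.

Lemma vanishing_at_infinity1F : ~ vanishing_at_infinity 1.
Proof.
move=> [a [b [d [e la lb]]]]; have d0 := polyf_neq0_of_size la.
have [] := @cf_free _ E F (a - d) b.
  rewrite rmorphB /=; transitivity ((polyf F a + polyf F b * y) - polyf F d);
    first by ring.
  by move/eqP: e; rewrite -[X in X == _](divff d0) eqr_div // (inj_eq (mulIf
    d0)) eq_sym => /eqP ->; rewrite subrr.
by move=> /subr0_eq ea; rewrite ea ltnn in la.
Qed.

Let yyh : y * (polyf F (lin E) + y) = polyf F (cubic E).
Proof. by rewrite -cf_equation; ring. Qed.

Let yV : y^-1 = (polyf F (lin E) + y) / polyf F (cubic E).
Proof.
have c0 : polyf F (cubic E) != 0 by rewrite polyf_eq0 -size_poly_eq0 size_cubic.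
by apply: (mulfI (cy_neq0 F)); rewrite divff ?cy_neq0 // mulrA yyh divff.
Qed.

Lemma vanishing_at_infinity_invy : vanishing_at_infinity y^-1.
Proof.
exists (lin E), 1, (cubic E); rewrite yV size_cubic rmorph1 mul1r; split=> //.
  exact: (leq_ltn_trans size_lin).
by rewrite size_poly1.
Qed.

Lemma vanishing_at_infinity_xy : vanishing_at_infinity (x / y).
Proof.
exists ('X * lin E), 'X, (cubic E); rewrite yV size_cubic size_polyX;
  split=> //.
  by rewrite rmorphM mulrA mulrDr.
rewrite (leq_ltn_trans (size_polyMleq _ _)) // size_polyX.
by have := size_lin; move: (size _); lia.
Qed.

(** The terms of the relation other than the constant one belong to the maximal
    ideal at infinity, and a nonzero constant does not. *)
Lemma eval_xy_inf_eq0 (g : {poly {poly k}}) :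
  eval_xy C (x / y) y^-1 g = 0 -> eval_xy idfun 0 0 g = 0.
Proof.
have P (g' : {poly {poly k}}) :
  exists c, vanishing_at_infinity (eval_xy C (x / y) y^-1 g' - C c).
  move: g'; apply: (eval_xy_ind (P := fun u =>
    exists c, vanishing_at_infinity (u - C c))).
  - by move=> c; exists c; exists 0, 0, ('X ^+ 2);
    rewrite subrr rmorph0 mul0r addr0 mul0r size_poly0 size_polyXn.
  - by exists 0; rewrite rmorph0 subr0; exact: vanishing_at_infinity_xy.
  - by exists 0; rewrite rmorph0 subr0; exact: vanishing_at_infinity_invy.
  - move=> u v [c hc] [d hd]; exists (c + d).
    by rewrite rmorphD opprD addrACA; exact: vanishing_at_infinityD.
  - move=> u v [c hc] [d hd]; exists (c * d).
    have -> : u * v - C (c * d)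
      = (u - C c) * (v - C d) + (C d * (u - C c) + C c * (v - C d)).
      by rewrite rmorphM /=; ring.
    by apply: vanishing_at_infinityD;
      [exact: vanishing_at_infinityM|apply: vanishing_at_infinityD;
      exact: vanishing_at_infinityZ].
have Q s (g' : {poly {poly k}}) : vanishing_at_infinity s ->
  vanishing_at_infinity (s * eval_xy C (x / y) y^-1 g').
  move=> hs; have [c hc] := P g'.
  have -> : s * eval_xy C (x / y) y^-1 g'
    = s * (eval_xy C (x / y) y^-1 g' - C c) + C c * s by ring.
  by apply: vanishing_at_infinityD;
    [exact: vanishing_at_infinityM|exact: vanishing_at_infinityZ].
have [g1 [g2 e]] := eval2_split g 0 0.
have e' : eval_xy idfun 0 0 g = eval2 g 0 0.
  by rewrite eval_xyE map_poly_id // => p _; rewrite map_poly_id.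
rewrite e'; set c := eval2 g 0 0 in e *; rewrite e.
rewrite !rmorphD !rmorphM !rmorphB eval_xy_X eval_xy_Y !eval_xy_CC /= rmorph0
  !subr0 => e0.
apply/eqP/negP => /negP c0; apply: vanishing_at_infinity1F.
have -> : 1 = C (- c^-1) * (x / y * eval_xy C (x / y) y^-1 g1
  + y^-1 * eval_xy C (x / y) y^-1 g2).
  move: e0; rewrite -addrA => /eqP; rewrite addrC addr_eq0 => /eqP ->.
  by rewrite mulrN -rmorphM mulNr mulVf // rmorphN rmorph1 opprK.
by apply: vanishing_at_infinityZ; apply: vanishing_at_infinityD; apply: Q;
  [exact: vanishing_at_infinity_xy|exact: vanishing_at_infinity_invy].
Qed.

Lemma ceval_eq0 R (g : {poly {poly k}}) : ceval R g = 0 -> veval R g = 0.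
Proof.
rewrite /ceval /veval /cchart /chart_value.
case: R => [[[x0 y0]|] /= oc]; first exact: eval_xy_affine_eq0.
exact: eval_xy_inf_eq0.
Qed.

End LocalRing.

Section Values.
Context {k : closedFieldType} {E : elliptic_curve k} (F : coord_field E).
Implicit Types (R : point E) (f g : F) (c d : k).
Local Notation C := (cst F).
Local Notation x := (cx F).
Local Notation y := (cy F).

(** A function is regular at [R] when it has a value there; tracking the value
    makes the residue map explicit.  The quotient defining the value does not
    depend on the chosen fraction, by [ceval_eq0]. *)
Definition has_value R f c := exists g h : {poly {poly k}},
  [/\ veval R h != 0, f = ceval F R g / ceval F R h &
    c = veval R g / veval R h].

Definition regular R f := exists c, has_value R f c.

Lemma ceval_neq0 R (h : {poly {poly k}}) : veval R h != 0 -> ceval F R h != 0.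
Proof. by apply: contra_neq; exact: ceval_eq0. Qed.

Lemma hv_unique R f c d : has_value R f c -> has_value R f d -> c = d.
Proof.
move=> [g [h [h0 -> ->]]] [g' [h' [h0' e ->]]].
have ch := ceval_neq0 h0; have ch' := ceval_neq0 h0'.
apply/eqP; rewrite eqr_div // -subr_eq0 -!rmorphM -rmorphB; apply/eqP.
apply: (@ceval_eq0 _ _ F); rewrite rmorphB !rmorphM.
by move/eqP: e; rewrite eqr_div // => /eqP ->; rewrite subrr.
Qed.

Lemma hv_ceval R (g : {poly {poly k}}) : has_value R (ceval F R g) (veval R g).
Proof. by exists g, 1; rewrite !rmorph1 !divr1 oner_neq0. Qed.

Lemma hv_cst R c : has_value R (C c) c.
Proof. by have := hv_ceval R c%:P%:P; rewrite /ceval /veval !eval_xy_CC. Qed.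

Lemma hv0 R : has_value R 0 0. Proof. by rewrite -(rmorph0 C);
  exact: hv_cst. Qed.
Lemma hv1 R : has_value R 1 1. Proof. by rewrite -(rmorph1 C);
  exact: hv_cst. Qed.

Lemma hvD R f g c d : has_value R f c -> has_value R g d ->
  has_value R (f + g) (c + d).
Proof.
move=> [u [h [h0 -> ->]]] [u' [h' [h0' -> ->]]].
exists (u * h' + u' * h), (h * h'); rewrite rmorphM mulf_neq0 //; split=> //.
  by rewrite addf_div ?ceval_neq0 // rmorphD !rmorphM.
by rewrite addf_div // rmorphD !rmorphM.
Qed.

Lemma hvM R f g c d : has_value R f c -> has_value R g d ->
  has_value R (f * g) (c * d).
Proof.
move=> [u [h [h0 -> ->]]] [u' [h' [h0' -> ->]]].
exists (u * u'), (h * h'); rewrite rmorphM mulf_neq0 //; split=> //.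
  by rewrite mulf_div !rmorphM.
by rewrite mulf_div !rmorphM.
Qed.

Lemma hvN R f c : has_value R f c -> has_value R (- f) (- c).
Proof.
by move=> h; have := hvM (hv_cst R (-1)) h; rewrite rmorphN rmorph1 !mulN1r.
Qed.

Lemma hvB R f g c d : has_value R f c -> has_value R g d ->
  has_value R (f - g) (c - d).
Proof. by move=> hf hg; apply: hvD => //; exact: hvN. Qed.

Lemma hvX R f c n : has_value R f c -> has_value R (f ^+ n) (c ^+ n).
Proof.
move=> h; elim: n => [|n IH]; first by rewrite !expr0; exact: hv1.
by rewrite !exprS; exact: hvM.
Qed.

Lemma hv_neq0 R f c : c != 0 -> has_value R f c -> f != 0.
Proof. by move=> c0 h; apply: contra_neq c0 => f0; apply: (hv_unique h);
  rewrite f0; exact: hv0. Qed.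

Lemma hvV R f c : c != 0 -> has_value R f c -> has_value R f^-1 c^-1.
Proof.
move=> c0 h; have f0 := hv_neq0 c0 h; move: h c0 f0 => [u [h [h0 -> ->]]].
rewrite mulf_eq0 invr_eq0 (negPf h0) orbF => u0 _.
by exists h, u; rewrite !invf_div.
Qed.

Lemma hv_chart1 R : has_value R (cchart F R).1 (chart_value R).1.
Proof. by have := hv_ceval R 'X%:P; rewrite /ceval /veval !eval_xy_X. Qed.

Lemma hv_chart2 R : has_value R (cchart F R).2 (chart_value R).2.
Proof. by have := hv_ceval R 'X; rewrite /ceval /veval !eval_xy_Y. Qed.

Lemma hv0_split R f : has_value R f 0 ->
  exists f1 f2, [/\ regular R f1, regular R f2 &
  f = ((cchart F R).1 - C (chart_value R).1) * f1
    + ((cchart F R).2 - C (chart_value R).2) * f2].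
Proof.
move=> [g [h [h0 -> /esym/eqP]]].
rewrite mulf_eq0 invr_eq0 (negPf h0) orbF => /eqP g0.
have [g1 [g2]] := eval2_split g (chart_value R).1 (chart_value R).2.
have -> : eval2 g (chart_value R).1 (chart_value R).2 = 0.
  by move: g0; rewrite vevalE.
rewrite !rmorph0 add0r => ->.
exists (ceval F R g1 / ceval F R h), (ceval F R g2 / ceval F R h); split.
- by exists (veval R g1 / veval R h), g1, h.
- by exists (veval R g2 / veval R h), g2, h.
rewrite rmorphD !rmorphM !rmorphB /ceval !eval_xy_X !eval_xy_Y !eval_xy_CC
  -/(ceval F R).
by rewrite mulrDl !mulrA.
Qed.

Lemma regM R f g : regular R f -> regular R g -> regular R (f * g).
Proof. by move=> [c hc] [d hd]; exists (c * d); exact: hvM. Qed.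
Lemma regD R f g : regular R f -> regular R g -> regular R (f + g).
Proof. by move=> [c hc] [d hd]; exists (c + d); exact: hvD. Qed.
Lemma regX R f n : regular R f -> regular R (f ^+ n).
Proof. by move=> [c hc]; exists (c ^+ n); exact: hvX. Qed.

Lemma reg_hv0M R f g : has_value R f 0 -> regular R g -> has_value R (f * g) 0.
Proof. by move=> hf [c hg]; rewrite -(mul0r c); exact: hvM. Qed.

(** The derivative of [y^2 + a1 x y + a3 y] with respect to [y], and that of
    [x^3 + a2 x^2 + a4 x + a6 - a1 x y] with respect to [x], at [(x0, y0)].  A
    point is fixed by negation if and only if [dy] vanishes there, see
    [dy_neg]. *)
Definition dy (x0 y0 : k) := 2%:R * y0 + a1 E * x0 + a3 E.
Definition dx (x0 y0 : k) :=
  3%:R * x0 ^+ 2 + 2%:R * a2 E * x0 + a4 E - a1 E * y0.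

(** The discriminant is invariant under translation of the coordinates, and it
    vanishes for a curve whose coefficients [a3], [a4] and [a6] are zero. *)
Lemma nonsingular (x0 y0 : k) : on_curve E (Some (x0, y0)) ->
  dy x0 y0 = 0 -> dx x0 y0 != 0.
Proof.
move=> /eqP oc; rewrite /dy /dx => ey; apply/eqP => ex.
have /eqP[] := discriminant_neq0 E.
pose W' := Weierstrass (a1 E) (a2 E + 3%:R * x0) (2%:R * y0 + a1 E * x0 + a3 E)
  (3%:R * x0 ^+ 2 + 2%:R * a2 E * x0 + a4 E - a1 E * y0)
  (x0 ^+ 3 + a2 E * x0 ^+ 2 + a4 E * x0 + a6 E - (y0 ^+ 2 + a1 E * x0 * y0
    + a3 E * y0)).
have -> : discriminant E = discriminant W'.
  rewrite /discriminant /b2 /b4 /b6 /b8 /W' /=.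
  move: (a1 E) (a2 E) (a3 E) (a4 E) (a6 E) => A1 A2 A3 A4 A6.
  ring.
rewrite /discriminant /b2 /b4 /b6 /b8 /W' /= ey ex oc subrr; ring.
Qed.

End Values.
Arguments dy {k} E x0 y0.
Arguments dx {k} E x0 y0.

(** * Discrete valuations *)
Section Uniformizer.
Context {k : closedFieldType} {E : elliptic_curve k} (F : coord_field E).
Implicit Types (R : point E) (f g : F) (c d : k).
Local Notation C := (cst F).
Local Notation x := (cx F).
Local Notation y := (cy F).
Local Notation has_value := (@has_value k E F).
Local Notation regular := (@regular k E F).

(** The last clause (every function becomes regular after multiplication by a
    power of [t]) replaces the Noetherian argument by which the powers of the
    maximal ideal have trivial intersection. *)
Definition is_local_parameter R (t : F) := [/\ t != 0, has_value R t 0,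
  forall f, has_value R f 0 -> exists2 g, regular R g & f = g * t &
  forall f, exists j, regular R (f * t ^+ j)].

(** It suffices to treat generators: [t] divides the two coordinates of the
    chart, which generate the maximal ideal, and [x], [y] and the inverses of
    the linear factors of a denominator generate the field. *)
Lemma is_local_parameter_crit R (t : F) : t != 0 -> has_value R t 0 ->
  regular R (((cchart F R).1 - C (chart_value R).1) / t) ->
  regular R (((cchart F R).2 - C (chart_value R).2) / t) ->
  (exists j, regular R (x * t ^+ j)) -> (exists j, regular R (y * t ^+ j)) ->
  (forall c, exists j, regular R ((x - C c)^-1 * t ^+ j)) ->
    is_local_parameter R t.
Proof.
move=> t0 ht r1 r2 jx jy jV.
have rt : regular R t by exists 0.
have JM f g : (exists j, regular R (f * t ^+ j)) ->
  (exists j, regular R (g * t ^+ j)) ->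
    exists j, regular R (f * g * t ^+ j).
  by move=> [i hi] [j hj]; exists (i + j)%N; rewrite exprD mulrACA; exact: regM.
have JD f g : (exists j, regular R (f * t ^+ j)) ->
  (exists j, regular R (g * t ^+ j)) ->
    exists j, regular R ((f + g) * t ^+ j).
  move=> [i hi] [j hj]; exists (i + j)%N; rewrite mulrDl; apply: regD.
    by rewrite exprD mulrA; apply: regM => //; exact: regX.
  by rewrite addnC exprD mulrA; apply: regM => //; exact: regX.
have JC c : exists j, regular R (C c * t ^+ j).
  by exists 0%N; rewrite expr0 mulr1; exists c; exact: hv_cst.
have Jp p : exists j, regular R (polyf F p * t ^+ j).
  rewrite polyf_horner; elim/poly_ind: p => [|p c IH].
    by rewrite rmorph0 hornerC -(rmorph0 C); exact: JC.
  rewrite rmorphD rmorphM /= map_polyX map_polyC !hornerE.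
  by apply: (JD); [exact: JM|exact: JC].
split=> // [f hf|f].
  have [f1 [f2 [rf1 rf2 e]]] := hv0_split hf.
  exists (((cchart F R).1 - C (chart_value R).1) / t * f1 +
          ((cchart F R).2 - C (chart_value R).2) / t * f2).
    by apply: regD; exact: regM.
  by rewrite {1}e; field.
have [a [b [e [e0 ->]]]] := cf_span f.
apply: (JM); first by apply: (JD) => //; exact: JM.
move: e0; rewrite polyf_eq0 => e0.
have [r er] := closed_field_poly_normal e.
rewrite er -mul_polyC rmorphM /= invfM; apply: (JM).
  by rewrite -[_^-1]/((C (lead_coef e))^-1) -fmorphV; exact: JC.
elim: r {er e0} => [|z r IH];
  first by rewrite big_nil rmorph1 invr1 -(rmorph1 C); exact: JC.
by rewrite big_cons rmorphM invfM /=; apply: (JM) => //; rewrite rmorphB;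
  exact: jV.
Qed.

(** The difference of the equations at [(x, y)] and at [(x0, y0)].  Whichever of
    the second factors is a unit at [(x0, y0)] tells that the difference of the
    other coordinates generates the maximal ideal. *)
Lemma curve_secant (x0 y0 : k) : on_curve E (Some (x0, y0)) ->
  (y - C y0) * (y + C y0 + C (a1 E) * x + C (a3 E))
  = (x - C x0) * (x ^+ 2 + x * C x0 + C x0 ^+ 2 + C (a2 E) * (x + C x0)
    + C (a4 E)
       - C (a1 E) * C y0).
Proof.
move=> /eqP/(congr1 C); rewrite !(rmorphD, rmorphM) /= => e.
have w := weierstrassE F.
transitivity ((y ^+ 2 + C (a1 E) * x * y + C (a3 E) * y)
   - (C y0 * C y0 + C (a1 E) * C x0 * C y0
     + C (a3 E) * C y0) - C (a1 E) * C y0 * (x - C x0)).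
  by ring.
by rewrite w e; ring.
Qed.

Lemma hv_x (x0 y0 : k) (oc : on_curve E (Some (x0, y0))) :
  has_value (Point oc) x x0.
Proof. exact: (hv_chart1 F (Point oc)). Qed.
Lemma hv_y (x0 y0 : k) (oc : on_curve E (Some (x0, y0))) :
  has_value (Point oc) y y0.
Proof. exact: (hv_chart2 F (Point oc)). Qed.

Section Affine.
Context (x0 y0 : k) (oc : on_curve E (Some (x0, y0))).
Local Notation R := (Point oc).
Local Notation A := (y + C y0 + C (a1 E) * x + C (a3 E)).
Local Notation B := (x ^+ 2 + x * C x0 + C x0 ^+ 2 + C (a2 E) * (x + C x0)
  + C (a4 E)
       - C (a1 E) * C y0).

Lemma hv_secant_dy : has_value R A (dy E x0 y0).
Proof.
have -> : dy E x0 y0 = y0 + y0 + a1 E * x0 + a3 E by rewrite /dy; ring.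
apply: hvD (hv_cst _ _ _); apply: hvD; last exact: hvM (hv_cst _ _ _) (hv_x oc).
exact: hvD (hv_y oc) (hv_cst _ _ _).
Qed.

Lemma hv_secant_dx : has_value R B (dx E x0 y0).
Proof.
have -> : dx E x0 y0
  = x0 ^+ 2 + x0 * x0 + x0 ^+ 2 + a2 E * (x0 + x0) + a4 E - a1 E * y0.
  by rewrite /dx; ring.
have hx := hv_x oc; have hc c := hv_cst F R c.
apply: hvB; last exact: hvM.
apply: hvD => //; apply: hvD; last by apply: hvM => //; exact: hvD.
by apply: hvD; [apply: hvD; [exact: hvX|exact: hvM]|exact: hvX].
Qed.

Lemma hvBx : has_value R (x - C x0) 0.
Proof. by rewrite -(subrr x0); apply: hvB; [exact: hv_x|exact: hv_cst]. Qed.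

Lemma hvBy : has_value R (y - C y0) 0.
Proof. by rewrite -(subrr y0); apply: hvB; [exact: hv_y|exact: hv_cst]. Qed.

Lemma reg_invx c : c != x0 -> regular R (x - C c)^-1.
Proof.
move=> cx; exists (x0 - c)^-1; apply: hvV; first by rewrite subr_eq0 eq_sym.
by apply: hvB; [exact: hv_x|exact: hv_cst].
Qed.

Lemma parameter_unramified : dy E x0 y0 != 0 -> is_local_parameter R (x - C x0).
Proof.
move=> dy0; have A0 := hv_neq0 dy0 hv_secant_dy.
apply: is_local_parameter_crit => /=.
- exact: cx_cst_neq0.
- exact: hvBx.
- by rewrite divff ?cx_cst_neq0 //; exists 1; exact: hv1.
- have -> : (y - C y0) / (x - C x0) = B / A.
    by apply/eqP; rewrite eqr_div ?cx_cst_neq0 // (curve_secant oc) mulrC.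
  by exists (dx E x0 y0 / dy E x0 y0); apply: hvM;
    [exact: hv_secant_dx|apply: hvV; last exact: hv_secant_dy].
- by exists 0%N; rewrite expr0 mulr1; exists x0; exact: hv_x.
- by exists 0%N; rewrite expr0 mulr1; exists y0; exact: hv_y.
move=> c; have [->|cx0] := eqVneq c x0.
  by exists 1%N; rewrite expr1 mulVf ?cx_cst_neq0 //; exists 1; exact: hv1.
by exists 0%N; rewrite expr0 mulr1; exact: reg_invx.
Qed.

Lemma coordy_sub_neq0 : y - C y0 != 0.
Proof.
apply/eqP => e; have [] := @cf_free _ E F (- y0%:P) 1.
  by rewrite rmorph1 mul1r rmorphN addrC.
by move=> _ /eqP; rewrite oner_eq0.
Qed.

(** At a point fixed by negation the vertical line is tangent to the curve, so
    [x - x0] has a double zero and [y - y0] is the local parameter. *)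
Lemma parameter_ramified : dy E x0 y0 = 0 ->
  is_local_parameter R (y - C y0) /\
  exists2 c, c != 0 & has_value R ((x - C x0) / (y - C y0) ^+ 2) c.
Proof.
move=> dy0; have dx0 := nonsingular oc dy0.
have B0 := hv_neq0 dx0 hv_secant_dx; have t0 := coordy_sub_neq0.
have s := curve_secant oc.
have eA : A = (y - C y0) + C (a1 E) * (x - C x0).
  have : C (dy E x0 y0) = 0 by rewrite dy0 rmorph0.
  rewrite /dy !rmorphD !rmorphM /= => e.
  transitivity (y - C y0 + C (a1 E) * (x - C x0)
     + (C (2%:R) * C y0 + C (a1 E) * C x0 + C (a3 E)));
       first by rewrite rmorph_nat; ring.
  by rewrite e addr0.
have hD : has_value R (B - C (a1 E) * (y - C y0)) (dx E x0 y0).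
  rewrite -[dx E x0 y0]subr0; apply: hvB; first exact: hv_secant_dx.
  by rewrite -(mulr0 (a1 E)); apply: hvM; [exact: hv_cst|exact: hvBy].
have D0 := hv_neq0 dx0 hD.
have e : (x - C x0) / (y - C y0) ^+ 2 = (B - C (a1 E) * (y - C y0))^-1.
  apply/eqP; rewrite -[X in _ == X]div1r eqr_div ?expf_neq0 // mul1r mulrBr
    -s eA.
  by apply/eqP; ring.
have hu : has_value R ((x - C x0) / (y
  - C y0) ^+ 2) (dx E x0 y0)^-1 by rewrite e; exact: hvV.
split; last by exists (dx E x0 y0)^-1; rewrite ?invr_eq0.
apply: is_local_parameter_crit => //=.
- exact: hvBy.
- have -> : (x - C x0) / (y - C y0)
  = (x - C x0) / (y - C y0) ^+ 2 * (y - C y0) by field.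
  by apply: regM; [exists (dx E x0 y0)^-1|exists 0; exact: hvBy].
- by rewrite divff //; exists 1; exact: hv1.
- by exists 0%N; rewrite expr0 mulr1; exists x0; exact: hv_x.
- by exists 0%N; rewrite expr0 mulr1; exists y0; exact: hv_y.
move=> c; have [->|cx0] := eqVneq c x0; last first.
  by exists 0%N; rewrite expr0 mulr1; exact: reg_invx.
exists 2%N; rewrite -[_^-1 * _]invrK invfM invrK; exists (dx E x0 y0)^-1^-1;
  apply: hvV => //.
by rewrite invr_eq0.
Qed.

End Affine.

Lemma parameter_infinity : [/\ is_local_parameter (origin E) (x / y),
  has_value (origin E) (x * (x / y) ^+ 2) 1 &
    has_value (origin E) (y * (x / y) ^+ 3) 1].
Proof.
have y0 := cy_neq0 F; have x0 := cx_neq0 F.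
set R := origin E; have hs : has_value R (x / y) 0 by exact: (hv_chart1 F R).
have hw : has_value R y^-1 0 by exact: (hv_chart2 F R).
have hc c := hv_cst F R c.
pose e : F := 1 + (C (a1 E) - C (a2 E) * (x / y)) * (x / y)
   + (C (a3 E) - C (a4 E) * (x / y) - C (a6 E) * y^-1) * y^-1.
have he : has_value R e 1.
  have -> : 1 = 1 + (a1 E - a2 E * 0) * 0
    + (a3 E - a4 E * 0 - a6 E * 0) * 0 :> k by ring.
  apply: hvD; last first.
    by apply: hvM => //; apply: hvB; [apply: hvB => //|]; apply: hvM.
  apply: hvD; first exact: hv1.
  by apply: hvM => //; apply: hvB => //; exact: hvM.
have e0 : e != 0 by apply: hv_neq0 he; rewrite oner_eq0.
have es : e = y * (x / y) ^+ 3.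
  have w := weierstrassE F.
  transitivity ((y ^+ 2 + C (a1 E) * x * y + C (a3 E) * y
     - (C (a2 E) * x ^+ 2 + C (a4 E) * x + C (a6 E))) / y ^+ 2).
    by rewrite /e; field.
  by rewrite w; field.
have hx : has_value R (x * (x / y) ^+ 2) 1.
  have -> : x * (x / y) ^+ 2 = y * (x / y) ^+ 3 by field.
  by rewrite -es.
have hy : has_value R (y * (x / y) ^+ 3) 1 by rewrite -es.
have hx1 : has_value R x^-1 0.
  have -> : x^-1 = (x / y) ^+ 2 * e^-1 by rewrite es; field; rewrite x0 y0.
  have -> : 0 = 0 ^+ 2 * 1^-1 :> k by rewrite expr0n mul0r.
  by apply: hvM; [exact: hvX|apply: hvV; rewrite ?oner_eq0].
split=> //; apply: is_local_parameter_crit => //=.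
- by rewrite mulf_neq0 ?invr_eq0.
- by rewrite rmorph0 subr0 divff ?mulf_neq0 ?invr_eq0 //; exists 1; exact: hv1.
- have -> : (y^-1 - C 0) / (x / y) = x^-1 by rewrite rmorph0; field;
  rewrite x0 y0.
  by exists 0.
- by exists 2%N; exists 1.
- by exists 3%N; exists 1.
move=> c; exists 0%N; rewrite expr0 mulr1.
have h1 : has_value R (1 - C c * x^-1) 1.
  by rewrite -[X in has_value _ _ X](subr0 1) -(mulr0 c); apply: hvB;
    [exact: hv1|exact: hvM].
have n1 : 1 - C c / x != 0 by apply: hv_neq0 h1; rewrite oner_eq0.
have -> : (x - C c)^-1 = x^-1 * (1 - C c * x^-1)^-1.
  by rewrite -invfM; congr (_^-1); field.
by apply: regM; [exists 0|exists 1^-1; apply: hvV; rewrite ?oner_eq0].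
Qed.

Lemma parameter_exists R : exists t, is_local_parameter R t.
Proof.
case: R => [[[x0 y0]|] oc]; last first.
  exists (x / y); have -> : Point oc = origin E by apply: val_inj.
  by have [] := parameter_infinity.
have [dy0|dy0] := eqVneq (dy E x0 y0) 0.
  by exists (y - C y0); have [] := parameter_ramified oc dy0.
by exists (x - C x0); exact: parameter_unramified.
Qed.

End Uniformizer.

Section Order.
Context {k : closedFieldType} {E : elliptic_curve k} (F : coord_field E).
Implicit Types (R : point E) (f g t w : F) (c d : k).
Local Notation C := (cst F).
Local Notation has_value := (@has_value k E F).
Local Notation regular := (@regular k E F).
Local Notation is_local_parameter := (@is_local_parameter k E F).

Definition local_parameter R : F := sval (cid (parameter_exists F R)).

Lemma local_parameterP R : is_local_parameter R (local_parameter R).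
Proof. by rewrite /local_parameter; case: cid. Qed.

(** As long as the divisor [f] of the power of [t] is not a unit, divide both by
    [t]. *)
Lemma factor_parameter R t f g n : is_local_parameter R t -> regular R f ->
  regular R g ->
  f * g = t ^+ n -> exists m w c, [/\ c != 0, has_value R w c & f = w * t ^+ m].
Proof.
move=> [t0 ht split _]; elim: n f => [|n IH] f [c hc] rg e.
  case: rg => d hd; exists 0%N, f, c; rewrite expr0 mulr1; split=> //.
  have : c * d = 1.
    by apply: (@hv_unique _ _ F R 1); [rewrite -(expr0 t) -e;
      exact: hvM|exact: hv1].
  by apply: contra_eq_neq => ->; rewrite mul0r eq_sym oner_eq0.
have [c0|c0] := eqVneq c 0; last by exists 0%N, f, c; rewrite expr0 mulr1.
rewrite c0 in hc; have [f1 rf1 ef] := split f hc.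
have [m [w [d [d0 hd e1]]]] : exists m w c, [/\ c != 0, has_value R w c &
  f1 = w * t ^+ m].
  by apply: IH => //; apply: (mulIf t0); rewrite -exprSr -e ef; ring.
by exists m.+1, w, d; split=> //; rewrite ef e1 exprSr mulrA.
Qed.

Lemma ord_exists R f : exists m : int, f != 0 ->
  exists w c, [/\ c != 0, has_value R w c & f = w * local_parameter R ^ m].
Proof.
have [->|f0] := eqVneq f 0; first by exists 0.
have pt := local_parameterP R; have [t0 _ _ tj] := pt;
  set t := local_parameter R in pt t0 tj *.
have [j rj] := tj f; have [i ri] := tj f^-1.
have e : f * t ^+ j * (f^-1 * t ^+ i) = t ^+ (j + i) by rewrite exprD; field.
have [m [w [c [c0 hc em]]]] := factor_parameter pt rj ri e.
exists (m%:Z - j%:Z) => _; exists w, c; split=> //.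
by apply: (mulIf (expf_neq0 j t0)); rewrite em -mulrA !exprnP -expfzDr // subrK.
Qed.

Definition ord R f : int := sval (cid (ord_exists R f)).

Lemma ordP R f : f != 0 ->
  exists w c, [/\ c != 0, has_value R w c &
  f = w * local_parameter R ^ ord R f].
Proof. by rewrite /ord; case: cid. Qed.

Lemma hv_expz R t w c (m : int) : is_local_parameter R t ->
  has_value R w c -> 0 < m -> has_value R (w * t ^ m) 0.
Proof.
move=> [_ ht _ _] hw; case: m => // -[|m] // _.
rewrite -exprnP exprSr mulrA mulrC; apply: reg_hv0M => //; exists (c * 0 ^+ m).
by apply: hvM => //; exact: hvX.
Qed.

Lemma ord_unique R f w c (m : int) : c != 0 -> has_value R w c ->
  f = w * local_parameter R ^ m -> ord R f = m.
Proof.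
move=> c0 hc e; have pt := local_parameterP R; have [t0 _ _ _] := pt.
have w0 := hv_neq0 c0 hc.
have f0 : f != 0 by rewrite e mulf_neq0 ?expfz_neq0.
have [w' [c' [c0' hc' e']]] := ordP R f0; set n := ord R f in e' *.
have aux (u v : F) (a b : k) (i j : int) : a != 0 -> has_value R u a ->
  has_value R v b ->
    u * local_parameter R ^ i = v * local_parameter R ^ j -> ~~ (i < j).
  move=> a0 ha hb euv; apply/negP => lt; move: (a0); apply/negP/negPn/eqP.
  apply: (hv_unique ha); have -> : u = v * local_parameter R ^ (j - i).
    by apply: (mulIf (expfz_neq0 i t0)); rewrite euv -mulrA -expfzDr // subrK.
  by apply: (hv_expz pt hb); rewrite subr_gt0.
apply/eqP; rewrite eq_le !leNgt; apply/andP; split.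
  by apply: (aux w w' c c') => //; rewrite -e e'.
by apply: (aux w' w c' c) => //; rewrite -e e'.
Qed.

Lemma hv_expfz R w c (m : int) : c != 0 -> has_value R w c ->
  has_value R (w ^ m) (c ^ m).
Proof. by move=> c0 h; case: m => n; [exact: hvX|apply: hvV;
  [exact: expf_neq0|exact: hvX]]. Qed.

Lemma ord_parameter R t f w c (m : int) : is_local_parameter R t ->
  c != 0 -> has_value R w c -> f = w * t ^ m -> ord R f = m.
Proof.
move=> [t0 ht tsplit _] c0 hc e; have [u0 hu usplit _] := local_parameterP R.
have [g [a ha] eg] := tsplit _ hu; have [h [b hb] eh] := usplit _ ht.
have gh : h * g = 1 by apply: (mulIf t0); rewrite mul1r {2}eh eg; ring.
have b0 : b != 0.
  have : b * a = 1 by apply: (@hv_unique _ _ F R 1); [rewrite -gh;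
    exact: hvM|exact: hv1].
  by apply: contra_eq_neq => ->; rewrite mul0r eq_sym oner_eq0.
apply: (@ord_unique R f (w * h ^ m) (c * b ^ m)).
- by rewrite mulf_neq0 ?expfz_neq0.
- by apply: hvM => //; exact: hv_expfz.
- by rewrite e {1}eh expfzMl mulrA.
Qed.

Lemma ord_hv R w c : c != 0 -> has_value R w c -> ord R w = 0.
Proof. by move=> c0 h; apply: (ord_unique c0 h); rewrite expr0z mulr1. Qed.

Lemma ord_cst R c : c != 0 -> ord R (C c) = 0.
Proof. by move=> c0; apply: (ord_hv c0); exact: hv_cst. Qed.

Lemma ord1 R : ord R 1 = 0.
Proof. by apply: ord_hv (hv1 F R); rewrite oner_eq0. Qed.

Lemma ordM R f g : f != 0 -> g != 0 -> ord R (f * g) = ord R f + ord R g.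
Proof.
move=> f0 g0; have [w [c [c0 hc ef]]] := ordP R f0.
have [w' [c' [c0' hc' eg]]] := ordP R g0; have [t0 _ _ _] := local_parameterP R.
apply: (@ord_unique R _ (w * w') (c * c')); rewrite ?mulf_neq0 //;
  first exact: hvM.
by rewrite {1}ef {1}eg expfzDr // mulrACA.
Qed.

Lemma ordV R f : f != 0 -> ord R f^-1 = - ord R f.
Proof.
move=> f0; have f0' : f^-1 != 0 by rewrite invr_eq0.
have := ordM R f0' f0; rewrite mulVf // ord1 => /esym/eqP.
by rewrite addr_eq0 => /eqP.
Qed.

Lemma ord_div R f g : f != 0 -> g != 0 -> ord R (f / g) = ord R f - ord R g.
Proof. by move=> f0 g0; rewrite ordM ?invr_eq0 // ordV. Qed.

Lemma ordX R f n : f != 0 -> ord R (f ^+ n) = ord R f *+ n.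
Proof.
move=> f0; elim: n => [|n IH]; first by rewrite expr0 mulr0n ord1.
by rewrite exprS ordM ?expf_neq0 // IH mulrS.
Qed.

Lemma ordN R f : f != 0 -> ord R (- f) = ord R f.
Proof.
move=> f0; rewrite -mulN1r ordM ?oppr_eq0 ?oner_eq0 //.
by rewrite -(rmorph1 C) -rmorphN ord_cst ?add0r // oppr_eq0 oner_eq0.
Qed.

Lemma hv_ord_ge0 R f : f != 0 -> 0 <= ord R f -> regular R f.
Proof.
move=> f0; have [w [c [c0 hc ef]]] := ordP R f0; rewrite {2}ef.
rewrite le_eqVlt => /predU1P[<-|lt]; first by rewrite expr0z mulr1; exists c.
by exists 0; apply: hv_expz lt => //; [exact: local_parameterP|exact: hc].
Qed.

Lemma hv_ord_gt0 R f : f != 0 -> 0 < ord R f -> has_value R f 0.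
Proof.
move=> f0; have [w [c [c0 hc ef]]] := ordP R f0; rewrite {2}ef.
by move=> lt; apply: hv_expz lt => //; [exact: local_parameterP|exact: hc].
Qed.

Lemma ord_gt0 R f : f != 0 -> has_value R f 0 -> 0 < ord R f.
Proof.
move=> f0 hf; have [u0 hu usplit _] := local_parameterP R.
have [g rg eg] := usplit _ hf.
rewrite ltNge; apply/negP => le0.
have g0 : g != 0 by apply: contra_neq f0 => g0; rewrite eg g0 mul0r.
have fV : regular R f^-1 by apply: hv_ord_ge0;
  rewrite ?invr_eq0 // ordV // oppr_ge0.
have : has_value R 1 0 by rewrite -(mulfV f0); exact: reg_hv0M.
by move/(hv_unique (hv1 F R))/eqP; rewrite oner_eq0.
Qed.

Lemma ord_ge0 R f : f != 0 -> regular R f -> 0 <= ord R f.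
Proof.
move=> f0 [c hc]; have [c0|c0] := eqVneq c 0; last by rewrite (ord_hv c0).
by rewrite c0 in hc; apply: ltW; exact: ord_gt0.
Qed.

Lemma ord0_hv R f : f != 0 -> ord R f = 0 ->
  exists2 c, c != 0 & has_value R f c.
Proof.
move=> f0 e; have [w [c [c0 hc ef]]] := ordP R f0.
by exists c => //; rewrite ef e expr0z mulr1.
Qed.

(** The fractional ideals of the local ring; unlike inequalities between orders
    they accommodate the zero function. *)
Definition vge R (n : int) f := (f == 0) || (n <= ord R f).

Lemma vge_ord R n f : f != 0 -> vge R n f = (n <= ord R f).
Proof. by rewrite /vge; case: eqP. Qed.

Lemma vge0 R n : vge R n 0. Proof. by rewrite /vge eqxx. Qed.

Lemma vge_reg R f : vge R 0 f <-> regular R f.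
Proof.
rewrite /vge; have [->|f0] := eqVneq f 0 => /=.
  by split=> // _; exists 0; exact: hv0.
by split; [exact: hv_ord_ge0|exact: ord_ge0].
Qed.

Lemma vge_hv0 R f : vge R 1 f <-> has_value R f 0.
Proof.
rewrite /vge; have [->|f0] := eqVneq f 0 => /=; first by split=> // _;
  exact: hv0.
by split; [exact: hv_ord_gt0|exact: ord_gt0].
Qed.

Lemma vge_hv R f c : vge R 1 (f - C c) <-> has_value R f c.
Proof.
rewrite vge_hv0; split=> h.
  by rewrite -[f](subrK (C c)) -[c in has_value _ _ c]add0r;
    apply: hvD => //; exact: hv_cst.
by rewrite -(subrr c); apply: hvB => //; exact: hv_cst.
Qed.

Lemma vge_le R m n f : m <= n -> vge R n f -> vge R m f.
Proof.
move=> le /orP[/eqP ->|h]; first exact: vge0.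
by rewrite /vge (le_trans le h) orbT.
Qed.

Lemma vgeM R m n f g : vge R m f -> vge R n g -> vge R (m + n) (f * g).
Proof.
have [->|f0] := eqVneq f 0; first by move=> _ _; rewrite mul0r vge0.
have [->|g0] := eqVneq g 0; first by move=> _ _; rewrite mulr0 vge0.
have fg0 : f * g != 0 by rewrite mulf_neq0.
by rewrite !vge_ord // ordM // => h1 h2; exact: lerD h1 h2.
Qed.

Lemma vgeD R n f g : vge R n f -> vge R n g -> vge R n (f + g).
Proof.
have [u0 _ _ _] := local_parameterP R; set u := local_parameter R in u0 *.
have ou : ord R u = 1.
  by apply: (@ord_unique R u 1 1); rewrite ?oner_eq0 ?mul1r ?expr1z //;
    exact: hv1.
have oz m : ord R (u ^ m) = m.
  by apply: (@ord_unique R _ 1 1); rewrite ?oner_eq0 ?mul1r //; exact: hv1.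
have H h : vge R n h <-> regular R (h * u ^ (- n)).
  rewrite -vge_reg; have [->|h0] := eqVneq h 0; first by rewrite mul0r !vge0.
  by rewrite !vge_ord ?mulf_neq0 ?expfz_neq0 // ordM ?expfz_neq0 // oz subr_ge0.
by rewrite !H mulrDl; exact: regD.
Qed.

Lemma vgeN R n f : vge R n (- f) = vge R n f.
Proof. by have [->|f0] := eqVneq f 0; rewrite ?oppr0 // /vge oppr_eq0 ordN. Qed.

Lemma vgeB R n f g : vge R n f -> vge R n g -> vge R n (f - g).
Proof. by move=> hf hg; apply: vgeD => //; rewrite vgeN. Qed.

Lemma vge_cst R c : vge R 0 (C c).
Proof. by apply/vge_reg; exists c; exact: hv_cst. Qed.

Lemma vgeX R n f i : vge R n f -> vge R (n *+ i) (f ^+ i).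
Proof.
move=> h; elim: i => [|i IH]; last by rewrite exprS mulrS; exact: vgeM.
by rewrite mulr0n expr0 -(rmorph1 C) vge_cst.
Qed.

Lemma vgeZ R n c f : vge R n f -> vge R n (C c * f).
Proof. by rewrite -[n in vge _ n (_ * _)]add0r; apply: vgeM;
  exact: vge_cst. Qed.

Lemma ordD R f g : f != 0 -> vge R (ord R f + 1) g ->
  f + g != 0 /\ ord R (f + g) = ord R f.
Proof.
move=> f0 hg; have le : vge R (ord R f) (f + g).
  by apply: vgeD; [rewrite vge_ord|apply: vge_le hg; rewrite lerDl].
have nle : ~~ vge R (ord R f + 1) (f + g).
  apply/negP => h; have := vgeB h hg; rewrite addrK vge_ord //.
  by rewrite gerDl ler10.
have fg0 : f + g != 0 by apply: contraNneq nle => ->; rewrite vge0.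
split=> //; apply/eqP; rewrite eq_le; apply/andP; split.
  by move: nle; rewrite vge_ord // -ltNge ltzD1.
by move: le; rewrite vge_ord.
Qed.

End Order.

(** The next definitions repeat for an arbitrary presentation those made for
    [function_field], with which they agree by conversion when the presentation
    is [standard]. *)
Section HasOrder.
Context {k : closedFieldType} {E : elliptic_curve k} (F : coord_field E).
Implicit Types (R : point E) (f g t : F).

Definition regular_for R f := exists g h : {poly {poly k}},
  eval_value R h != 0 /\ f = ceval F R g / ceval F R h.
Definition unit_for R f :=
  [/\ f != 0, regular_for R f & regular_for R f^-1].
Definition vanishes_for R f := regular_for R f /\ ~ unit_for R f.
Definition uniformizer_for R t := vanishes_for R t /\
  forall f, vanishes_for R f -> exists2 g, regular_for R g & f = g * t.
Definition has_order_for R f (m : int) :=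
  exists t u, [/\ uniformizer_for R t, unit_for R u & f = u * t ^ m].

Lemma regular_forP R f : regular_for R f <-> regular R f.
Proof.
split=> [[g [h [h0 e]]]|[c [g [h [h0 e _]]]]].
  by exists (veval R g / veval R h), g, h; rewrite vevalE.
by exists g, h; rewrite -vevalE.
Qed.

Lemma unit_forP R f : unit_for R f <-> f != 0 /\ ord R f = 0.
Proof.
split=> [[f0 /regular_forP r1 /regular_forP r2]|[f0 e]].
  split=> //; apply/eqP; rewrite eq_le (ord_ge0 f0 r1) andbT -oppr_ge0 -ordV //.
  by apply: ord_ge0; rewrite ?invr_eq0.
by split=> //; apply/regular_forP; apply: hv_ord_ge0;
  rewrite ?invr_eq0 // ?ordV // e.
Qed.

Lemma vanishes_forP R f : vanishes_for R f <-> has_value R f 0.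
Proof.
split=> [[/regular_forP r nu]|h].
  have [->|f0] := eqVneq f 0; first exact: hv0.
  apply: hv_ord_gt0 => //; rewrite lt_neqAle (ord_ge0 f0 r) andbT.
  by apply/eqP => e; apply: nu; apply/unit_forP.
split; first by apply/regular_forP; exists 0.
by move=> /unit_forP [f0 e]; have := ord_gt0 f0 h; rewrite e.
Qed.

Lemma ord_local_parameter R : ord R (local_parameter F R) = 1.
Proof.
by apply: (@ord_unique _ _ F R _ 1 1); rewrite ?oner_eq0 ?mul1r ?expr1z //;
  exact: hv1.
Qed.

Lemma local_parameter_neq0 R : local_parameter F R != 0.
Proof. by have [] := local_parameterP F R. Qed.

Lemma uniformizer_forP R t : uniformizer_for R t <-> t != 0 /\ ord R t = 1.
Proof.
split=> [[/vanishes_forP ht H]|[t0 e]].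
  have [u0 hu _ _] := local_parameterP F R.
  have [g /regular_forP rg eg] := H _ (proj2 (vanishes_forP R _) hu).
  have t0 : t != 0 by apply: contra_neq u0 => t0; rewrite eg t0 mulr0.
  have g0 : g != 0 by apply: contra_neq u0 => g0; rewrite eg g0 mul0r.
  split=> //; have := ord_local_parameter R; rewrite eg ordM //.
  by have := ord_gt0 t0 ht; have := ord_ge0 g0 rg; lia.
split; first by apply/vanishes_forP; apply: hv_ord_gt0; rewrite ?e.
move=> f /vanishes_forP hf; exists (f / t); last by rewrite divfK.
apply/regular_forP; have [->|f0] := eqVneq f 0; first by rewrite mul0r;
  exists 0; exact: hv0.
apply: hv_ord_ge0; first by rewrite mulf_neq0 ?invr_eq0.
by rewrite ord_div // e; have := ord_gt0 f0 hf; lia.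
Qed.

Lemma ordXz R f (m : int) : f != 0 -> ord R (f ^ m) = m * ord R f.
Proof.
move=> f0; case: m => n; first by rewrite -exprnP ordX // -mulr_natl natz.
by rewrite NegzE -exprnN ordV ?expf_neq0 // ordX // -mulr_natl natz mulNr.
Qed.

Lemma has_order_forP R f m : has_order_for R f m <-> f != 0 /\ ord R f = m.
Proof.
split=> [[t [u [/uniformizer_forP [t0 et] /unit_forP [u0 eu] ->]]]|[f0 <-]].
  by rewrite mulf_neq0 ?expfz_neq0 // ordM ?expfz_neq0 // ordXz // eu et
    mulr1 add0r.
have [w [c [c0 hc e]]] := ordP R f0; exists (local_parameter F R), w;
  split=> //.
  by apply/uniformizer_forP; rewrite local_parameter_neq0 ord_local_parameter.
by apply/unit_forP; rewrite (hv_neq0 c0 hc) (ord_hv c0 hc).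
Qed.

End HasOrder.

(** * Homomorphisms and local rings *)
Section Transfer.
Context {k : closedFieldType} {E E' : elliptic_curve k}.
Context (F : coord_field E) (F' : coord_field E') (phi : {rmorphism F' -> F}).
Hypothesis phi_cst : forall c, phi (cst F' c) = cst F c.

Lemma rmorph_eval_xy s t (g : {poly {poly k}}) :
  phi (eval_xy (cst F') s t g) = eval_xy (cst F) (phi s) (phi t) g.
Proof.
elim/poly_ind: g => [|g p IH]; first by rewrite !rmorph0.
rewrite !rmorphD !rmorphM IH !eval_xy_Y !eval_xy_C; congr (_ + _).
elim/poly_ind: p => [|p c IHp]; first by rewrite !rmorph0 !horner0 rmorph0.
rewrite !rmorphD !rmorphM /= !map_polyX !map_polyC !hornerD !hornerM !hornerX
  !hornerC.
by rewrite rmorphD rmorphM IHp phi_cst.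
Qed.

Lemma hv_eval_xy (R : point E) (s t : F) s0 t0 (g : {poly {poly k}}) :
  has_value R s s0 -> has_value R t t0 ->
    has_value R (eval_xy (cst F) s t g) (eval_xy idfun s0 t0 g).
Proof.
move=> hs ht; elim/poly_ind: g => [|g p IH]; first by rewrite !rmorph0;
  exact: hv0.
rewrite !rmorphD !rmorphM !eval_xy_Y !eval_xy_C; apply: hvD; first exact: hvM.
elim/poly_ind: p => [|p c IHp]; first by rewrite !rmorph0 !horner0; exact: hv0.
rewrite !rmorphD !rmorphM /= !map_polyX !map_polyC !hornerD !hornerM !hornerX
  !hornerC.
by apply: hvD; [exact: hvM|exact: hv_cst].
Qed.

Lemma dominate_hv (R : point E) (R' : point E') :
  has_value R (phi (cchart F' R').1) (chart_value R').1 ->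
  has_value R (phi (cchart F' R').2) (chart_value R').2 ->
  forall f c, has_value R' f c -> has_value R (phi f) c.
Proof.
move=> h1 h2 f c [g [h [h0 -> ->]]].
rewrite fmorph_div !rmorph_eval_xy; apply: hvM; first exact: hv_eval_xy.
by apply: hvV => //; exact: hv_eval_xy.
Qed.

(** A discrete valuation ring is a maximal proper subring of its field of
    fractions: if [f] is not regular then [f^-1] has value 0, which is preserved
    and prevents the image of [f] from being regular. *)
Lemma dominate_reg (R : point E) (R' : point E') :
  (forall f c, has_value R' f c -> has_value R (phi f) c) ->
  forall f, regular R' f <-> regular R (phi f).
Proof.
move=> dom f; split=> [[c hc]|[c hc]]; first by exists c; exact: dom.
have [->|f0] := eqVneq f 0; first by exists 0; exact: hv0.
apply: hv_ord_ge0 => //; rewrite leNgt; apply/negP => lt.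
have h : has_value R' f^-1 0.
  by apply: hv_ord_gt0; rewrite ?invr_eq0 // ordV // oppr_gt0.
have := hvM hc (dom _ _ h); rewrite -rmorphM divff // rmorph1 mulr0.
by move/(hv_unique (hv1 F R))/eqP; rewrite oner_eq0.
Qed.

(** The order of the image of [f] is a multiple [e] of the order of [f], and
    surjectivity forces [e = 1]. *)
Lemma ord_transfer (R : point E) (R' : point E') :
  (forall f, regular R' f <-> regular R (phi f)) ->
    (forall g, exists f, phi f = g) ->
  forall f, f != 0 -> ord R (phi f) = ord R' f.
Proof.
move=> regE surj.
have phi0 f : f != 0 -> phi f != 0 by rewrite fmorph_eq0.
have unit0 w c : c != 0 -> has_value R' w c -> ord R (phi w) = 0.
  move=> c0 hc; have w0 := hv_neq0 c0 hc; apply/eqP; rewrite eq_le.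
  apply/andP; split; last by apply: ord_ge0; [exact: phi0|apply/regE; exists c].
  rewrite -oppr_ge0 -ordV ?phi0 // -fmorphV; apply: ord_ge0.
    by rewrite phi0 // invr_eq0.
  by apply/regE; exists c^-1; exact: hvV.
have u0 := local_parameter_neq0 F' R';
  set e := ord R (phi (local_parameter F' R')).
have ordE f : f != 0 -> ord R (phi f) = ord R' f * e.
  move=> f0; have [w [c [c0 hc ef]]] := ordP R' f0.
  have w0 := hv_neq0 c0 hc.
  have eX : phi (local_parameter F' R' ^ ord R' f)
    = phi (local_parameter F' R') ^ ord R' f.
    by rewrite rmorphXz ?unitfE.
  rewrite {1}ef rmorphM eX ordM ?expfz_neq0 ?phi0 //.
  by rewrite (unit0 _ _ c0 hc) add0r ordXz ?phi0.
have e0 : 0 <= e.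
  by apply: ord_ge0; [exact: phi0|apply/regE; exists 0;
    have [] := local_parameterP F' R'].
have [f1 ef1] := surj (local_parameter F R).
have f10 : f1 != 0 by apply: contraNneq (local_parameter_neq0 F R) => f10;
  rewrite -ef1 f10 rmorph0.
have := ordE _ f10; rewrite ef1 ord_local_parameter => e1.
have {}e1 : e = 1.
  have : (e %| 1)%Z by apply/dvdzP; exists (ord R' f1).
  by rewrite dvdz1 => /eqP; move: e0; clear; lia.
by move=> f f0; rewrite ordE // e1 mulr1.
Qed.

End Transfer.

(** * Functions with poles at infinity only *)
Section AffineRing.
Context {k : closedFieldType} {E : elliptic_curve k} (F : coord_field E).
Implicit Types (R : point E) (f g t : F) (c : k) (p a b : {poly k}).
Local Notation C := (cst F).
Local Notation x := (cx F).
Local Notation y := (cy F).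
Local Notation P := (polyf F).
Local Notation O := (origin E).

(** If the orders of two functions differ there is no cancellation in the sum.
    It is used for a function of [x], of even order, and another one of odd
    order. *)
Lemma vge_split R n f g : (f != 0 -> g != 0 -> ord R f != ord R g) ->
  vge R n (f + g) -> vge R n f /\ vge R n g.
Proof.
have [->|f0] := eqVneq f 0; first by rewrite add0r vge0.
have [->|g0] := eqVneq g 0; first by rewrite addr0 vge0.
move=> /(_ isT isT) ne.
wlog lt : f g f0 g0 ne / ord R f < ord R g.
  move=> W; have := ne; rewrite neq_lt => /orP[lt|lt]; first exact: W.
  by rewrite addrC => h; have [] := W _ _ g0 f0 _ lt h; rewrite // eq_sym.
have hg : vge R (ord R f + 1) g by rewrite vge_ord // lezD1.
have [fg0 e] := ordD f0 hg; rewrite vge_ord // e => h.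
by rewrite !vge_ord // h (le_trans h (ltW lt)).
Qed.

Lemma ord_prod_XsubC R (r : seq k) n : (forall c, c \in r ->
  ord R (x - C c) = n) ->
  ord R (P (\prod_(z <- r) ('X - z%:P))) = n *+ size r.
Proof.
elim: r => [|z r IH] H; first by rewrite big_nil rmorph1 ord1 mulr0n.
rewrite big_cons rmorphM ordM; last 2 first.
- by rewrite polyf_eq0 polyXsubC_eq0.
- by rewrite polyf_eq0 monic_neq0 ?monic_prod_XsubC.
rewrite IH /= => [|c cr]; last by apply: H; rewrite in_cons cr orbT.
by rewrite rmorphB (H z) ?mem_head // mulrS.
Qed.

Lemma ord_infinity_x : ord O x = -2 /\ ord O y = -3.
Proof.
have [pt hx hy] := parameter_infinity F; have [t0 ht _ _] := pt.
split; [apply: (ord_parameter pt _ hx)|apply: (ord_parameter pt _ hy)];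
  rewrite ?oner_neq0 //.
  by rewrite -mulrA exprnP -expfzDr // addrN expr0z mulr1.
by rewrite -mulrA exprnP -expfzDr // addrN expr0z mulr1.
Qed.

Lemma ord_infinity_XsubC c : ord O (x - C c) = -2.
Proof.
have [ex _] := ord_infinity_x.
have h : vge O (ord O x + 1) (- C c) by rewrite vgeN ex;
  apply: vge_le (vge_cst F O c).
by have [_ ->] := ordD (cx_neq0 F) h.
Qed.

Lemma ord_infinity_poly p : p != 0 -> ord O (P p) = -2 *+ (size p).-1.
Proof.
move=> p0; have [r er] := closed_field_poly_normal p.
have l0 : lead_coef p != 0 by rewrite lead_coef_eq0.
rewrite er size_scale // size_prod_XsubC /= -mul_polyC rmorphM ordM;
  last 2 first.
- by rewrite polyf_eq0 polyC_eq0.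
- by rewrite polyf_eq0 monic_neq0 ?monic_prod_XsubC.
rewrite -[P _%:P]/(C (lead_coef p)) ord_cst // add0r.
by apply: ord_prod_XsubC => c _; exact: ord_infinity_XsubC.
Qed.

Lemma vge_infinity_poly n p : vge O n (P p) -> p = 0 \/ n <= -2 *+ (size p).-1.
Proof.
have [->|p0] := eqVneq p 0; first by left.
by rewrite vge_ord ?polyf_eq0 // ord_infinity_poly //; right.
Qed.

Lemma ord_infinity_polyM b : b != 0 -> ord O (P b * y) = -2 *+ (size b).-1 - 3.
Proof.
move=> b0; rewrite ordM ?cy_neq0 ?polyf_eq0 // ord_infinity_poly //.
by have [_ ->] := ord_infinity_x.
Qed.

Lemma vge_infinity n a b : vge O n (P a + P b * y) ->
  (a = 0 \/ n <= -2 *+ (size a).-1) /\ (b = 0 \/ n <= -2 *+ (size b).-1 - 3).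
Proof.
move=> h; have [|ha hb] := vge_split _ h.
  rewrite mulf_eq0 negb_or !polyf_eq0 => a0 /andP[b0 _].
  by rewrite ord_infinity_poly // ord_infinity_polyM //; lia.
split; first exact: vge_infinity_poly.
have [->|b0] := eqVneq b 0; [by left|right].
by rewrite -ord_infinity_polyM // -vge_ord // mulf_neq0 ?cy_neq0 ?polyf_eq0.
Qed.

Section AffinePoint.
Context (x0 y0 : k) (oc : on_curve E (Some (x0, y0))).
Local Notation R := (Point oc).

Lemma hv_polyf p : has_value R (P p) p.[x0].
Proof.
rewrite polyf_horner; elim/poly_ind: p => [|p c IH].
  by rewrite rmorph0 !hornerC; exact: hv0.
rewrite rmorphD rmorphM /= map_polyX map_polyC !hornerE; apply: hvD.
  by apply: hvM => //; exact: hv_x.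
exact: hv_cst.
Qed.

Lemma ord_XsubC_neq c : c != x0 -> ord R (x - C c) = 0.
Proof.
move=> cx; apply: (@ord_hv _ _ _ _ _ (x0 - c));
  first by rewrite subr_eq0 eq_sym.
by apply: hvB; [exact: hv_x|exact: hv_cst].
Qed.

Lemma ord_XsubC_unram : dy E x0 y0 != 0 -> ord R (x - C x0) = 1.
Proof.
move=> h; apply: (ord_parameter (parameter_unramified F oc h) (oner_neq0 _)
  (hv1 F R)).
by rewrite expr1z mul1r.
Qed.

Lemma ord_XsubC_ram : dy E x0 y0 = 0 -> ord R (x - C x0) = 2.
Proof.
move=> h; have [pt [c c0 hc]] := parameter_ramified F oc h.
apply: (ord_parameter pt c0 hc); rewrite -exprnP divfK //.
by rewrite expf_neq0 // (coordy_sub_neq0 F y0).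
Qed.

Lemma ord_YsubC_ram : dy E x0 y0 = 0 -> ord R (y - C y0) = 1.
Proof.
move=> h; have [pt _] := parameter_ramified F oc h.
by apply: (ord_parameter pt (oner_neq0 _) (hv1 F R)); rewrite expr1z mul1r.
Qed.

Lemma ord_polyf p : p != 0 ->
  exists n : nat, [/\ ord R (P p) = ord R (x - C x0) *+ n &
  p.[x0] = 0 -> (0 < n)%N].
Proof.
move=> p0; have [m [q hq ->]] := multiplicity_XsubC p x0.
rewrite p0 /= in hq; exists m; split.
  have q0 : q != 0 by apply: contraNneq hq => ->; rewrite root0.
  rewrite rmorphM rmorphXn ordM ?expf_neq0 ?polyf_eq0 ?polyXsubC_eq0 //.
  rewrite ordX ?polyf_eq0 ?polyXsubC_eq0 // (ord_hv _ (hv_polyf q)) // add0r.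
  by rewrite rmorphB.
case: m => //; rewrite expr0 mulr1 => e; by rewrite rootE e eqxx in hq.
Qed.

End AffinePoint.

Lemma affine_point_exists x0 : exists y0, on_curve E (Some (x0, y0)).
Proof.
pose f (i : nat) := if i == 0%N then x0 ^+ 3 + a2 E * x0 ^+ 2 + a4 E * x0 + a6 E
   else - (a1 E * x0 + a3 E).
have [y0 Hy] := @solve_monicpoly k 2 f isT; exists y0.
rewrite 2!big_ord_recl big_ord0 /= expr0 /f /= mulr1 addr0 expr1 in Hy.
by rewrite /= Hy; apply/eqP; ring.
Qed.

Lemma neg_on_curve x0 y0 : on_curve E (Some (x0, y0)) ->
  on_curve E (Some (x0, - y0 - a1 E * x0 - a3 E)).
Proof. by rewrite /= => /eqP <-; apply/eqP; ring. Qed.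

(** Let [x0] be a root of the denominator of [(a + b y) / d].  If there are two
    points above [x0], then [a + b y] vanishes at both, hence so do [a] and [b].
    If there is only one then [d] has order at least 2 there, and [a + b y]
    is the sum of a function of [x], of even order, and of [b (y - y0)]; again
    [a] and [b] vanish at [x0].  So [x - x0] can be cancelled. *)
Lemma affine_regularP f : (forall R, R != O -> regular R f) ->
  exists a b, f = P a + P b * y.
Proof.
move=> H; have [a [b [d [d0 e]]]] := cf_span f; rewrite polyf_eq0 in d0.
have [n] := ubnP (size d); elim: n => // n IH in a b d d0 e *.
rewrite ltnS => sd.
have [/eqP/size_poly1P[c c0 ed]|s1] := eqVneq (size d) 1%N.
  exists (c^-1 *: a), (c^-1 *: b).
  rewrite e ed -!mul_polyC !rmorphM /= -[P c%:P]/(C c) -[P (c^-1)%:P]/(C c^-1).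
  by rewrite fmorphV; field; rewrite cst_eq0.
have [x0 rx0] := closed_rootP d s1.
have key y0 : on_curve E (Some (x0, y0)) -> a.[x0] + b.[x0] * y0 = 0.
  move=> oc; have [c hc] := H (Point oc) isT.
  have h1 := hvM hc (hv_polyf oc d).
  have h2 := hvD (hv_polyf oc a) (hvM (hv_polyf oc b) (hv_y F oc)).
  have e2 : f * P d = P a + P b * y by rewrite e divfK ?polyf_eq0.
  rewrite e2 in h1; rewrite (hv_unique h2 h1).
  by move/rootP: rx0 => ->; rewrite mulr0.
have [y0 oc] := affine_point_exists x0.
have [ra rb] : a.[x0] = 0 /\ b.[x0] = 0.
  have k0 := key _ oc; have k1 := key _ (neg_on_curve oc).
  have [dy0|dy0] := eqVneq (dy E x0 y0) 0; last first.
    have b0 : b.[x0] = 0.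
      apply: (mulIf dy0); rewrite mul0r.
      transitivity ((a.[x0] + b.[x0] * y0) - (a.[x0]
        + b.[x0] * (- y0 - a1 E * x0 - a3 E))).
        by rewrite /dy; ring.
      by rewrite k0 k1 subr0.
    by move: k0; rewrite b0 mul0r addr0.
  have [r0|b0] := eqVneq b.[x0] 0; first by move: k0; rewrite r0 mul0r addr0.
  have e2 : f * P d = P (a + y0 *: b) + P b * (y - C y0).
    rewrite e divfK ?polyf_eq0 // rmorphD -mul_polyC rmorphM /= -[P y0%:P]/(C
      y0); ring.
  have [cd [ed /(_ (rootP rx0)) cd0]] := ord_polyf oc d0.
  have hd : vge (Point oc) 2 (P d).
    by rewrite vge_ord ?polyf_eq0 // ed (ord_XsubC_ram oc dy0); lia.
  have hf : vge (Point oc) 0 f by apply/vge_reg; exact: H.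
  have := vgeM hf hd; rewrite add0r e2 => /vge_split[].
    move=> ab0 by0; have ob : ord (Point oc) (P b * (y - C y0)) = 1.
      rewrite ordM ?polyf_eq0 ?coordy_sub_neq0 //; last first.
        by apply: contraNneq b0 => ->; rewrite horner0.
      by rewrite (ord_hv b0 (hv_polyf oc b)) (ord_YsubC_ram oc dy0).
    rewrite ob; rewrite polyf_eq0 in ab0; have [m [-> _]] := ord_polyf oc ab0.
    by rewrite (ord_XsubC_ram oc dy0); lia.
  move=> _; rewrite vge_ord; last first.
    rewrite mulf_neq0 ?coordy_sub_neq0 // polyf_eq0.
    by apply: contraNneq b0 => ->; rewrite horner0.
  rewrite ordM ?polyf_eq0 ?coordy_sub_neq0 //; last first.
    by apply: contraNneq b0 => ->; rewrite horner0.
  by rewrite (ord_hv b0 (hv_polyf oc b)) (ord_YsubC_ram oc dy0).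
have /factor_theorem [a' ea] : root a x0 by apply/rootP.
have /factor_theorem [b' eb] : root b x0 by apply/rootP.
have /factor_theorem [d' ed] := rx0.
have d0' : d' != 0 by apply: contraNneq d0 => d0'; rewrite ed d0' mul0r.
apply: (IH a' b' d' d0').
  have u0 : P ('X - x0%:P) != 0 by rewrite polyf_eq0 polyXsubC_eq0.
  have {}d0' : P d' != 0 by rewrite polyf_eq0.
  rewrite e ea eb ed !rmorphM.
  by move: (P ('X - _)) u0 => u u0; field; rewrite d0' u0.
move: sd; rewrite ed size_mul ?polyXsubC_eq0 // size_XsubC addn2 /=.
by move=> h; apply: leq_trans h.
Qed.

Lemma vge_infinity_const f : (forall R, R != O -> regular R f) ->
  vge O (-1) f ->
  exists c, f = C c.
Proof.
move=> /affine_regularP [a [b ->]] /vge_infinity [ha hb].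
have b0 : b = 0 by case: hb => //; lia.
have ea : a = (a`_0)%:P.
  by apply: size1_polyC; case: ha => [->|]; [rewrite size_poly0|lia].
by exists a`_0; rewrite b0 rmorph0 mul0r addr0 {1}ea.
Qed.

Lemma vge_infinity_linear f : (forall R, R != O -> regular R f) ->
  vge O (-2) f ->
  exists c d, f = C c * x + C d.
Proof.
move=> /affine_regularP [a [b ->]] /vge_infinity [ha hb].
have b0 : b = 0 by case: hb => //; lia.
have sa : (size a <= 2)%N by case: ha => [->|]; [rewrite size_poly0|lia].
suff ea : a = (a`_1)%:P * 'X + (a`_0)%:P.
  by exists a`_1, a`_0; rewrite b0 rmorph0 mul0r addr0 {1}ea rmorphD rmorphM.
apply/polyP => -[|[|i]];
  rewrite coefD coefC coefCM coefX ?mulr0 ?addr0 ?mulr1 ?add0r //.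
by rewrite nth_default // (leq_trans sa).
Qed.

End AffineRing.

(** The product of a line with its conjugate, restricted to the curve.  The
    hypotheses say that the line passes through the point [(X1, Y1)] and that
    its slope [L] is the one prescribed by the second point, in a form without
    division that is valid for chords and tangents. *)
Lemma line_identity (K : fieldType) (A1 A2 A3 A4 A6 X Y X1 Y1 X2 L : K) :
  Y ^+ 2 + A1 * X * Y + A3 * Y = X ^+ 3 + A2 * X ^+ 2 + A4 * X + A6 ->
  Y1 ^+ 2 + A1 * X1 * Y1 + A3 * Y1 = X1 ^+ 3 + A2 * X1 ^+ 2 + A4 * X1 + A6 ->
  L * (Y1 + Y1 + A1 * X1 + A3) + A1 * Y1 + L ^+ 2 * (X2 - X1)
    + A1 * L * (X2 - X1)
    = X1 ^+ 2 + X1 * X2 + X2 ^+ 2 + A2 * (X1 + X2) + A4 ->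
  (Y - Y1 - L * (X - X1)) * (- Y - (A1 * X + A3) - Y1 - L * (X - X1))
    = - ((X - X1) * (X - X2) * (X - (L ^+ 2 + A1 * L - A2 - X1 - X2))).
Proof.
move=> w e1 s; apply/subr0_eq.
transitivity (- (Y ^+ 2 + A1 * X * Y + A3 * Y - (X ^+ 3 + A2 * X ^+ 2
  + A4 * X + A6))
  + (Y1 ^+ 2 + A1 * X1 * Y1 + A3 * Y1 - (X1 ^+ 3 + A2 * X1 ^+ 2 + A4 * X1 + A6))
  + (L * (Y1 + Y1 + A1 * X1 + A3) + A1 * Y1 + L ^+ 2 * (X2 - X1)
    + A1 * L * (X2 - X1)
     - (X1 ^+ 2 + X1 * X2 + X2 ^+ 2 + A2 * (X1 + X2) + A4)) * (X - X1));
       first by ring.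
by rewrite w e1 s !subrr; ring.
Qed.

(** * Divisors of lines *)
Section Negation.
Context {k : closedFieldType} {E : elliptic_curve k}.
Implicit Types (R A B S : point E).

Definition neg_coords (P : option (k * k)) : option (k * k) :=
  if P is Some (u, v) then Some (u, - v - a1 E * u - a3 E) else None.

Lemma neg_coords_on_curve R : on_curve E (neg_coords R).
Proof. by case: R => [[[u v]|]] //= oc; exact: neg_on_curve. Qed.

Definition neg_point R : point E := Point (neg_coords_on_curve R).

Lemma neg_pointK : involutive neg_point.
Proof.
case=> [[[u v]|] oc]; apply: val_inj => //=; congr (Some (_, _)).
by ring.
Qed.

Lemma neg_origin : neg_point (origin E) = origin E.
Proof. exact: val_inj. Qed.

Lemma eq_or_neg_of_same_x (u v w : k) : on_curve E (Some (u, v)) ->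
  on_curve E (Some (u, w)) ->
  w = v \/ w = - v - a1 E * u - a3 E.
Proof.
move=> /= /eqP e /eqP e'.
have /eqP : (w - v) * (w - (- v - a1 E * u - a3 E)) = 0.
  transitivity ((w ^+ 2 + a1 E * u * w + a3 E * w) - (v ^+ 2 + a1 E * u * v
    + a3 E * v)).
    by ring.
  by rewrite e e' subrr.
by rewrite mulf_eq0 !subr_eq0 => /orP[]/eqP->; [left|right].
Qed.

Lemma dy_neg (u v : k) : (dy E u v == 0) = (- v - a1 E * u - a3 E == v).
Proof.
apply/eqP/eqP => e; last by rewrite /dy -(subrr v) -{3}e; ring.
by apply/subr0_eq; rewrite -[RHS]oppr0 -e /dy; ring.
Qed.

End Negation.

Section Divisors.
Context {k : closedFieldType} {E : elliptic_curve k} (F : coord_field E).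
Implicit Types (R A B S : point E) (f g : F) (c d : k).
Local Notation C := (cst F).
Local Notation x := (cx F).
Local Notation y := (cy F).
Local Notation O := (origin E).

(** The divisor [(A)]. *)
Definition pt A R : int := (R == A)%:Z.

Definition principal (D : point E -> int) : Prop :=
  exists2 f : F, f != 0 & forall R, ord R f = D R.

Lemma principal_ext D D' : D =1 D' -> principal D -> principal D'.
Proof. by move=> e [f f0 h]; exists f => // R; rewrite h e. Qed.

Lemma principal0 : principal (fun=> 0).
Proof. by exists 1; rewrite ?oner_neq0 // => R; rewrite ord1. Qed.

Lemma principalD D D' : principal D -> principal D' ->
  principal (fun R => D R + D' R).
Proof.
move=> [f f0 h] [g g0 h']; exists (f * g); first by rewrite mulf_neq0.
by move=> R; rewrite ordM // h h'.
Qed.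

Lemma principalN D : principal D -> principal (fun R => - D R).
Proof.
move=> [f f0 h]; exists f^-1; first by rewrite invr_eq0.
by move=> R; rewrite ordV // h.
Qed.

Lemma ord_vertical (x0 y0 : k) (oc : on_curve E (Some (x0, y0))) R :
  ord R (x - C x0) = pt (Point oc) R + pt (neg_point (Point oc)) R - 2 * pt O R.
Proof.
case: R => [[[u v]|] ocR]; last first.
  have -> : Point ocR = O by apply: val_inj.
  by rewrite ord_infinity_XsubC /pt.
rewrite /pt -!val_eqE /= mulr0 subr0.
have someE (a b c d : k) :
  (Some (a, b) == Some (c, d)) = (a == c) && (b == d) by [].
rewrite !someE; have [ex|nx] := eqVneq u x0; last first.
  by rewrite ord_XsubC_neq // eq_sym.
move: ocR; rewrite ex => ocR.
rewrite /=.
have nn (w : k) : - (- w - a1 E * x0 - a3 E) - a1 E * x0 - a3 E = w by ring.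
have [dy0|dy0] := eqVneq (dy E x0 v) 0; last first.
  rewrite ord_XsubC_unram //; rewrite dy_neg in dy0.
  have [ev|ev] := eq_or_neg_of_same_x oc ocR; rewrite ev ?nn in dy0 *.
    by rewrite eqxx eq_sym (negPf dy0).
  by rewrite eqxx eq_sym (negPf dy0).
rewrite ord_XsubC_ram //; move/eqP: dy0; rewrite dy_neg.
have [->|->] := eq_or_neg_of_same_x oc ocR; rewrite ?nn => /eqP e;
  last by rewrite -e !eqxx.
by rewrite e !eqxx.
Qed.


Lemma conj_exists : exists phi : {rmorphism F -> F},
  (forall p, phi (polyf F p) = polyf F p) /\ phi y = - y - polyf F (lin E).
Proof.
apply: cf_lift_exists => [p|]; first by rewrite polyf_eq0.
by rewrite -cf_equation; ring.
Qed.

Definition conj : {rmorphism F -> F} := sval (cid conj_exists).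

Lemma conj_poly p : conj (polyf F p) = polyf F p.
Proof. by rewrite /conj; case: cid => phi []. Qed.

Lemma conj_y : conj y = - y - polyf F (lin E).
Proof. by rewrite /conj; case: cid => phi []. Qed.

Lemma conjK : involutive conj.
Proof.
move=> f; apply: (cf_rmorph_eq (phi := conj \o conj) (psi := idfun)) => /= [p|].
  by rewrite !conj_poly.
by rewrite conj_y rmorphB rmorphN conj_poly conj_y; ring.
Qed.

Lemma ord_conj R f : f != 0 -> ord R (conj f) = ord (neg_point R) f.
Proof.
apply: (ord_transfer (phi := conj)); last by move=> g; exists (conj g);
  exact: conjK.
have cC c : conj (C c) = C c by exact: conj_poly.
have cxE : conj x = x by exact: conj_poly.
have [ordx ordy] := ord_infinity_x F.
have [cy0 ordcy] : conj y != 0 /\ ord O (conj y) = -3.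
  rewrite conj_y -ordy -(ordN O (cy_neq0 F)); apply: ordD;
    first by rewrite oppr_eq0 cy_neq0.
  rewrite ordN ?cy_neq0 // ordy vgeN polyf_lin; apply: vgeD.
    by apply: vgeZ; rewrite vge_ord ?cx_neq0 // ordx.
  by apply: vge_le (vge_cst F O _).
apply: dominate_reg => //; apply: dominate_hv => //.
  case: R => [[[u v]|] oc] /=; first by rewrite cxE; exact: hv_x.
  have -> : Point oc = O by exact: val_inj.
  rewrite fmorph_div cxE; apply: hv_ord_gt0;
    first by rewrite mulf_neq0 ?invr_eq0 ?cx_neq0.
  by rewrite ord_div ?cx_neq0 // ordx ordcy.
case: R => [[[u v]|] oc] /=; last first.
  have -> : Point oc = O by exact: val_inj.
  by rewrite fmorphV; apply: hv_ord_gt0; rewrite ?invr_eq0 // ordV // ordcy.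
rewrite conj_y polyf_lin opprD addrA; apply: hvB; last exact: hv_cst.
by apply: hvB; [apply: hvN; exact: hv_y|apply: hvM;
  [exact: hv_cst|exact: hv_x]].
Qed.

Section Line.
Context (x1 y1 x2 y2 : k).
Hypotheses (oc1 : on_curve E (Some (x1, y1))) (oc2 :
  on_curve E (Some (x2, y2))).
Hypothesis not_opp : ~~ ((x1 == x2) && (y2 == - y1 - a1 E * x1 - a3 E)).
Local Notation l := (slope E x1 y1 x2 y2).
Local Notation x3 := (l ^+ 2 + a1 E * l - a2 E - x1 - x2).

Lemma slope_relation :
  l * (y1 + y1 + a1 E * x1 + a3 E) + a1 E * y1 + l ^+ 2 * (x2 - x1)
    + a1 E * l * (x2 - x1)
  = (x1 ^+ 2 + x1 * x2 + x2 ^+ 2) + a2 E * (x1 + x2) + a4 E.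
Proof.
move: oc1 oc2 not_opp => /= /eqP H1 /eqP H2.
rewrite /slope; case: eqP => [e /= NO|/eqP ne _]; last first.
  have d0 : x2 - x1 != 0 by rewrite subr_eq0 eq_sym.
  apply: (mulIf d0).
  have -> : (x1 ^+ 2 + x1 * x2 + x2 ^+ 2 + a2 E * (x1 + x2) + a4 E) * (x2 - x1)
      = (x2 ^+ 3 + a2 E * x2 ^+ 2 + a4 E * x2 + a6 E)
        - (x1 ^+ 3 + a2 E * x1 ^+ 2 + a4 E * x1 + a6 E) by ring.
  by rewrite -H1 -H2; field.
move: oc2; rewrite -e => oc2'; have [ey|ey] := eq_or_neg_of_same_x oc1 oc2';
  last by rewrite ey eqxx in NO.
have D0 : dy E x1 y1 != 0 by rewrite dy_neg eq_sym -{1}ey.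
by rewrite /dy in D0; field.
Qed.

Lemma line_through_second : y2 = y1 + l * (x2 - x1).
Proof.
rewrite /slope; case: eqP not_opp => [e /= NO|/eqP ne _]; last first.
  by field; rewrite subr_eq0 eq_sym.
move: oc2; rewrite -e => oc2'; have [ey|ey] := eq_or_neg_of_same_x oc1 oc2';
  last by rewrite ey eqxx in NO.
by rewrite ey subrr mulr0 addr0.
Qed.

Definition line_fun : F := y - C y1 - C l * (x - C x1).

Lemma line_fun_conj :
  line_fun * conj line_fun = - ((x - C x1) * (x - C x2) * (x - C x3)).
Proof.
have cC c : conj (C c) = C c by exact: conj_poly.
have cxE : conj x = x by exact: conj_poly.
have s := congr1 C slope_relation; have /eqP/(congr1 C) e1 := oc1.
rewrite /line_fun !rmorphB rmorphM rmorphB !cC cxE conj_y polyf_lin.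
rewrite !(rmorphXn, rmorphB, rmorphD, rmorphM) /=.
rewrite !(rmorphXn, rmorphB, rmorphD, rmorphM) /= in s.
rewrite !(rmorphXn, rmorphB, rmorphD, rmorphM) /= in e1.
exact: line_identity (weierstrassE F) e1 s.
Qed.

Lemma line_fun_neq0 : line_fun != 0.
Proof.
apply/eqP => e; have [] := @cf_free _ E F (- y1%:P - l *: ('X - x1%:P)) 1.
  rewrite rmorph1 mul1r rmorphB rmorphN -mul_polyC rmorphM rmorphB /=.
  by rewrite -[RHS]e /line_fun /cst /=; ring.
by move=> _ /eqP; rewrite oner_eq0.
Qed.

Lemma hv_line_fun (u v : k) (oc : on_curve E (Some (u, v))) :
  has_value (Point oc) line_fun (v - y1 - l * (u - x1)).
Proof.
apply: hvB; last by apply: hvM; [exact: hv_cst|apply: hvB;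
  [exact: hv_x|exact: hv_cst]].
by apply: hvB; [exact: hv_y|exact: hv_cst].
Qed.

Lemma third_on_curve : on_curve E (Some (x3, y1 + l * (x3 - x1))).
Proof.
have := neg_coords_on_curve (add_point (Point oc1) (Point oc2)).
rewrite /add_point /= (negPf not_opp) /neg_coords.
have nn (w v : k) : - (- w - a1 E * v - a3 E) - a1 E * v - a3 E = w by ring.
by rewrite nn.
Qed.

(** The orders at [R] and at [-R] add up to the order of the product
    [line_fun_conj].  If the line misses one of [R] and [-R] then that order is
    zero; if it contains both then [R = -R], since it is not vertical. *)
Lemma ord_line_fun R : ord R line_fun
  = pt (Point oc1) R + pt (Point oc2) R
    + pt (Point third_on_curve) R - 3 * pt O R.
Proof.
have l0 := line_fun_neq0.
have cl0 : conj line_fun != 0 by rewrite fmorph_eq0.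
set T3 := Point third_on_curve.
have X0 c : x - C c != 0 by exact: cx_cst_neq0.
have := congr1 (ord R) line_fun_conj.
rewrite ordN ?mulf_neq0 // !ordM ?mulf_neq0 // ord_conj //.
have := ord_vertical third_on_curve R; move=> ->.
rewrite (ord_vertical oc1) (ord_vertical oc2).
rewrite -/T3.
have negE A : pt (neg_point A) R = pt A (neg_point R).
  by rewrite /pt -[R in LHS]neg_pointK (inj_eq (inv_inj (@neg_pointK _ E))).
rewrite !negE.
have ptv (u v : k) (oc : on_curve E (Some (u, v))) S c :
    has_value S line_fun c -> c != 0 -> v = y1 + l * (u - x1) ->
      pt (Point oc) S = 0.
  move=> hc c0 ev; rewrite /pt; case: eqP => // eS; move: c0; rewrite eS in hc.
  by rewrite (hv_unique hc (hv_line_fun oc)) ev addrAC addrK subrr eqxx.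
have on1 : y1 = y1 + l * (x1 - x1) by rewrite subrr mulr0 addr0.
have on2 := line_through_second.
have [->|RO] := eqVneq R O.
  by rewrite neg_origin /pt /=; lia.
have ptO : pt O R = 0 by rewrite /pt (negPf RO).
rewrite ptO !mulr0 !subr0.
have hR : exists c, has_value R line_fun c.
  by case: (R) RO => [[[u v]|] oc] // _; eexists; exact: hv_line_fun.
have [c hc] := hR; have hN : exists c, has_value (neg_point R) line_fun c.
  case: (R) RO => [[[u v]|] oc] // _; eexists.
  exact: (hv_line_fun (neg_coords_on_curve (Point oc))).
have [d hd] := hN.
have [c0|c0] := eqVneq c 0; last first.
  by rewrite !(ptv _ _ _ _ _ hc c0) // (ord_hv c0 hc) !add0r.
have [d0|d0] := eqVneq d 0; last first.
  by rewrite !(ptv _ _ _ _ _ hd d0) // (ord_hv d0 hd) !addr0.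
have -> : neg_point R = R.
  rewrite c0 in hc; rewrite d0 in hd;
    case: (R) RO hc hd => [[[u v]|] oc] // _ hc hd.
  have e1 := hv_unique hc (hv_line_fun oc).
  have e2 := hv_unique hd (hv_line_fun (neg_coords_on_curve (Point oc))).
  apply: val_inj => /=; congr (Some (_, _)).
  apply/subr0_eq; transitivity ((- v - a1 E * u - a3 E - y1 - l * (u - x1))
    - (v - y1 - l * (u - x1))).
    by ring.
  by rewrite -e1 -e2 subrr.
by lia.
Qed.

End Line.

Lemma add_point_principal A B :
  principal (fun R => pt A R + pt B R - pt (add_point A B) R - pt O R).
Proof.
case: A B => [[[x1 y1]|] oc1] [[[x2 y2]|] oc2]; last 3 first.
- have -> : Point oc2 = O by exact: val_inj.
  have -> : add_point (Point oc1) O = Point oc1 by exact: val_inj.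
  by apply: principal_ext principal0 => R; ring.
- have -> : Point oc1 = O by exact: val_inj.
  have -> : add_point O (Point oc2) = Point oc2 by exact: val_inj.
  by apply: principal_ext principal0 => R; ring.
- have -> : Point oc1 = O by exact: val_inj.
  have -> : Point oc2 = O by exact: val_inj.
  have -> : add_point O O = O by exact: val_inj.
  by apply: principal_ext principal0 => R; ring.
have [/andP[/eqP ex /eqP ey]|no] :=
  boolP ((x1 == x2) && (y2 == - y1 - a1 E * x1 - a3 E)).
  have -> : Point oc2 = neg_point (Point oc1) by apply: val_inj;
    rewrite /= -ex ey.
  have -> : add_point (Point oc1) (neg_point (Point oc1)) = O.
    by apply: val_inj; rewrite /= !eqxx.
  exists (x - C x1); first exact: cx_cst_neq0.
  by move=> R; rewrite (ord_vertical oc1); ring.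
exists (line_fun x1 y1 x2 y2 / (x - C (slope E x1 y1 x2 y2 ^+ 2
  + a1 E * slope E x1 y1 x2 y2 - a2 E - x1 - x2))).
  by rewrite mulf_neq0 ?invr_eq0 ?line_fun_neq0 ?cx_cst_neq0.
move=> R; rewrite ord_div ?line_fun_neq0 ?cx_cst_neq0 //.
rewrite (ord_line_fun oc1 oc2 no) (ord_vertical (third_on_curve oc1 oc2 no)).
have -> : neg_point (Point (third_on_curve oc1 oc2 no))
  = add_point (Point oc1) (Point oc2).
  by apply: val_inj; rewrite /= (negPf no).
by ring.
Qed.

End Divisors.

(** * The group law *)
Section GroupLaw.
Context {k : closedFieldType} {E : elliptic_curve k} (F : coord_field E).
Implicit Types (R A B S : point E) (f g : F) (c d : k).
Local Notation C := (cst F).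
Local Notation x := (cx F).
Local Notation O := (origin E).
Local Notation principal := (principal F).

Lemma pt_same A : pt A A = 1. Proof. by rewrite /pt eqxx. Qed.
Lemma pt_neq A R : R != A ->
  pt A R = 0. Proof. by rewrite /pt => /negPf ->. Qed.
Lemma pt_ge0 A R : 0 <= pt A R. Proof. by []. Qed.
Lemma ord_const R f : (exists c, f = C c) -> f != 0 -> ord R f = 0.
Proof. by move=> [c ->]; rewrite cst_eq0 => c0; rewrite ord_cst. Qed.

(** Multiplying by [x - x_B] moves the pole from [B] to infinity: the result has
    at most a double pole there, so it is [c x + d].  Its zero at [-B] shows that
    it is a multiple of [x - x_B], so the original function is constant. *)
Lemma principal_pt_inj A B : principal (fun R => pt A R - pt B R) -> A = B.
Proof.
move=> [f f0 h]; apply/eqP/negPn/negP => AB.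
suff fc : exists c, f = C c.
  by have := h A; rewrite ord_const // pt_same pt_neq.
case: B AB h => [[[x0 y0]|] oc] AB h; last first.
  have eO : Point oc = O by exact: val_inj.
  rewrite eO in h AB; apply: vge_infinity_const.
    by move=> R RO; apply: hv_ord_ge0; rewrite ?h // (pt_neq RO) subr0 pt_ge0.
  by rewrite vge_ord // h pt_same; have := pt_ge0 A O; lia.
set B := Point oc in AB h; set g := f * (x - C x0).
have x0' := cx_cst_neq0 F x0.
have g0 : g != 0 by rewrite mulf_neq0.
have og R : ord R g = pt A R + pt (neg_point B) R - 2 * pt O R.
  by rewrite ordM // h (ord_vertical F oc) -/B; ring.
have [c [d e]] : exists c d, g = C c * x + C d.
  apply: vge_infinity_linear.
    move=> R RO; apply: hv_ord_ge0 => //; rewrite og (pt_neq RO).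
    by have := pt_ge0 A R; have := pt_ge0 (neg_point B) R; lia.
  by rewrite vge_ord // og pt_same; have := pt_ge0 A O;
    have := pt_ge0 (neg_point B) O; lia.
have hg : has_value (neg_point B) g 0.
  apply: hv_ord_gt0 => //; rewrite og pt_same (@pt_neq O (neg_point B)) //.
  by have := pt_ge0 A (neg_point B); lia.
have hg' : has_value (neg_point B) g (c * x0 + d).
  rewrite e; apply: hvD; last exact: hv_cst.
  by apply: hvM; [exact: hv_cst|exact: (hv_x F (neg_coords_on_curve B))].
have cd := hv_unique hg hg'.
exists c; apply: (mulIf x0'); rewrite -/g e.
have -> : d = - (c * x0) by apply/eqP; rewrite -addr_eq0 addrC -cd.
by rewrite rmorphN rmorphM /=; ring.
Qed.

(** By [principal_pt_inj], identities in the group reduce to identities between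
    divisors; in particular associativity. *)
Lemma add_point_uniq A B S :
  principal (fun R => pt A R + pt B R - pt S R - pt O R) -> S = add_point A B.
Proof.
move=> h; apply: principal_pt_inj.
apply: principal_ext (principalD (add_point_principal F A B) (principalN h))
  => R.
by ring.
Qed.

Lemma addO A : add_point O A = A. Proof. exact: val_inj. Qed.
Lemma addrO A : add_point A O = A.
Proof. by case: A => [[[u v]|] oc]; apply: val_inj. Qed.

Lemma add_pointC A B : add_point A B = add_point B A.
Proof.
apply: add_point_uniq; apply: principal_ext (add_point_principal F A B) => R.
by ring.
Qed.

Lemma add_pointA A B S :
  add_point A (add_point B S) = add_point (add_point A B) S.
Proof.
apply: add_point_uniq.
have h1 := add_point_principal F A B; have h2 := add_point_principal F B S.
have h3 := add_point_principal F A (add_point B S).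
apply: principal_ext (principalD (principalD h2 h3) (principalN h1)) => R.
by ring.
Qed.

Lemma add_negr A : add_point A (neg_point A) = O.
Proof.
apply/esym/add_point_uniq; case: A => [[[u v]|] oc].
  exists (x - C u); first exact: cx_cst_neq0.
  by move=> R; rewrite (ord_vertical F oc); ring.
have -> : Point oc = O by exact: val_inj.
by rewrite neg_origin; apply: principal_ext (principal0 F) => R; ring.
Qed.

Lemma add_negl A : add_point (neg_point A) A = O.
Proof. by rewrite add_pointC add_negr. Qed.

Lemma add_pointK A B : add_point (neg_point A) (add_point A B) = B.
Proof. by rewrite add_pointA add_negl addO. Qed.

Lemma add_point_inj A : injective (add_point A).
Proof. by move=> B S e; rewrite -(add_pointK A B) e add_pointK. Qed.

Lemma mul_pointS n A : mul_point n.+1 A = add_point A (mul_point n A).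
Proof. by []. Qed.

Lemma mul_pointD m n A :
  mul_point (m + n) A = add_point (mul_point m A) (mul_point n A).
Proof.
elim: m => [|m IH]; first by rewrite add0n addO.
by rewrite addSn !mul_pointS IH add_pointA.
Qed.

Lemma mul_pointM m n A : mul_point (m * n) A = mul_point m (mul_point n A).
Proof. by elim: m => // m IH; rewrite mulSn mul_pointD mul_pointS IH. Qed.

Lemma mul_point_origin n : mul_point n O = O.
Proof. by elim: n => // n IH; rewrite mul_pointS IH addO. Qed.

Lemma mul_point_principal n A :
  principal (fun R => n%:Z * pt A R - pt (mul_point n A) R - (n%:Z
    - 1) * pt O R).
Proof.
elim: n => [|n IH].
  by apply: principal_ext (principal0 F) => R /=; ring.
apply: principal_ext (principalD IH (add_point_principal F A (mul_point n
  A))) => R.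
by rewrite mul_pointS intS; ring.
Qed.

Lemma torsion_principal n A : mul_point n A = O ->
  principal (fun R => n%:Z * pt A R - n%:Z * pt O R).
Proof.
move=> e; apply: principal_ext (mul_point_principal n A) => R; rewrite e; ring.
Qed.

End GroupLaw.

(** * Translations *)
Section CoordinateLift.
Context {k : closedFieldType} {E E' : elliptic_curve k}.
Context (F : coord_field E) (F' : coord_field E').
Local Notation C := (cst F).

(** Over an algebraically closed field a nonconstant function is transcendental,
    since a polynomial is a product of linear factors. *)
Lemma coordinate_lift (X Y : F) : (forall c, X != C c) ->
  Y ^+ 2 + C (a1 E') * X * Y + C (a3 E') * Y
    = X ^+ 3 + C (a2 E') * X ^+ 2 + C (a4 E') * X + C (a6 E') ->
  exists phi : {rmorphism F' -> F},
    [/\ forall c, phi (cst F' c) = C c, phi (cx F') = X & phi (cy F') = Y].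
Proof.
move=> Xc w; have [kappa kC kX] : exists2 kappa : {rmorphism {poly k} -> F},
    forall c, kappa c%:P = C c & kappa 'X = X.
  exists (horner_eval X \o map_poly C) => [c|] /=.
    by rewrite map_polyC /horner_eval hornerC.
  by rewrite map_polyX /horner_eval hornerX.
have k0 p : p != 0 -> kappa p != 0.
  have [r er] := closed_field_poly_normal p; rewrite -lead_coef_eq0 => l0.
  rewrite er -mul_polyC rmorphM kC mulf_neq0 ?cst_eq0 //.
  elim: r {er} => [|z r IH]; first by rewrite big_nil rmorph1 oner_neq0.
  by rewrite big_cons rmorphM mulf_neq0 // rmorphB kC kX subr_eq0.
have cur : Y ^+ 2 + kappa (lin E') * Y = kappa (cubic E').
  rewrite /lin /cubic !rmorphD /= -!mul_polyC !rmorphM kC kX.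
  transitivity (Y ^+ 2 + C (a1 E') * X * Y + C (a3 E') * Y);
    first by rewrite kC; ring.
  by rewrite w !kC; ring.
have [phi [p1 p2]] := cf_lift_exists F' k0 cur.
exists phi; split=> // [c|]; first exact: etrans (p1 _) (kC c).
exact: etrans (p1 _) kX.
Qed.

End CoordinateLift.

Lemma third_point_identity (K : fieldType) (A1 A2 A3 A4 A6 X0 Y0 X Y L : K) :
  X != X0 -> L * (X - X0) = Y - Y0 ->
  Y ^+ 2 + A1 * X * Y + A3 * Y = X ^+ 3 + A2 * X ^+ 2 + A4 * X + A6 ->
  Y0 ^+ 2 + A1 * X0 * Y0 + A3 * Y0 = X0 ^+ 3 + A2 * X0 ^+ 2 + A4 * X0 + A6 ->
  let X3 := L ^+ 2 + A1 * L - A2 - X - X0 in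
  let Y3 := - (Y0 + L * (X3 - X0)) - A1 * X3 - A3 in
  Y3 ^+ 2 + A1 * X3 * Y3 + A3 * Y3 = X3 ^+ 3 + A2 * X3 ^+ 2 + A4 * X3 + A6.
Proof.
move=> ne eL w e X3 Y3; have d0 : X - X0 != 0 by rewrite subr_eq0.
have s : L * (Y0 + Y0 + A1 * X0 + A3) + A1 * Y0 + L ^+ 2 * (X - X0)
  + A1 * L * (X - X0)
    = X0 ^+ 2 + X0 * X + X ^+ 2 + A2 * (X0 + X) + A4.
  apply: (mulIf d0).
  have -> : (X0 ^+ 2 + X0 * X + X ^+ 2 + A2 * (X0 + X) + A4) * (X - X0)
      = (X ^+ 3 + A2 * X ^+ 2 + A4 * X + A6) - (X0 ^+ 3 + A2 * X0 ^+ 2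
        + A4 * X0 + A6) by ring.
  rewrite -w -e; have -> : Y = Y0 + L * (X - X0) by rewrite eL; ring.
  by ring.
apply/subr0_eq.
transitivity ((Y0 ^+ 2 + A1 * X0 * Y0 + A3 * Y0 - (X0 ^+ 3 + A2 * X0 ^+ 2
  + A4 * X0 + A6))
  + (L * (Y0 + Y0 + A1 * X0 + A3) + A1 * Y0 + L ^+ 2 * (X - X0)
    + A1 * L * (X - X0)
     - (X0 ^+ 2 + X0 * X + X ^+ 2 + A2 * (X0 + X) + A4)) * (X3 - X0)).
  by rewrite /Y3 /X3; ring.
by rewrite e s !subrr mul0r addr0.
Qed.

Section Translation.
Context {k : closedFieldType} {E : elliptic_curve k} (F : coord_field E).
Local Notation C := (cst F).
Local Notation x := (cx F).
Local Notation y := (cy F).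
Local Notation O := (origin E).

Section Formulas.
Context (x0 y0 : k) (oc : on_curve E (Some (x0, y0))).
Local Notation Q := (Point oc).

(** The addition formulas for [(x0, y0) + (x, y)], at the generic point. *)
Definition shift_slope : F := (y - C y0) / (x - C x0).
Definition shift_x : F :=
  shift_slope ^+ 2 + C (a1 E) * shift_slope - C (a2 E) - x - C x0.
Definition shift_y : F :=
  - (C y0 + shift_slope * (shift_x - C x0)) - C (a1 E) * shift_x - C (a3 E).

Let D0 : x - C x0 != 0. Proof. exact: cx_cst_neq0. Qed.
Let w := weierstrassE F.
Let e0 : C y0 ^+ 2 + C (a1 E) * C x0 * C y0 + C (a3 E) * C y0
  = C x0 ^+ 3 + C (a2 E) * C x0 ^+ 2 + C (a4 E) * C x0 + C (a6 E).
Proof.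
by have /eqP/(congr1 C) := oc;
  rewrite !(rmorphXn, rmorphB, rmorphD, rmorphM) /=.
Qed.

Lemma shift_on_curve :
  shift_y ^+ 2 + C (a1 E) * shift_x * shift_y + C (a3 E) * shift_y
  = shift_x ^+ 3 + C (a2 E) * shift_x ^+ 2 + C (a4 E) * shift_x + C (a6 E).
Proof.
apply: (third_point_identity (X := x) (Y := y)) => //;
  first by rewrite -subr_eq0.
by rewrite /shift_slope divfK.
Qed.

Hypothesis dy0 : dy E x0 y0 != 0.
Local Notation y0' := (- y0 - a1 E * x0 - a3 E).

Lemma ord_translation_pole :
  [/\ shift_x != 0, shift_y != 0, ord (neg_point Q) shift_x = -2
  & ord (neg_point Q) shift_y = -3].
Proof.
set R := neg_point Q.
have ocR : on_curve E (Some (x0, y0')) := neg_coords_on_curve Q.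
have ER : R = Point ocR by exact: val_inj.
have dyR : dy E x0 y0' = - dy E x0 y0 by rewrite /dy; ring.
have ox : ord R (x - C x0) = 1.
  by rewrite ER ord_XsubC_unram // dyR oppr_eq0.
have hy : has_value R (y - C y0) (- dy E x0 y0).
  have -> : - dy E x0 y0 = y0' - y0 by rewrite /dy; ring.
  by apply: hvB; [rewrite ER; exact: hv_y|exact: hv_cst].
have dy0' : - dy E x0 y0 != 0 by rewrite oppr_eq0.
have y0n : y - C y0 != 0 by exact: coordy_sub_neq0.
have l0 : shift_slope != 0 by rewrite mulf_neq0 ?invr_eq0.
have ol : ord R shift_slope = -1 by rewrite ord_div // (ord_hv dy0' hy) ox.
have l20 : shift_slope ^+ 2 != 0 by rewrite expf_neq0.
have ol2 : ord R (shift_slope ^+ 2) = -2 by rewrite ordX // ol.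
have vc c n : n <= 0 -> vge R n (C c) by move=> h; apply: vge_le h _;
  exact: vge_cst.
have vx n : n <= 0 -> vge R n x.
  move=> h; apply: vge_le h _; apply/vge_reg; exists x0; rewrite ER;
    exact: hv_x.
have [t0 ot] : shift_x != 0 /\ ord R shift_x = -2.
  have -> : shift_x = shift_slope ^+ 2
    + (C (a1 E) * shift_slope - C (a2 E) - x - C x0) by rewrite /shift_x; ring.
  rewrite -ol2; apply: ordD => //; rewrite ol2.
  apply: vgeB; last exact: vc; apply: vgeB; last exact: vx; apply: vgeB;
    last exact: vc.
  by apply: vgeZ; rewrite vge_ord // ol.
have lt0 : - (shift_slope * shift_x) != 0 by rewrite oppr_eq0 mulf_neq0.
have olt : ord R (- (shift_slope * shift_x)) = -3 by rewrite ordN;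
  [rewrite ordM // ol ot|exact: mulf_neq0].
suff [u0 ou] : shift_y != 0 /\ ord R shift_y = -3 by [].
have -> : shift_y = - (shift_slope * shift_x)
  + (C x0 * shift_slope - C y0 - C (a1 E) * shift_x - C (a3 E)).
  by rewrite /shift_y; ring.
rewrite -olt; apply: ordD => //; rewrite olt.
apply: vgeB; last exact: vc; apply: vgeB; last by apply: vgeZ;
  rewrite vge_ord // ot.
by apply: vgeB; [apply: vgeZ; rewrite vge_ord // ol|exact: vc].
Qed.

Lemma shift_x_not_const c : shift_x != C c.
Proof.
have [t0 _ ot _] := ord_translation_pole; apply/eqP => e.
by move: ot; rewrite ord_const //; exists c.
Qed.

(** At the origin the poles in the addition formulas cancel.  Eliminating the
    cube [x^3] and the square [y^2] by the equation leaves numerators [N] and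
    [N'], of order at least -3 and -5, over the square and the cube of
    [x - x0]. *)
Lemma hv_translation_origin : has_value O shift_x x0 /\ has_value O shift_y y0.
Proof.
have [ox oy] := ord_infinity_x F; have x00 := cx_neq0 F; have y00 := cy_neq0 F.
have oD : ord O (x - C x0) = -2 := ord_infinity_XsubC F x0.
pose b := y0 ^+ 2 + a1 E * x0 * y0 - a2 E * x0 ^+ 2 - 2%:R * x0 ^+ 3 + a6 E.
pose N := C (dx E x0 y0) * x + C b - C (dy E x0 y0) * y.
have vc c n : n <= 0 -> vge O n (C c) by move=> h; apply: vge_le h _;
  exact: vge_cst.
have vx n : n <= -2 -> vge O n x by move=> h; rewrite vge_ord // ox.
have vy n : n <= -3 -> vge O n y by move=> h; rewrite vge_ord // oy.
have vD f n : vge O (n - 2) f -> vge O n (f / (x - C x0)).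
  move=> hf; rewrite -[n](subrK 2); apply: vgeM => //.
  by rewrite vge_ord ?invr_eq0 // ordV // oD.
have eN : shift_x - C x0 = N / (x - C x0) / (x - C x0).
  apply: (mulIf D0); apply: (mulIf D0); rewrite !divfK //.
  transitivity (N + (y ^+ 2 + C (a1 E) * x * y + C (a3 E) * y
    - (x ^+ 3 + C (a2 E) * x ^+ 2 + C (a4 E) * x + C (a6 E))));
      last by rewrite w; ring.
  rewrite /N /b /dx /dy /shift_x /shift_slope; move: D0.
  rewrite !(rmorphXn, rmorphB, rmorphD, rmorphM, rmorph_nat) -/C.
  by move=> D0'; field.
have vN : vge O (-3) N.
  apply: vgeB; last by apply: vgeZ; exact: vy.
  by apply: vgeD; [apply: vgeZ; exact: vx|exact: vc].
have vtx : vge O 1 (shift_x - C x0).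
  by rewrite eN; do 2!apply: (vD); exact: vge_le vN.
split; first by apply/vge_hv.
apply/vge_hv.
have -> : shift_y - C y0
  = - (C (dy E x0 y0) + shift_slope * (shift_x - C x0))
  - C (a1 E) * (shift_x - C x0).
  rewrite /shift_y /dy !(rmorphXn, rmorphB, rmorphD, rmorphM,
    rmorph_nat) -/C; ring.
apply: vgeB; last exact: vgeZ.
rewrite vgeN.
pose K := C (dy E x0 y0).
pose N' := (K * C (a1 E) + C (dx E x0 y0)) * x * y - (K * (C (a2 E)
  + 3%:R * C x0)) * x ^+ 2
  + (K * (3%:R * C x0 ^+ 2 - C (a4 E)) - C y0 * C (dx E x0 y0)) * x
  + (K * C (a3 E) + C b + K * C y0) * y - K * (C x0 ^+ 3
    + C (a6 E)) - C y0 * C b.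
have -> : C (dy E x0 y0) + shift_slope * (shift_x - C x0)
  = N' / (x - C x0) / (x - C x0) / (x - C x0).
  rewrite eN /shift_slope; do 3!apply: (mulIf D0); rewrite !divfK //.
  transitivity (N' - K * (y ^+ 2 + C (a1 E) * x * y + C (a3 E) * y
    - (x ^+ 3 + C (a2 E) * x ^+ 2 + C (a4 E) * x + C (a6 E))));
      last by rewrite w; ring.
  rewrite /N' /N -/K; clear N'; clearbody K;
    move: (C b) (C (dx E x0 y0)) D0 => B DX D0'.
  by field.
do 3!apply: (vD).
have vK : vge O 0 K by exact: vge_cst.
have vc0 c : vge O 0 (C c) := vge_cst F O c.
have v0M f g n : vge O 0 f -> vge O n g -> vge O n (f * g).
  by move=> hf hg; rewrite -[n]add0r; exact: vgeM.
have vnat n : vge O 0 (n%:R : F) by rewrite -(rmorph_nat C).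
have vxx n : n <= -4 -> vge O n (x ^+ 2).
  by move=> h; rewrite vge_ord ?expf_neq0 // ordX // ox.
have vxy n : n <= -5 -> vge O n (x * y).
  by move=> h; rewrite vge_ord ?mulf_neq0 // ordM // ox oy.
have v00 n f : n <= 0 -> vge O 0 f -> vge O n f by exact: vge_le.
have vX0 n : vge O 0 (C x0 ^+ n) by rewrite -rmorphXn.
rewrite /N' -mulrA.
apply: vgeB; last by apply: v00 => //; exact: v0M.
apply: vgeB; last by apply: v00 => //; apply: (v0M) => //; exact: vgeD.
apply: vgeD; last by apply: (v0M); [apply: vgeD; [apply: vgeD => //;
  exact: v0M|exact: v0M]|exact: vy].
apply: vgeD; last first.
  by apply: (v0M); [apply: vgeB; [apply: (v0M) => //; apply: vgeB => //;
    exact: v0M|exact: v0M]|exact: vx].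
apply: vgeB; last by apply: (v0M); [apply: (v0M) => //; apply: vgeD => //;
  exact: v0M|exact: vxx].
by apply: (v0M); [apply: vgeD => //; exact: v0M|exact: vxy].
Qed.

Lemma hv_translation_affine (u v : k) (ocR : on_curve E (Some (u, v))) :
  Point ocR != neg_point Q ->
  let l := slope E x0 y0 u v in
  let u3 := l ^+ 2 + a1 E * l - a2 E - x0 - u in
  has_value (Point ocR) shift_x u3 /\ has_value (Point ocR) shift_y (- (y0
    + l * (u3 - x0)) - a1 E * u3 - a3 E).
Proof.
move=> ne l u3; have hc c := hv_cst F (Point ocR) c.
have hl : has_value (Point ocR) shift_slope l.
  rewrite /l /slope; case: eqP => [e|/eqP ne'].
    have [ev|ev] := eq_or_neg_of_same_x oc (eq_ind_r (fun z =>
      on_curve E (Some (z, v))) ocR e); last first.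
      by case/eqP: ne; apply: val_inj; rewrite /= -e ev.
    have -> : shift_slope
      = (x ^+ 2 + x * C x0 + C x0 ^+ 2 + C (a2 E) * (x + C x0)
      + C (a4 E) - C (a1 E) * C y0)
       / (y + C y0 + C (a1 E) * x + C (a3 E)).
      have hA := hv_secant_dy F oc; have A0 := hv_neq0 dy0 hA.
      by apply/eqP; rewrite /shift_slope eqr_div // (curve_secant F oc) mulrC.
    have -> : Point ocR = Q by apply: val_inj; rewrite /= -e ev.
    by apply: hvM; [exact: hv_secant_dx|apply: hvV => //; exact: hv_secant_dy].
  apply: hvM; first by apply: hvB => //; exact: hv_y.
  by apply: hvV; [rewrite subr_eq0 eq_sym|apply: hvB => //; exact: hv_x].
have htx : has_value (Point ocR) shift_x u3.
  have -> : u3 = l ^+ 2 + a1 E * l - a2 E - u - x0 by rewrite /u3; ring.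
  apply: hvB => //; apply: hvB; last exact: hv_x.
  by apply: hvB => //; apply: hvD; [exact: hvX|exact: hvM].
split=> //; apply: hvB => //; apply: hvB; last exact: hvM.
by apply: hvN; apply: hvD => //; apply: hvM => //; exact: hvB.
Qed.

(** The hypothesis that [Q] is not of order 2 gives the formulas a simple
    behaviour at [-Q], where the slope has a simple pole, and at [Q], where it is
    the slope of the tangent. *)
Lemma translation_lift : exists phi : {rmorphism F -> F},
  [/\ forall c, phi (C c) = C c, phi x = shift_x, phi y = shift_y &
  forall R f, regular (add_point Q R) f <-> regular R (phi f)].
Proof.
have [phi [pC px py]] := coordinate_lift F shift_x_not_const shift_on_curve.
exists phi; split=> // R; apply: dominate_reg => //.
have [->|nR] := eqVneq R (neg_point Q).
  rewrite (add_negr F Q); have [t0 u0 ot ou] := ord_translation_pole.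
  apply: dominate_hv => //=; apply: hv_ord_gt0.
  - by rewrite fmorph_eq0 mulf_neq0 ?invr_eq0 ?cx_neq0 ?cy_neq0.
  - by rewrite fmorph_div px py ord_div // ot ou.
  - by rewrite fmorph_eq0 invr_eq0 cy_neq0.
  by rewrite fmorphV py ordV // ou.
case: R nR => [[[u v]|] ocR] nR; last first.
  have -> : Point ocR = O by exact: val_inj.
  rewrite addrO; have [h1 h2] := hv_translation_origin.
  by apply: dominate_hv => //=; rewrite ?px ?py.
have [h1 h2] := hv_translation_affine nR.
have no : (x0 == u) && (v == - y0 - a1 E * x0 - a3 E) = false.
  apply/negP => /andP[/eqP eu /eqP ev]; case/eqP: nR.
  by apply: val_inj; rewrite /= -eu ev.
apply: dominate_hv => //; rewrite /cchart /chart_value /= no /= ?px ?py //.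
Qed.

End Formulas.

(** The chord from [-Q] to [Q + R] is the reflection of the chord from [Q] to
    [R], so the slopes are opposite up to [a1] and [(-Q) + (Q + R) = R]. *)
Lemma translation_neg (x0 y0 : k) (phi : {rmorphism F -> F}) :
  (forall c, shift_x x0 y0 != C c) ->
  (forall c, phi (C c) = C c) -> phi x = shift_x x0 y0 ->
    phi y = shift_y x0 y0 ->
  phi (shift_x x0 (- y0 - a1 E * x0 - a3 E))
    = x /\ phi (shift_y x0 (- y0 - a1 E * x0 - a3 E)) = y.
Proof.
move=> tc pC px py; have D0 := cx_cst_neq0 F x0.
have T0 : shift_x x0 y0 - C x0 != 0 by rewrite subr_eq0.
have el : phi (shift_slope x0 (- y0 - a1 E * x0 - a3 E))
  = - shift_slope x0 y0 - C (a1 E).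
  rewrite /shift_slope fmorph_div !rmorphB rmorphN px py !pC -/(shift_slope
    x0 y0) {1}/shift_y.
  by rewrite !(rmorphB, rmorphN, rmorphM) !pC; field.
have ex : phi (shift_x x0 (- y0 - a1 E * x0 - a3 E)) = x.
  rewrite {1}/shift_x; move: (shift_slope x0 (- y0 - a1 E * x0 - a3 E)) el =>
    t el.
  by rewrite !rmorphB rmorphD rmorphXn rmorphM el !pC px /shift_x; ring.
split=> //; rewrite /shift_y;
  move: (shift_x x0 (- y0 - _ - _)) (shift_slope x0 (- y0 - _ - _)) ex el =>
  X t ex el.
rewrite !(rmorphB, rmorphN, rmorphD, rmorphM) ex el !pC /shift_slope; field.
exact: D0.
Qed.

Lemma translation_exists (Q : point E) : neg_point Q != Q ->
  exists phi : {rmorphism F -> F}, (forall c, phi (C c) = C c) /\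
   forall R f, f != 0 -> ord R (phi f) = ord (add_point Q R) f.
Proof.
case: Q => [[[x0 y0]|] oc] nQ; last first.
  by case/eqP: nQ; apply: val_inj.
have dy0 : dy E x0 y0 != 0.
  rewrite dy_neg; apply: contra nQ => /eqP e; apply/eqP; apply: val_inj.
  by rewrite /= e.
have oc' : on_curve E (Some (x0, - y0 - a1 E * x0 - a3 E)) := neg_on_curve oc.
have dy0' : dy E x0 (- y0 - a1 E * x0 - a3 E) != 0.
  have -> : dy E x0 (- y0 - a1 E * x0 - a3 E) = - dy E x0 y0 by rewrite /dy;
    ring.
  by rewrite oppr_eq0.
have [phi [pC px py pR]] := translation_lift oc dy0.
have [psi [qC qx qy _]] := translation_lift oc' dy0'.
have [ex ey] := translation_neg (shift_x_not_const oc dy0) pC px py.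
have K : cancel psi phi.
  move=> f; apply: (cf_rmorph_eq (phi := phi \o psi) (psi := idfun)) => /= [p|].
    rewrite !polyf_horner; elim/poly_ind: p => [|p c IH];
      first by rewrite !rmorph0 !hornerC !rmorph0.
    rewrite !rmorphD !rmorphM /= !map_polyX !map_polyC !hornerE.
    by rewrite !rmorphD !rmorphM /= IH qC pC qx ex.
  by rewrite qy ey.
exists phi; split=> // R f f0.
by apply: (ord_transfer (R' := add_point (Point oc) R)) => // g; exists (psi g).
Qed.

End Translation.

(** * The symmetric function in characteristic 2 *)
Lemma mulrn_int (i : int) n : i *+ n = n%:Z * i.
Proof. by rewrite -mulr_natl natz. Qed.

Section Characteristic2.
Context {k : closedFieldType} {E : elliptic_curve k} (F : coord_field E).
Hypothesis two0 : 2%:R = 0 :> k.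
Implicit Types (R A B S Q : point E) (f g : F) (c d : k).
Local Notation C := (cst F).
Local Notation x := (cx F).
Local Notation y := (cy F).
Local Notation P := (polyf F).
Local Notation O := (origin E).

Lemma dbl_k (c : k) : c + c = 0.
Proof. by rewrite -mulr2n -mulr_natl two0 mul0r. Qed.

Lemma dbl_F f : f + f = 0.
Proof.
by rewrite -mulr2n -mulr_natl -(rmorph_nat C) two0 rmorph0 mul0r.
Qed.

Lemma dyE (u v : k) : dy E u v = a1 E * u + a3 E.
Proof. by rewrite /dy two0 mul0r add0r. Qed.

Lemma lin_horner (u : k) : (lin E).[u] = a1 E * u + a3 E.
Proof. by rewrite /lin !hornerE. Qed.

Lemma a1_a3_neq0 : a1 E = 0 -> a3 E != 0.
Proof.
move=> a10; apply/eqP => a30.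
have /eqP[] := discriminant_neq0 E.
rewrite /discriminant /b2 /b4 /b6 /b8 a10 a30.
rewrite (_ : 4%:R = 2%:R * 2%:R :> k); last by ring.
rewrite (_ : 8%:R = 2%:R * 4%:R :> k); last by ring.
by rewrite two0; ring.
Qed.

Lemma lin_neq0 : lin E != 0.
Proof.
apply/eqP => e; have := a1_a3_neq0; have := lin_horner 0; have := lin_horner 1.
rewrite e !horner0 mulr0 mulr1 add0r => e1 e3 h.
by move: e1; rewrite -e3 addr0 => /esym/h; rewrite -e3 eqxx.
Qed.

(** Functions of [x] have even order at infinity, so an odd order comes from the
    term with [y]. *)
Lemma ord_infinity_odd (U V : {poly k}) (m : int) : P U + P V * y != 0 ->
  ord O (P U + P V * y) = 2 * m + 1 -> V != 0 /\ ord O (P V) = 2 * m + 4.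
Proof.
have [->|V0] := eqVneq V 0.
  rewrite rmorph0 mul0r addr0 polyf_eq0 => U0; rewrite ord_infinity_poly //;
    lia.
move=> _ e; split=> //.
have y0 := cy_neq0 F; have PV0 : P V != 0 by rewrite polyf_eq0.
have PVy0 : P V * y != 0 by rewrite mulf_neq0.
have [ox oy] := ord_infinity_x F.
have oV : ord O (P V * y) = ord O (P V) - 3 by rewrite ordM // oy.
have eV := ord_infinity_poly F V0.
have [U0|U0] := eqVneq U 0.
  by move: e; rewrite U0 rmorph0 add0r oV; lia.
have PU0 : P U != 0 by rewrite polyf_eq0.
have eU := ord_infinity_poly F U0.
have : ord O (P U) < ord O (P V * y) \/ ord O (P V * y) < ord O (P U).
  by rewrite oV eU eV; lia.
case=> lt.
  have [] := @ordD _ _ _ O (P U) (P V * y) PU0 _;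
    first by rewrite vge_ord // lezD1.
  by rewrite e eU; lia.
have [] := @ordD _ _ _ O (P V * y) (P U) PVy0 _;
  first by rewrite vge_ord // lezD1.
by rewrite addrC e oV; lia.
Qed.

Section OddTorsion.
Context (m : nat) (x0 y0 : k) (oc : on_curve E (Some (x0, y0))).
Local Notation Q := (Point oc).
Local Notation n := (m.*2.+1).
Hypothesis nQ : mul_point n Q = O.

Lemma torsion_function_exists : exists G : F, G != 0 /\
  forall R, ord R G = n%:Z * pt Q R - n%:Z * pt O R.
Proof. by have [G G0 h] := torsion_principal F nQ; exists G. Qed.

Definition torsion_fun : F := sval (cid torsion_function_exists).
Definition torsion_fun_conj : F := conj F torsion_fun.

Lemma torsion_fun_neq0 : torsion_fun != 0. Proof. by rewrite /torsion_fun;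
  case: cid => G []. Qed.
Lemma ord_torsion_fun R : ord R torsion_fun = n%:Z * pt Q R - n%:Z * pt O R.
Proof. by rewrite /torsion_fun; case: cid => G []. Qed.

Lemma torsion_fun_conj_neq0 :
  torsion_fun_conj != 0. Proof. by rewrite fmorph_eq0 torsion_fun_neq0. Qed.

Lemma pt_negE A R : pt (neg_point A) R = pt A (neg_point R).
Proof. by rewrite /pt -[R in LHS]neg_pointK (inj_eq (inv_inj (@neg_pointK _
  E))). Qed.

Lemma ord_torsion_fun_conj R :
  ord R torsion_fun_conj = n%:Z * pt (neg_point Q) R - n%:Z * pt O R.
Proof.
rewrite /torsion_fun_conj ord_conj ?torsion_fun_neq0 // ord_torsion_fun
  -pt_negE; congr (_ - _ * _).
by rewrite -pt_negE neg_origin.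
Qed.

(** The function of a Lame curve, made symmetric by a translation: negation
    exchanges it with its inverse. *)
Definition lame_fun : F := torsion_fun / torsion_fun_conj.

Lemma lame_fun_neq0 : lame_fun != 0. Proof. by rewrite mulf_neq0 ?invr_eq0
  ?torsion_fun_neq0 ?torsion_fun_conj_neq0. Qed.

Lemma ord_lame_fun R :
  ord R lame_fun = n%:Z * pt Q R - n%:Z * pt (neg_point Q) R.
Proof. by rewrite ord_div ?torsion_fun_neq0 ?torsion_fun_conj_neq0 //
  ord_torsion_fun ord_torsion_fun_conj; ring. Qed.

(** [G = U + V y] and [conj G = U + V (- y - a1 x - a3)] differ by
    [V (2 y + a1 x + a3)], where 2 = 0. *)
Lemma lame_fun_sub1 : exists2 V, V != 0 &
  [/\ lame_fun - 1 = P V * P (lin E) / torsion_fun_conj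
  & ord O (P V) = 3 - n%:Z].
Proof.
have [U [V eG]] : exists U V, torsion_fun = P U + P V * y.
  apply: affine_regularP => R RO; apply: hv_ord_ge0;
    first exact: torsion_fun_neq0.
  by rewrite ord_torsion_fun (pt_neq RO); have := pt_ge0 Q R; lia.
have G0 := torsion_fun_neq0; have oG := ord_torsion_fun O.
rewrite eG pt_same pt_neq // in G0 oG.
have [|V0 oV] := @ord_infinity_odd U V (- m%:Z - 1) G0; first by rewrite oG;
  lia.
exists V => //; split; last by rewrite oV; lia.
apply: (mulIf torsion_fun_conj_neq0);
  rewrite divfK ?torsion_fun_conj_neq0 // mulrBl divfK ?torsion_fun_conj_neq0
  // mul1r.
rewrite /torsion_fun_conj eG rmorphD rmorphM !conj_poly conj_y.
transitivity (P V * P (lin E) + (P V * y + P V * y)); first by ring.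
by rewrite dbl_F addr0.
Qed.

Lemma lame_fun_origin :
  lame_fun - 1 != 0 /\ ord O (lame_fun - 1) = 3 + ord O (P (lin E)).
Proof.
have l0 := lin_neq0.
have [V V0 [-> oV]] := lame_fun_sub1.
have n0 : P V * P (lin E) != 0 by rewrite mulf_neq0 ?polyf_eq0.
rewrite mulf_neq0 ?invr_eq0 ?torsion_fun_conj_neq0 // ord_div
  ?torsion_fun_conj_neq0 // ordM ?polyf_eq0 //.
split=> //; rewrite oV ord_torsion_fun_conj pt_same pt_neq //; ring.
Qed.


(** [G * conj G] is constant times [(x - x0)^n] by comparison of divisors, and
    [G / conj G = G^2 / (G * conj G)]; as [n] is odd one factor [x - x0]
    remains. *)
Lemma lame_fun_square : exists c (B :
  F), [/\ c != 0, B != 0, lame_fun = C c * (x - C x0) * B ^+ 2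
  & forall R, R != Q -> R != neg_point Q -> R != O -> ord R B = 0].
Proof.
have x00 := cx_cst_neq0 F x0; have G0 := torsion_fun_neq0;
  have H0 := torsion_fun_conj_neq0.
pose X := x - C x0; have X0 : X != 0 by [].
have XX j : X ^+ j != 0 by rewrite expf_neq0.
have GH0 : torsion_fun * torsion_fun_conj / X ^+ n != 0 by rewrite mulf_neq0
  ?invr_eq0 // mulf_neq0.
have oX R : ord R X = pt Q R + pt (neg_point Q) R - 2 * pt O R :=
  ord_vertical F oc R.
have o0 R : ord R (torsion_fun * torsion_fun_conj / X ^+ n) = 0.
  rewrite ord_div ?mulf_neq0 // ordM // ordX // oX ord_torsion_fun
    ord_torsion_fun_conj mulrn_int; lia.
have [||c e] := @vge_infinity_const _ _ F (torsion_fun * torsion_fun_conj / X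
  ^+ n).
- by move=> R _; apply: hv_ord_ge0; rewrite ?o0.
- by rewrite vge_ord // o0.
have c0 : c != 0 by apply: contraNneq GH0 => c0; rewrite e c0 rmorph0.
have Cc0 : C c != 0 by rewrite cst_eq0.
exists c^-1, (torsion_fun / X ^+ m.+1); split.
- by rewrite invr_eq0.
- by rewrite mulf_neq0 ?invr_eq0.
- have -> : lame_fun = torsion_fun ^+ 2 / (C c * X ^+ n).
    by rewrite -e divfK // /lame_fun; field; rewrite G0 H0.
  have eX : X ^+ n = X * (X ^+ m * X ^+ m) by rewrite -exprD addnn -exprS.
  rewrite fmorphV -/X eX [X ^+ m.+1]exprS.
  by field; rewrite Cc0 XX X0.
move=> R RQ RQ' RO; rewrite ord_div // ord_torsion_fun ordX // oX !pt_neq //.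
by rewrite !mulr0 !subr0 mul0rn.
Qed.

(** Replacing [B] by its value [b] changes the function by a multiple of
    [B^2 - b^2 = (B - b)^2], of order at least 2, so the order is that of
    [x - u]. *)
Lemma lame_fun_unramified (u v : k) (ocR : on_curve E (Some (u, v))) :
  Point ocR != Q -> Point ocR != neg_point Q -> dy E u v != 0 ->
  exists c, lame_fun - C c != 0 /\ ord (Point ocR) (lame_fun - C c) = 1.
Proof.
move=> RQ RQ' dyR; set R := Point ocR in RQ RQ' *.
have [c [B [c0 B0 -> oB]]] := lame_fun_square.
have [b b0 hb] := ord0_hv B0 (oB R RQ RQ' isT).
exists (c * (u - x0) * b ^+ 2).
have xu0 : x - C u != 0 := cx_cst_neq0 F u.
have Cc0 : C c != 0 by rewrite cst_eq0.
have -> : C c * (x - C x0) * B ^+ 2 - C (c * (u - x0) * b ^+ 2)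
   = C c * (x - C u) * B ^+ 2 + C c * C (u - x0) * (B - C b) ^+ 2.
  transitivity (C c * (x - C u) * B ^+ 2 + C c * C (u - x0) * (B - C b) ^+ 2
     + C c * C (u - x0) * C b * (B - C b + (B - C b))).
    by rewrite !(rmorphXn, rmorphB, rmorphM) -/C; ring.
  by rewrite dbl_F mulr0 addr0.
have f0 : C c * (x - C u) * B ^+ 2 != 0 by rewrite !mulf_neq0 ?expf_neq0.
have of1 : ord R (C c * (x - C u) * B ^+ 2) = 1.
  rewrite ordM ?mulf_neq0 ?expf_neq0 // ordX // (ord_hv b0 hb) mul0rn addr0.
  by rewrite ordM // ord_cst // add0r; exact: ord_XsubC_unram.
rewrite -of1; apply: ordD => //; rewrite of1 -[1 + 1]add0r; apply: vgeM.
  by rewrite -rmorphM; exact: vge_cst.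
have := @vgeX _ _ F R 1 (B - C b) 2; apply.
by apply/vge_hv.
Qed.

(** At a point of order 2 the numerator [V * (a1 x + a3)] of [lame_fun_sub1] is a
    function of [x], hence of even order. *)
Lemma lame_fun_two_torsion (u v : k) (ocR : on_curve E (Some (u, v))) :
  Point ocR != neg_point Q -> dy E u v = 0 ->
  exists j : nat, [/\ (0 < j)%N, lame_fun - 1 != 0 &
    ord (Point ocR) (lame_fun - 1) = 2 *+ j].
Proof.
move=> RQ' dyR; set R := Point ocR in RQ' *.
have [V V0 [-> _]] := lame_fun_sub1; have l0 := lin_neq0;
  have H0 := torsion_fun_conj_neq0.
have PV0 : P V != 0 by rewrite polyf_eq0.
have Pl0 : P (lin E) != 0 by rewrite polyf_eq0.
have [i [ei _]] := ord_polyf F ocR V0.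
have [j [ej hj]] := ord_polyf F ocR l0.
exists (i + j)%N; split.
- by rewrite addn_gt0 hj ?orbT // lin_horner -(dyE u v).
- by rewrite mulf_neq0 ?invr_eq0 // mulf_neq0.
rewrite ord_div ?mulf_neq0 // ordM // -/R in ei ej *.
by rewrite ei ej (ord_XsubC_ram F ocR dyR) ord_torsion_fun_conj !pt_neq //
  mulr0 !subr0 -mulrnDr.
Qed.

End OddTorsion.
End Characteristic2.

(** * Lame curves and the coefficient a1 *)
Section LameFor.
Context {k : closedFieldType} {E : elliptic_curve k} (F : coord_field E).
Implicit Types (P R A B S Q : point E) (f g : F) (c d : k).
Local Notation C := (cst F).
Local Notation O := (origin E).

Definition ramification_for f R (e : nat) : Prop := (0 < e)%N /\
  ((exists c, has_order_for R (f - C c) e%:Z) \/ has_order_for R f^-1 e%:Z).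

Definition lame_for P n : Prop :=
  [/\ (1 < n)%N, has_exact_order P n, [pchar k]^'.-nat n &
   exists f : F,
   [/\ forall R, has_order_for R f ((R == P)%:Z *+ n - (R == O)%:Z *+ n),
       forall R e, ramification_for f R e -> [pchar k]^'.-nat e,
       ramification_for f O n,
       ramification_for f P n &
       exists Q, [/\ Q != O, Q != P, ramification_for f Q 3 &
         forall R, R != O -> R != P -> R != Q -> ramification_for f R 1]]].

Lemma ramification_zero f R c e : (0 < e)%N -> f - C c != 0 ->
  ord R (f - C c) = e%:Z ->
  ramification_for f R e.
Proof. by move=> e0 f0 h; split=> //; left; exists c; apply/has_order_forP. Qed.

Lemma ramification_pole f R e : (0 < e)%N -> f != 0 -> ord R f = - e%:Z ->
  ramification_for f R e.
Proof.
move=> e0 f0 h; split=> //; right; apply/has_order_forP.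
by rewrite invr_eq0 ordV // h opprK.
Qed.

Lemma ord_sub_uniq f R c d : f - C c != 0 -> f - C d != 0 ->
  0 < ord R (f - C c) -> 0 < ord R (f - C d) -> c = d.
Proof.
move=> hc hd oc od; apply: (@hv_unique _ _ F R f).
  by apply/vge_hv/vge_hv0; exact: hv_ord_gt0.
by apply/vge_hv/vge_hv0; exact: hv_ord_gt0.
Qed.

Lemma ramificationP f R e : ramification_for f R e <-> (0 < e)%N /\
  ((exists c, f - C c != 0 /\ ord R (f - C c) = e%:Z) \/ (f != 0 /\ ord R f
    = - e%:Z)).
Proof.
split=> [[e0 H]|[e0 H]]; split=> //; case: H => [[c]|].
- by move=> /has_order_forP H; left; exists c.
- move=> /has_order_forP; rewrite invr_eq0 => -[f0 H]; right; split=> //.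
  by rewrite -H ordV // opprK.
- by move=> H; left; exists c; apply/has_order_forP.
by move=> [f0 H]; right; apply/has_order_forP; rewrite invr_eq0 ordV // H opprK.
Qed.

Lemma value_not_pole f R c : f != 0 -> f - C c != 0 ->
  0 <= ord R (f - C c) -> 0 <= ord R f.
Proof.
move=> f0 fc0 h; rewrite -vge_ord // -[f](subrK (C c)); apply: vgeD;
  last exact: vge_cst.
by rewrite vge_ord.
Qed.

Lemma ramification_uniq f R e e' : ramification_for f R e ->
  ramification_for f R e' -> e = e'.
Proof.
move=> /ramificationP [e0 H] /ramificationP [e0' H'].
case: H => [[c [fc oc]]|[f0 o]]; case: H' => [[d [fd od]]|[f0' o']].
- have cd : c = d by apply: (@ord_sub_uniq f R) => //; rewrite ?oc ?od; lia.
  by move: od; rewrite -cd oc => -[].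
- by have := value_not_pole f0' fc (R := R); rewrite oc o'; lia.
- by have := value_not_pole f0 fd (R := R); rewrite od o; lia.
by move: o'; rewrite o; lia.
Qed.

Hypothesis char2 : 2%N \in [pchar k].

Lemma pnat_odd n : (0 < n)%N -> [pchar k]^'.-nat n = odd n.
Proof.
move=> n0; rewrite (eq_pnat _ (eq_negn (pcharf_eq char2))) p'natE //.
by rewrite dvdn2 negbK.
Qed.

Let two0 : 2%:R = 0 :> k. Proof. exact: pcharf0. Qed.

Section HalfPoint.
Context (P : point E) (m : nat).
Local Notation n := (m.*2.+1).
Hypotheses (nP : mul_point n P = O) (P0 : P != O).

(** As [n = 2m + 1] kills [P], twice this point is [P]. *)
Definition half_point := mul_point m.+1 P.
Local Notation Q := half_point.

Lemma half_point_double : add_point Q Q = P.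
Proof.
rewrite /Q -(mul_pointD F) addSn addnS addnn (mul_pointS m.*2.+1) nP.
exact: addrO.
Qed.

Lemma half_point_torsion : mul_point n Q = O.
Proof. by rewrite /Q -(mul_pointM F) mulnC (mul_pointM F) nP
  mul_point_origin. Qed.

Lemma half_point_neq0 : Q != O.
Proof. by apply: contra_neq P0 => e; rewrite -half_point_double e addO. Qed.

Lemma half_point_neg : neg_point Q != Q.
Proof.
apply: contra_neq P0 => e; rewrite -half_point_double -{1}e.
exact: add_negl F Q.
Qed.

End HalfPoint.

Lemma add_neg_eq A R S :
  (add_point (neg_point A) R == S) = (R == add_point A S).
Proof.
apply/eqP/eqP => [<-|->]; last exact: add_pointK F A S.
by rewrite -{1}[A]neg_pointK (add_pointK F).
Qed.

Lemma two_torsion_free R : a1 E = 0 -> neg_point R = R -> R = O.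
Proof.
move=> a10; case: R => [[[u v]|] oc]; last by move=> _; exact: val_inj.
move=> /(congr1 (@coords _ E)) [] /eqP; rewrite -dy_neg dyE // a10 mul0r add0r.
by rewrite (negPf (a1_a3_neq0 two0 a10)).
Qed.

Lemma exact_order_odd P n : a1 E = 0 -> has_exact_order P n -> odd n.
Proof.
move=> a10 [n0 nP min]; apply/negPn/negP => en.
have e : n = (n./2).*2 by rewrite -[LHS]odd_double_half (negPf en).
have j0 : (0 < n./2 < n)%N by lia.
apply: (min _ j0); apply: two_torsion_free => //.
apply: (add_point_inj F (A := mul_point n./2 P)).
by rewrite (add_negr F) -(mul_pointD F) addnn -e.
Qed.

(** Translate [lame_fun] by [-Q], where [Q + Q = P]: the zero [Q] moves to [P],
    the pole [-Q] to the origin, and the origin to the third point [Q]. *)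
Lemma lame_for_a1_eq0 P n : a1 E = 0 -> P != O -> has_exact_order P n ->
  lame_for P n.
Proof.
move=> a10 P0 oP; have nodd := exact_order_odd a10 oP; have [n0 nP min] := oP.
have n1 : (1 < n)%N.
  case: n n0 nP {min oP nodd} => [|[|n]] // _; rewrite mul_pointS => /eqP.
  by rewrite addrO (negPf P0).
have en : n = (n./2).*2.+1 by rewrite -[LHS]odd_double_half nodd.
move: nP; rewrite [in mul_point n P]en; set m := n./2 => nP.
pose Q := half_point P m.
have QQ : add_point Q Q = P := half_point_double nP.
have nQ : mul_point m.*2.+1 Q = O := half_point_torsion nP.
have Q0 : Q != O := half_point_neq0 nP P0.
have NQ : neg_point Q != Q := half_point_neg nP P0.
clearbody Q.
have [phi [pC pord]] : exists phi : {rmorphism F ->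
  F}, (forall c, phi (C c) = C c) /\
   forall R f, f != 0 -> ord R (phi f) = ord (add_point (neg_point Q) R) f.
  by apply: translation_exists; rewrite neg_pointK eq_sym.
have tQ R : (add_point (neg_point Q) R == Q)
  = (R == P) by rewrite add_neg_eq QQ.
have tO R : (add_point (neg_point Q) R == O)
  = (R == Q) by rewrite add_neg_eq addrO.
have tN R : (add_point (neg_point Q) R == neg_point Q) = (R == O).
  by rewrite add_neg_eq (add_negr F).
case: Q Q0 nQ QQ NQ pord tQ tO tN =>
  [[[x0 y0]|] oc] // _ nQ QQ NQ pord tQ tO tN.
set Q := Point oc in nQ QQ NQ pord tQ tO tN *.
pose f := lame_fun F nQ; have f0 : f != 0 := lame_fun_neq0 F nQ.
have sub c : phi f - C c = phi (f - C c) by rewrite rmorphB pC.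
have zero R c e : (0 < e)%N -> f - C c != 0 ->
  ord (add_point (neg_point Q) R) (f - C c) = e%:Z ->
    ramification_for (phi f) R e.
  move=> e0 fc o; apply: (@ramification_zero _ R c) => //.
    by rewrite sub fmorph_eq0.
  by rewrite sub pord.
have of_ R : ord R (phi f) = n%:Z * pt P R - n%:Z * pt O R.
  by rewrite pord // ord_lame_fun /pt tQ tN -en.
have rO : ramification_for (phi f) O n.
  apply: ramification_pole => //; first by rewrite fmorph_eq0.
  by rewrite of_ pt_same pt_neq 1?eq_sym //; ring.
have rP : ramification_for (phi f) P n.
  apply: (@ramification_zero _ P 0) => //; rewrite rmorph0 subr0 ?fmorph_eq0 //.
  by rewrite of_ pt_same pt_neq //; ring.
have rQ : ramification_for (phi f) Q 3.
  have [g0 og] := lame_fun_origin F two0 nQ.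
  apply: (@zero Q 1) => //; rewrite rmorph1 // (add_negl F) og.
  have l0 : lin E = (a3 E)%:P by rewrite /lin a10 scale0r add0r.
  by rewrite l0 -[polyf F _]/(C (a3 E)) ord_cst // a1_a3_neq0.
have r1 R : R != O -> R != P -> R != Q -> ramification_for (phi f) R 1.
  rewrite -(tN R) -(tQ R) -(tO R) => h1 h2 h3.
  suff [c [g0 og]] : exists c,
    f - C c != 0 /\ ord (add_point (neg_point Q) R) (f - C c) = 1.
    exact: (@zero R c).
  move: h1 h2 h3; case: (add_point (neg_point Q) R) =>
    [[[u v]|] ocR] // h1 h2 h3.
  apply: (lame_fun_unramified F two0 nQ h2 h1).
  by rewrite dyE // a10 mul0r add0r a1_a3_neq0.
have QO : Q != O by [].
have QP : Q != P.
  by apply/eqP => e; have /(add_point_inj F) : add_point Q Q = add_point Q O;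
    rewrite ?QQ ?addrO.
split=> //; first by rewrite pnat_odd.
exists (phi f); split=> //.
- move=> R; apply/has_order_forP; rewrite fmorph_eq0; split=> //.
  by rewrite of_ /pt !mulrn_int.
- have odd_nat e : odd e -> [pchar k]^'.-nat e.
    by move=> oe; rewrite pnat_odd //; case: e oe.
  move=> R e re; apply: odd_nat.
  have [RO|RO] := eqVneq R O;
    first by rewrite (ramification_uniq re (eq_ind_r (fun R =>
    ramification_for _ R n) rO RO)).
  have [RP|RP] := eqVneq R P;
    first by rewrite (ramification_uniq re (eq_ind_r (fun R =>
    ramification_for _ R n) rP RP)).
  have [RQ|RQ] := eqVneq R Q;
    first by rewrite (ramification_uniq re (eq_ind_r (fun R =>
    ramification_for _ R 3) rQ RQ)).
  by rewrite (ramification_uniq re (r1 R RO RP RQ)).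
by exists Q.
Qed.

(** Translating by [Q] the function of a Lame curve gives a multiple of
    [lame_fun].  If [a1 <> 0] its indices away from [Q] and [-Q] are 1 or even,
    so the third ramification point cannot exist. *)
Lemma a1_eq0_of_lame_for P n : lame_for P n -> a1 E = 0.
Proof.
move=> [n1 oP pn [f [divf _ _ _ [S [SO SP rS _]]]]].
have [n0 nP min] := oP; apply/eqP/negPn/negP => a10.
have nodd : odd n by rewrite -pnat_odd.
have P0 : P != O.
  by apply/eqP => e; apply: (min 1%N); rewrite ?n1 // mul_pointS addrO.
have en : n = (n./2).*2.+1 by rewrite -[LHS]odd_double_half nodd.
move: nP; rewrite [in mul_point n P]en; set m := n./2 => nP.
pose Q := half_point P m.
have QQ : add_point Q Q = P := half_point_double nP.
have nQ : mul_point m.*2.+1 Q = O := half_point_torsion nP.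
have Q0 : Q != O := half_point_neq0 nP P0.
have NQ : neg_point Q != Q := half_point_neg nP P0.
clearbody Q; have [phi [pC pord]] := translation_exists F NQ.
have fO R : f != 0 /\ ord R f = n%:Z * pt P R - n%:Z * pt O R.
  by have /has_order_forP [f0 ->] := divf R; rewrite /pt !mulrn_int.
have f0 : f != 0 := (fO O).1.
have inj := add_point_inj F (A := Q).
have tP R : (add_point Q R == P) = (R == Q) by rewrite -QQ (inj_eq inj).
have tO R : (add_point Q R == O)
  = (R == neg_point Q) by rewrite -(add_negr F Q) (inj_eq inj).
pose T := add_point (neg_point Q) S.
have ST : add_point Q T = S by rewrite -[Q]neg_pointK (add_pointK F).
have TQ : T != Q by rewrite -tP ST.
have TN : T != neg_point Q by rewrite -tO ST.
clearbody T; rewrite -ST in SO SP rS; clear S ST.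
case: Q Q0 nQ QQ NQ pord inj tP tO TQ TN SO SP rS =>
  [[[x0 y0]|] oc] // _ nQ QQ NQ pord inj tP tO TQ TN SO SP rS.
set Q := Point oc in nQ QQ NQ pord inj tP tO TQ TN SO SP rS *.
pose g := lame_fun F nQ; have g0 : g != 0 := lame_fun_neq0 F nQ.
have pf0 : phi f != 0 by rewrite fmorph_eq0.
have o0 R : ord R (phi f / g) = 0.
  by rewrite ord_div // pord // (fO _).2 ord_lame_fun /pt tP tO -en; ring.
have [||c e] := @vge_infinity_const _ _ F (phi f / g).
- by move=> R _; apply: hv_ord_ge0; rewrite ?o0 // mulf_neq0 ?invr_eq0.
- by rewrite vge_ord ?o0 // mulf_neq0 ?invr_eq0.
have {}e : phi f = C c * g by rewrite -e divfK.
have c0 : c != 0 by apply: contraNneq pf0 => c0; rewrite e c0 rmorph0 mul0r.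
have [d [gd od]] : exists d, g - C d != 0 /\ ord T (g - C d) = 3.
  move/ramificationP: rS => [_ [[d [fd od]]|[_ o]]]; last first.
    by move: o; rewrite (fO _).2 /pt (negPf SO) (negPf SP) mulr0 subrr.
  have eg : phi (f - C d) = C c * (g - C (d / c)).
    have Cc0 : C c != 0 by rewrite cst_eq0.
    by rewrite rmorphB pC e fmorph_div; field.
  have fd' : phi (f - C d) != 0 by rewrite fmorph_eq0.
  exists (d / c); have gd : g - C (d / c) != 0.
    by apply: contraNneq fd' => z; rewrite eg z mulr0.
  by split=> //; move: od;
    rewrite -pord // eg ordM ?cst_eq0 // ord_cst // add0r.
have other c' (i : int) : g - C c' != 0 -> ord T (g - C c') = i -> 0 < i ->
  i = 3.
  move=> gc oi i0; have cd : c' = d by apply: (@ord_sub_uniq g T) => //;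
    rewrite ?od ?oi.
  by rewrite -oi cd.
case: T TQ TN {rS SO SP} od other => [[[u v]|] ocT] TQ TN od other; last first.
  have eO : Point ocT = O by exact: val_inj.
  have [h0 oh] := lame_fun_origin F two0 nQ.
  have ol : ord O (polyf F (lin E)) = -2.
    rewrite ord_infinity_poly ?lin_neq0 //.
    have -> // : size (lin E) = 2%N.
    by rewrite /lin -mul_polyC size_MXaddC polyC_eq0 (negPf a10) /=
      size_polyC a10.
  have := other 1 1; rewrite rmorph1 eO oh ol => W.
  by have := W h0 (erefl _) isT.
have [dy0|dy0] := eqVneq (dy E u v) 0.
  have [j [j0 h0 oh]] := lame_fun_two_torsion F two0 nQ TN dy0.
  have := other 1 (2 *+ j); rewrite rmorph1 => W.
  have p0 : 0 < j%:Z * 2 by move: j0; clear; lia.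
  by have := W h0 oh; rewrite mulrn_int => /(_ p0); clear; lia.
have [c' [h0 oh]] := lame_fun_unramified F two0 nQ TQ TN dy0.
by have := other c' 1 h0 oh isT.
Qed.

End LameFor.

(** * Torsion *)
Lemma pigeonhole (T : eqType) (f : nat ->
  T) (s : seq T) : (forall i, f i \in s) ->
  exists i j, (i < j)%N /\ f i = f j.
Proof.
move=> fs; have : ~~ uniq (mkseq f (size s).+1).
  apply/negP => u; have := uniq_leq_size (s2 := s) u _.
  rewrite size_mkseq ltnn => W; have : false by apply: W => _ /mapP[i _ ->].
  by [].
case/(uniqPn (f 0%N)) => i [j [lt]]; rewrite size_mkseq => js.
by rewrite !nth_mkseq ?(ltn_trans lt) // => e; exists i, j.
Qed.

Lemma roots_seq (k : closedFieldType) (p : {poly k}) : p != 0 ->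
  exists r : seq k, forall z, root p z -> z \in r.
Proof.
move=> p0; have [r er] := closed_field_poly_normal p; exists r => z.
by rewrite er rootZ ?lead_coef_eq0 // root_prod_XsubC.
Qed.

Section Frobenius.
Context (k : closedFieldType) (iota : {rmorphism 'F_2 -> k}).
Hypothesis k_alg : forall z : k, algebraicOver iota z.

Lemma pchar_F2 : 2%N \in [pchar k].
Proof. by rewrite (fmorph_pchar iota) pchar_Fp. Qed.

Lemma pchar_nat_exp2 (N : nat) : [pchar k].-nat (2 ^ N)%N.
Proof. by rewrite (eq_pnat _ (pcharf_eq pchar_F2)) pnatX pnat_id. Qed.

Definition frob_fixed (N : nat) (z : k) := z ^+ (2 ^ N)%N == z.

Lemma expF2 (b : 'F_2) : b ^+ 2 = b.
Proof. by have := expf_card b; rewrite card_Fp. Qed.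

Lemma horner_frob (p : {poly 'F_2}) (z : k) :
  (map_poly iota p).[z ^+ 2] = (map_poly iota p).[z] ^+ 2.
Proof.
elim/poly_ind: p => [|p c IH]; first by rewrite rmorph0 !hornerC expr0n.
have p2 : [pchar k].-nat 2%N := pchar_nat_exp2 1.
rewrite rmorphD rmorphM /= map_polyX map_polyC !(hornerD, hornerM, hornerX,
  hornerC) IH.
by rewrite exprDn_pchar // exprMn -rmorphXn expF2.
Qed.

Lemma frob_inj N : injective (fun z : k => z ^+ (2 ^ N)%N).
Proof.
move=> z w /= e; apply/subr0_eq/eqP.
have := exprDn_pchar z (- w) (pchar_nat_exp2 N).
have -> : (- w) ^+ (2 ^ N)%N = - (w ^+ (2 ^ N)%N).
  have := exprDn_pchar w (- w) (pchar_nat_exp2 N).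
  rewrite subrr expr0n expn_eq0 /= => /esym/eqP.
  by rewrite addrC addr_eq0 => /eqP.
by rewrite e subrr => /eqP; rewrite expf_eq0 => /andP[].
Qed.

(** The iterates of [z] under the Frobenius are roots of one polynomial over the
    prime field, so two of them coincide, and the Frobenius is injective. *)
Lemma frob_fixed_exists z : exists2 d, (0 < d)%N & frob_fixed d z.
Proof.
have [p p0 rz] := k_alg z;
  have q0 : map_poly iota p != 0 by rewrite map_poly_eq0.
have [r rr] := roots_seq q0.
have [|i [j [lt e]]] := @pigeonhole _ (fun i => z ^+ (2 ^ i)%N) r.
  elim=> [|i IH]; apply: rr; first by rewrite expn0 expr1.
  have : root (map_poly iota p) (z ^+ (2 ^ i)%N).
    elim: i {IH} => [|i IH]; first by rewrite expn0 expr1.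
    by rewrite expnS mulnC exprM rootE horner_frob (eqP IH) expr0n.
  by move=> h; rewrite expnS mulnC exprM rootE horner_frob (eqP h) expr0n.
exists (j - i)%N; first by rewrite subn_gt0.
apply/eqP/(@frob_inj i) => /=; rewrite -exprM -expnD subnK; last exact: ltnW.
by rewrite e.
Qed.

Lemma frob_fixedM d e z : frob_fixed d z -> frob_fixed (d * e) z.
Proof.
move=> /eqP h; elim: e => [|e IH];
  first by rewrite muln0 /frob_fixed expn0 expr1.
by rewrite /frob_fixed mulnS expnD exprM h.
Qed.

Lemma frob_fixed_seq (s : seq k) : exists2 N, (0 < N)%N & all (frob_fixed N) s.
Proof.
elim: s => [|z s [N N0 IH]]; first by exists 1%N.
have [d d0 h] := frob_fixed_exists z; exists (d * N)%N;
  first by rewrite muln_gt0 d0.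
rewrite /= frob_fixedM //=; apply: sub_all IH => w.
by rewrite mulnC; exact: frob_fixedM.
Qed.

Section Closed.
Context (N : nat).
Local Notation fixed := (frob_fixed N).

Lemma frob_fixedD z w : fixed z -> fixed w -> fixed (z + w).
Proof.
by move=> /eqP hz /eqP hw;
  rewrite /frob_fixed exprDn_pchar ?pchar_nat_exp2 // hz hw.
Qed.
Lemma frob_fixedMul z w : fixed z -> fixed w -> fixed (z * w).
Proof. by move=> /eqP hz /eqP hw; rewrite /frob_fixed exprMn hz hw. Qed.
Lemma frob_fixedV z : fixed z -> fixed z^-1.
Proof. by move=> /eqP hz; rewrite /frob_fixed exprVn hz. Qed.
Lemma frob_fixed0 : fixed 0.
Proof. by rewrite /frob_fixed expr0n expn_eq0. Qed.
Lemma frob_fixed1 : fixed 1.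
Proof. by rewrite /frob_fixed expr1n. Qed.
Lemma frob_fixedN z : fixed z -> fixed (- z).
Proof.
move=> h; rewrite -mulN1r; apply: frob_fixedMul => //.
have -> : -1 = 1 :> k; last exact: frob_fixed1.
apply/esym/eqP; rewrite -addr_eq0 -mulr2n; apply/eqP; exact: (pcharf0 pchar_F2).
Qed.
Lemma frob_fixed_nat n : fixed n%:R.
Proof. by elim: n => [|n IH];
  [exact: frob_fixed0|rewrite mulrS frob_fixedD ?frob_fixed1]. Qed.
Lemma frob_fixedX z n : fixed z -> fixed (z ^+ n).
Proof. by move=> h; elim: n => [|n IH];
  [exact: frob_fixed1|rewrite exprS frob_fixedMul]. Qed.

End Closed.

Section Torsion.
Context (E : elliptic_curve k) (F : coord_field E).

Definition fixed_coords N (P : option (k * k)) : bool :=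
  if P is Some (u, v) then frob_fixed N u && frob_fixed N v else true.

Lemma fixed_coords_add N (P Q : point E) :
  all (frob_fixed N) [:: a1 E; a2 E; a3 E; a4 E] ->
  fixed_coords N P -> fixed_coords N Q -> fixed_coords N (add_point P Q).
Proof.
case/and5P => h1 h2 h3 h4 _; rewrite /add_point /=.
case: (coords P) (coords Q) =>
  [[u v]|] [[u' v']|] //= /andP[hu hw] /andP[hu' hw'].
case: ifP => // _; rewrite /fixed_coords.
have hN := @frob_fixedN N; have hD := @frob_fixedD N;
  have hM := @frob_fixedMul N.
have hV := @frob_fixedV N; have hn := @frob_fixed_nat N;
  have hX := @frob_fixedX N.
have hl : frob_fixed N (slope E u v u' v').
  rewrite /slope; case: eqP => _; last by apply: (hM);
    [apply: (hD)|apply: (hV); apply: (hD)] => //; exact: hN.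
  apply: (hM); first apply: (hD); last by apply: (hV); apply: (hD) => //;
    apply: (hD); exact: hM.
    apply: (hD) => //; apply: (hD); first by apply: (hM) => //; exact: hX.
    by apply: (hM) => //; exact: hM.
  by apply: (hN); apply: (hM).
have hx : frob_fixed N (slope E u v u' v' ^+ 2
  + a1 E * slope E u v u' v' - a2 E - u - u').
  by do 3!(apply: (hD); last exact: hN); apply: (hD); [exact: hX|exact: hM].
rewrite hx /=; apply: (hD); last exact: hN; apply: (hD); last by apply: (hN);
  apply: (hM).
by apply: (hN); apply: (hD) => //; apply: (hM) => //; apply: (hD) => //;
  exact: hN.
Qed.

(** The coefficients of the curve and the coordinates of [P] lie in one finite
    field, which then contains the coordinates of all multiples of [P]. *)
Lemma exact_order_exists (P : point E) : exists n, has_exact_order P n.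
Proof.
pose xs := if coords P is Some (u, v) then [:: u; v] else [::].
have [N N0] := frob_fixed_seq ([:: a1 E; a2 E; a3 E; a4 E] ++ xs).
rewrite all_cat => /andP[ha hx].
have hP : fixed_coords N P.
  by move: hx; rewrite /xs /fixed_coords;
    case: (coords P) => [[u v]|] //= /and3P[-> ->].
have hmul i : fixed_coords N (mul_point i P).
  by elim: i => // i IH; rewrite mul_pointS; exact: fixed_coords_add.
have q0 : 'X ^+ (2 ^ N)%N - 'X != 0 :> {poly k}.
  have s : size ('X ^+ (2 ^ N)%N - 'X : {poly k})%R = (2 ^ N)%N.+1.
    rewrite size_polyDl size_polyXn // size_polyN size_polyX ltnS.
    by have := @ltn_exp2l 2 0 N isT; rewrite expn0 N0.
  by rewrite -size_poly_eq0 s.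
have [r rr] := roots_seq q0.
have fr z : frob_fixed N z -> z \in r.
  by move=> h; apply: rr; rewrite rootE !hornerE subr_eq0.
pose s := None :: [seq Some (a, b) | a <- r, b <- r].
have [i|i [j [lt e]]] := @pigeonhole _ (fun i => coords (mul_point i P)) s.
  move: (hmul i); rewrite /s inE /fixed_coords.
  case: (coords _) => [[u v]|] //= /andP[hu hw].
  by apply/allpairsP; exists (u, v); rewrite !fr.
have tor : mul_point (j - i) P = origin E.
  apply: (add_point_inj F (A := mul_point i P)).
  by rewrite addrO -(mul_pointD F) subnKC ?(ltnW lt) //; apply/esym/val_inj.
have ex : exists n, (0 < n)%N && (mul_point n P == origin E).
  by exists (j - i)%N; rewrite subn_gt0 lt tor eqxx.
case: (ex_minnP ex) => n /andP[n0 /eqP nP] min; exists n;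
  split=> // m /andP[m0 mn] mP.
by have := min m; rewrite m0 mP eqxx leqNgt mn => /(_ isT).
Qed.

End Torsion.
End Frobenius.

(** * Isomorphisms *)

(** The hypotheses equate the coefficients of [Y], [X^2], [X] and [1]; in
    characteristic 2, with [a1 = 0] on both curves, the remaining ones agree. *)
Lemma change_of_variables_identity (K : fieldType)
    (A2 A3 A4 A6 B2 B3 B4 B6 w r s t X Y : K) :
  2%:R = 0 :> K -> B3 * w ^+ 3 = w ^+ 6 * A3 ->
  s ^+ 2 + w ^+ 6 * A2 = w ^+ 4 * r + B2 * w ^+ 4 ->
  B3 * s + w ^+ 6 * A4 = w ^+ 2 * r ^+ 2 + B4 * w ^+ 2 ->
  t ^+ 2 + B3 * t + w ^+ 6 * A6 = r ^+ 3 + B2 * r ^+ 2 + B4 * r + B6 ->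
  let X' := w ^+ 2 * X + r in
  let Y' := w ^+ 3 * Y + s * X + t in
  Y' ^+ 2 + B3 * Y' - (X' ^+ 3 + B2 * X' ^+ 2 + B4 * X' + B6)
   = w ^+ 6 * (Y ^+ 2 + A3 * Y - (X ^+ 3 + A2 * X ^+ 2 + A4 * X + A6)).
Proof.
move=> two0 e3 e2 e1 e0 X' Y'; apply/subr0_eq.
transitivity ((B3 * w ^+ 3 - w ^+ 6 * A3) * Y
  + (s ^+ 2 + w ^+ 6 * A2 - (w ^+ 4 * r + B2 * w ^+ 4)) * X ^+ 2
  + (B3 * s + w ^+ 6 * A4 - (w ^+ 2 * r ^+ 2 + B4 * w ^+ 2)) * X
  + (t ^+ 2 + B3 * t + w ^+ 6 * A6 - (r ^+ 3 + B2 * r ^+ 2 + B4 * r + B6))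
  + 2%:R * (w ^+ 3 * Y * (s * X + t)
    + s * t * X - w ^+ 4 * r * X ^+ 2 - w ^+ 2 * r ^+ 2 * X
     - B2 * w ^+ 2 * r * X)); first by rewrite /X' /Y'; ring.
by rewrite e3 e2 e1 e0 two0 !subrr !mul0r !addr0.
Qed.

Section ChangeOfVariables.
Context {k : closedFieldType} {E E' : elliptic_curve k}.
Hypotheses (two0 : 2%:R = 0 :> k) (a10 : a1 E = 0) (a10' : a1 E' = 0).

(** The coefficients of a substitution [x' = w^2 x + r], [y' = w^3 y + s x + t]
    from [E] to [E']. *)
Definition admissible (w r s t : k) : Prop :=
  [/\ w != 0, a3 E' * w ^+ 3 = w ^+ 6 * a3 E,
   s ^+ 2 + w ^+ 6 * a2 E = w ^+ 4 * r + a2 E' * w ^+ 4,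
   a3 E' * s + w ^+ 6 * a4 E = w ^+ 2 * r ^+ 2 + a4 E' * w ^+ 2 &
   t ^+ 2 + a3 E' * t + w ^+ 6 * a6 E
     = r ^+ 3 + a2 E' * r ^+ 2 + a4 E' * r + a6 E'].

(** The equations are solved in the order [w], [s], [r], [t].  The coefficient of
    [Y] gives [w^3]; that of [X^2] expresses [r] in terms of [s]; substituting it
    in that of [X] gives a monic quartic for [s]; the last one is a quadratic
    equation for [t]. *)
Lemma admissible_exists : exists w r s t, admissible w r s t.
Proof.
have a30 : a3 E != 0 := a1_a3_neq0 two0 a10.
have a30' : a3 E' != 0 := a1_a3_neq0 two0 a10'.
have dbl (c : k) : c + c = 0 := dbl_k two0 c.
have [w ew] := @solve_monicpoly k 3%N (fun i =>
  if i == 0%N then a3 E' / a3 E else 0) isT.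
rewrite 3!big_ord_recl big_ord0 /= expr0 mulr1 !mul0r !addr0 in ew.
have w0 : w != 0.
  by apply: contra_eq_neq ew => ->; rewrite expr0n eq_sym mulf_neq0 ?invr_eq0.
pose c := a2 E' + w ^+ 2 * a2 E.
have [s es] := @solve_monicpoly k 4%N (fun i => if i == 0%N then
  (w ^+ 6 * a4 E + w ^+ 2 * c ^+ 2 + a4 E' * w ^+ 2) / w ^+ 6
  else if i == 1%N then a3 E' / w ^+ 3 else 0) isT.
rewrite 4!big_ord_recl big_ord0 /= expr0 expr1 mulr1 !mul0r !addr0 in es.
pose r := c + w ^+ 2 * s ^+ 2.
have [t et] := @solve_monicpoly k 2%N (fun i => if i == 0%N then
   r ^+ 3 + a2 E' * r ^+ 2 + a4 E' * r
     + a6 E' - w ^+ 6 * a6 E else - a3 E') isT.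
rewrite 2!big_ord_recl big_ord0 /= expr0 expr1 mulr1 !addr0 in et.
exists w, r, (w ^+ 3 * s), t; split=> //.
- have -> : w ^+ 6 = w ^+ 3 * w ^+ 3 by ring.
  by rewrite {3}ew; field.
- apply/subr0_eq; transitivity (- (w ^+ 4 * (a2 E' + a2 E')));
  last by rewrite dbl mulr0 oppr0.
  by rewrite /r /c; ring.
- apply/subr0_eq.
  transitivity (- (w ^+ 6 * (s ^+ 4 - ((w ^+ 6 * a4 E + w ^+ 2 * c ^+ 2
    + a4 E' * w ^+ 2) / w ^+ 6
     + a3 E' / w ^+ 3 * s)) ) + w ^+ 6 * 0
     - (w ^+ 2 * c ^+ 2 + w ^+ 2 * c ^+ 2) - (w ^+ 4 * c * s ^+ 2
       + w ^+ 4 * c * s ^+ 2) - (a4 E' * w ^+ 2 + a4 E' * w ^+ 2)).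
    by rewrite /r; field.
  by rewrite es subrr !dbl; ring.
by rewrite et; ring.
Qed.


Section Isomorphism.
Context (F : coord_field E) (F' : coord_field E') (w r s t : k).
Hypothesis adm : admissible w r s t.
Local Notation C := (cst F).
Local Notation x := (cx F).
Local Notation y := (cy F).

Lemma cov_identity_k (u v : k) :
  on_curve E' (Some (w ^+ 2 * u + r, w ^+ 3 * v + s * u + t))
    = on_curve E (Some (u, v)).
Proof.
have [w0 e3 e2 e1 e0] := adm.
have := change_of_variables_identity u v two0 e3 e2 e1 e0.
rewrite /= a10 a10' !mul0r !addr0 => e.
rewrite -subr_eq0 e mulf_eq0 expf_eq0 (negPf w0) /= subr_eq0.
by [].
Qed.

Definition cov_coords (p : option (k * k)) : option (k * k) :=
  if p is Some (u, v) then Some (w ^+ 2 * u + r,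
    w ^+ 3 * v + s * u + t) else None.

Lemma cov_on_curve (R : point E) : on_curve E' (cov_coords R).
Proof.
case: R => [[[u v]|] oc] //; exact: (eq_ind_r is_true oc (cov_identity_k u v)).
Qed.

Definition cov_point (R : point E) : point E' := Point (cov_on_curve R).

Lemma cov_point_bij : bijective cov_point.
Proof.
have [w0 _ _ _ _] := adm.
pose inv (p : option (k * k)) : option (k * k) := if p is Some (u', v') then
  let u := (u' - r) / w ^+ 2 in Some (u, (v' - s * u - t) / w ^+ 3) else None.
have K : cancel cov_coords inv.
  case=> [[u v]|] //=; congr (Some (_, _)); first by field.
  by field.
have K' : cancel inv cov_coords.
  case=> [[u v]|] //=; congr (Some (_, _)); first by field.
  by field.
have oinv (R : point E') : on_curve E (inv R).
  case: R => [[[u v]|] oc] //.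
  apply: (@eq_ind _ _ is_true _ _ (cov_identity_k _ _)).
  exact: (eq_ind_r (on_curve E') oc (K' (Some (u, v)))).
exists (fun R => Point (oinv R)) => R; apply: val_inj; [exact: K|exact: K'].
Qed.

Lemma cov_lift : exists phi : {rmorphism F' -> F},
  [/\ forall c, phi (cst F' c) = C c, bijective phi
   & forall R f, regular (cov_point R) f <-> regular R (phi f)].
Proof.
have [w0 e3 e2 e1 e0] := adm;
  have two0F : 2%:R = 0 :> F by rewrite -(rmorph_nat C) two0 rmorph0.
pose X := C w ^+ 2 * x + C r; pose Y := C w ^+ 3 * y + C s * x + C t.
have Cw0 : C w != 0 by rewrite cst_eq0.
have XY : Y ^+ 2 + C (a1 E') * X * Y + C (a3 E') * Y
    = X ^+ 3 + C (a2 E') * X ^+ 2 + C (a4 E') * X + C (a6 E').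
  have := weierstrassE F; rewrite a10 a10' !rmorph0 !mul0r !addr0 => ew.
  have := @change_of_variables_identity F (C (a2 E)) (C (a3 E)) (C (a4 E)) (C
    (a6 E))
    (C (a2 E')) (C (a3 E')) (C (a4 E')) (C (a6 E')) (C w) (C r) (C s) (C t) x
      y two0F.
  rewrite ew subrr mulr0 => W; apply/subr0_eq/W.
  - by have := congr1 C e3; rewrite !(rmorphXn, rmorphD, rmorphM).
  - by have := congr1 C e2; rewrite !(rmorphXn, rmorphD, rmorphM).
  - by have := congr1 C e1; rewrite !(rmorphXn, rmorphD, rmorphM).
  by have := congr1 C e0; rewrite !(rmorphXn, rmorphD, rmorphM).
have [ox oy] := ord_infinity_x F; have x0 := cx_neq0 F; have y0 := cy_neq0 F.
have [X0 oX] : X != 0 /\ ord (origin E) X = -2.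
  have o2 : ord (origin E) (C w ^+ 2 * x) = -2.
    by rewrite -rmorphXn ordM ?cst_eq0 ?expf_neq0 // ord_cst ?expf_neq0 // ox.
  rewrite -o2; apply: ordD; first by rewrite mulf_neq0 ?expf_neq0.
  by rewrite o2; apply: vge_le (vge_cst F _ _).
have [Y0 oY] : Y != 0 /\ ord (origin E) Y = -3.
  have o3 : ord (origin E) (C w ^+ 3 * y) = -3.
    by rewrite -rmorphXn ordM ?cst_eq0 ?expf_neq0 // ord_cst ?expf_neq0 // oy.
  rewrite -o3 /Y -addrA; apply: ordD; first by rewrite mulf_neq0 ?expf_neq0.
  rewrite o3; apply: vgeD; last by apply: vge_le (vge_cst F _ _).
  by apply: vgeZ; rewrite vge_ord // ox.
have Xc c : X != C c.
  by apply/eqP => e; move: oX; rewrite ord_const //; exists c.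
have [phi [pC px py]] := coordinate_lift F' Xc XY.
exists phi; split=> // [|R].
  have surj g : exists f, phi f == g.
    pose px' := (cx F' - cst F' r) / cst F' w ^+ 2.
    have ex : phi px' = x.
      by rewrite fmorph_div rmorphXn rmorphB px !pC /X; field.
    have ey : phi ((cy F' - cst F' s * px' - cst F' t) / cst F' w ^+ 3) = y.
      by rewrite fmorph_div rmorphXn 2!rmorphB rmorphM ex py !pC /Y; field.
    have [a [b [d [d0 ->]]]] := cf_span g.
    have surjp p : exists f, phi f = polyf F p.
      rewrite polyf_horner; elim/poly_ind: p => [|p c [f IH]].
        by exists 0; rewrite !rmorph0 hornerC.
      exists (f * px' + cst F' c).
      by rewrite rmorphD rmorphM IH ex pC rmorphD rmorphM /= map_polyX
        map_polyC !hornerE.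
    have [fa ea] := surjp a; have [fb eb] := surjp b; have [fd ed] := surjp d.
    exists ((fa + fb * ((cy F' - cst F' s * px'
      - cst F' t) / cst F' w ^+ 3)) / fd).
    by rewrite fmorph_div rmorphD rmorphM ey ea eb ed.
  exists (fun g => xchoose (surj g)) => g; last exact/eqP/(xchooseP (surj g)).
  by apply: (fmorph_inj phi); exact/eqP/(xchooseP (surj (phi g))).
apply: dominate_reg => //; case: R => [[[u v]|] oc];
  apply: dominate_hv => //=; rewrite ?px ?py.
- by apply: hvD (hv_cst _ _ _); rewrite -rmorphXn; apply: hvM;
  [exact: hv_cst|exact: hv_x].
- apply: hvD (hv_cst _ _ _); apply: hvD; last by apply: hvM;
  [exact: hv_cst|exact: hv_x].
  by rewrite -rmorphXn; apply: hvM; [exact: hv_cst|exact: hv_y].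
- have -> : Point oc = origin E by exact: val_inj.
  rewrite fmorph_div px py; apply: hv_ord_gt0;
    first by rewrite mulf_neq0 ?invr_eq0.
  by rewrite ord_div // oX oY.
have -> : Point oc = origin E by exact: val_inj.
by rewrite fmorphV py; apply: hv_ord_gt0; rewrite ?invr_eq0 // ordV // oY.
Qed.

End Isomorphism.
End ChangeOfVariables.

Section Invariance.
Context {k : closedFieldType} {E E' : elliptic_curve k}.
Context (F : coord_field E) (F' : coord_field E').
Hypothesis char2 : 2%N \in [pchar k].
Let two0 : 2%:R = 0 :> k. Proof. exact: pcharf0. Qed.

(** If [a1 E' <> 0] there is a point [T'] of order 2 on [E'], and [x - x_T'] has
    divisor [2(T') - 2(0)].  Its image has divisor [2(T) - 2(0)], so [T] is a
    point of order 2 on [E]. *)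
Lemma a1_eq0_isomorphic (phi : point E -> point E') (phi_ : {rmorphism F' ->
  F}) :
  bijective phi -> bijective phi_ -> (forall c, phi_ (cst F' c) = cst F c) ->
  (forall R f, regular (phi R) f <-> regular R (phi_ f)) ->
    phi (origin E) = origin E' ->
  a1 E = 0 -> a1 E' = 0.
Proof.
move=> bphi bphi_ pC pR pO a10; apply/eqP/negPn/negP => a10'.
pose u := - (a3 E' / a1 E'); have [v oc] := affine_point_exists (E := E') u.
have dyT : dy E' u v = 0 by rewrite dyE // /u; field.
have [psi psiK psiK'] := bphi; pose T := psi (Point oc).
have eT : phi T = Point oc by exact: psiK'.
have surj g : exists f, phi_ f = g by case: bphi_ => q _ qK; exists (q g);
  exact: qK.
have negT : neg_point (Point oc) = Point oc.
  by apply: val_inj => /=; congr (Some (_, _)); apply/eqP; rewrite -dy_neg dyT.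
have x0 := cx_cst_neq0 F' u.
have pr : principal F (fun R =>
  pt T R + pt T R - pt (origin E) R - pt (origin E) R).
  exists (phi_ (cx F' - cst F' u)); first by rewrite fmorph_eq0.
  move=> R; rewrite (ord_transfer (pR R) surj) // (ord_vertical F' oc) negT.
  have -> : pt (Point oc) (phi R) = pt T R by rewrite /pt -eT (bij_eq bphi).
  have -> : pt (origin E') (phi R)
    = pt (origin E) R by rewrite /pt -pO (bij_eq bphi).
  by ring.
have TT : neg_point T = T.
  by apply: (add_point_inj F (A := T));
    rewrite (add_negr F) (add_point_uniq pr).
have := two_torsion_free char2 a10 TT.
by move/(congr1 phi); rewrite eT pO => /(congr1 (@coords _ E')).
Qed.

End Invariance.

(** * The function field of an elliptic curve *)
Lemma linear_poly_eq0 (R : nzRingType) (u v : R) :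
  u%:P + v%:P * 'X = 0 -> u = 0 /\ v = 0.
Proof.
move/polyP => e; split; [have := e 0%N | have := e 1%N].
  by rewrite coefD coefC coefMX /= addr0 coef0.
by rewrite coefD !coefC coefMX /= add0r coefC.
Qed.

Section FunctionField.
Context {k : fieldType} (E : elliptic_curve k).
Local Notation "x %:F" := (@FracField.tofrac _ x).
Local Notation K := (function_field E).
Local Notation W := (weierstrass_poly E).

Definition fun_poly (p : {poly k}) : K := in_qpoly W (p%:F)%:P.

Lemma fun_poly_is_zmod_morphism : zmod_morphism fun_poly.
Proof. by move=> p q; rewrite /fun_poly tofracB polyCB; exact: raddfB. Qed.

Lemma fun_poly_is_monoid_morphism : monoid_morphism fun_poly.
Proof.
split; first by rewrite /fun_poly tofrac1 polyC1; exact: in_qpoly1.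
by move=> p q; rewrite /fun_poly tofracM polyCM; exact: in_qpolyM.
Qed.

HB.instance Definition _ :=
  GRing.isZmodMorphism.Build {poly k} K fun_poly fun_poly_is_zmod_morphism.
HB.instance Definition _ :=
  GRing.isMonoidMorphism.Build {poly k} K fun_poly fun_poly_is_monoid_morphism.

Lemma constfE c : constf E c = fun_poly c%:P. Proof. by []. Qed.
Lemma constf_is_zmod_morphism : zmod_morphism (constf E).
Proof. by move=> p q; rewrite !constfE polyCB rmorphB. Qed.

Lemma constf_is_monoid_morphism : monoid_morphism (constf E).
Proof. by split=> [|p q]; rewrite !constfE ?rmorph1 // polyCM rmorphM. Qed.

HB.instance Definition _ :=
  GRing.isZmodMorphism.Build k K (constf E) constf_is_zmod_morphism.
HB.instance Definition _ :=
  GRing.isMonoidMorphism.Build k K (constf E) constf_is_monoid_morphism.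

Let WE : W = 'X ^+ 2 + ((lin E)%:F)%:P * 'X - ((cubic E)%:F)%:P.
Proof. by []. Qed.

Let monW : W \is monic. Proof. exact: (weierstrass_poly_irreducible E).2. Qed.

Let sizeW : size W = 3%N.
Proof.
rewrite WE -addrA size_polyDl size_polyXn //.
rewrite ltnS (leq_trans (size_polyD _ _)) // geq_max size_polyN.
rewrite (leq_trans (size_polyC_leq1 _)) // andbT.
rewrite (leq_trans (size_polyMleq _ _)) // size_polyX addn2 /=.
by rewrite ltnS size_polyC_leq1.
Qed.

Let mkW : mk_monic W = W. Proof. by rewrite /mk_monic sizeW monW. Qed.

Lemma curve_equation :
  coordy E ^+ 2 + fun_poly (lin E) * coordy E = fun_poly (cubic E).
Proof.
suff : coordy E ^+ 2 + fun_poly (lin E) * coordy E + fun_poly (- cubic E) = 0.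
  by rewrite rmorphN => /subr0_eq.
transitivity (in_qpoly W W : K); last first.
  by apply: val_inj; rewrite /= mkW Pdiv.RingMonic.rmodpp ?monW.
have e : W = 'X * 'X + ((lin E)%:F)%:P * 'X + ((- cubic E)%:F)%:P.
  by rewrite WE tofracN polyCN expr2.
rewrite [X in _ = in_qpoly _ X]e.
by rewrite !in_qpolyD !in_qpolyM -expr2.
Qed.

Lemma function_fieldP (f : K) : exists a b d : {poly k},
  d != 0 /\ f = (fun_poly a + fun_poly b * coordy E) / fun_poly d.
Proof.
pose fr (c : {fraction {poly k}}) : K := in_qpoly W c%:P.
have frM c d : fr (c * d) = fr c * fr d by rewrite /fr polyCM; exact: in_qpolyM.
have fr1 : fr 1 = 1 by exact: in_qpoly1.
have fr0 : fr 0 = 0 by exact: in_qpoly0.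
have frE n m : m != 0 -> fr (n%:F / m%:F) = fun_poly n / fun_poly m.
  move=> m0; have m1 : m%:F != 0 by rewrite tofrac_eq0.
  have e : fr (m%:F)^-1 * fun_poly m
    = 1 by rewrite -[fun_poly m]/(fr m%:F) -frM mulVf.
  have m2 : fun_poly m != 0.
    by apply: contra_eq_neq e => ->; rewrite mulr0 eq_sym oner_eq0.
  by rewrite frM -[fr n%:F]/(fun_poly n); congr (_ * _);
    rewrite -[RHS]mul1r -e mulfK.
have -> : f = fr (val f)`_0 + fr (val f)`_1 * coordy E.
  transitivity (in_qpoly W (val f) : K).
    by apply: val_inj; rewrite /= Pdiv.CommonRing.rmodp_small // size_mk_monic.
  rewrite -[fr _ * _]in_qpolyM -[RHS]in_qpolyD; congr in_qpoly.
  have sf : (size (val f) <= 2)%N by rewrite -ltnS;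
    apply: (leq_trans (size_mk_monic f)); rewrite mkW sizeW.
  apply/polyP => -[|[|i]];
    rewrite coefD coefC coefCM coefX ?mulr0 ?addr0 ?mulr1 ?add0r //.
  by rewrite nth_default // (leq_trans sf).
have [n [m [m0 ->]]] := fraction_numden (val f)`_0.
have [n' [m' [m0' ->]]] := fraction_numden (val f)`_1.
exists (n * m'), (n' * m), (m * m'); split; first by rewrite mulf_neq0.
have inj p : p != 0 -> fun_poly p != 0.
  move=> p0; have p1 : p%:F != 0 by rewrite tofrac_eq0.
  have e : fr (p%:F)^-1 * fun_poly p
    = 1 by rewrite -[fun_poly p]/(fr p%:F) -frM mulVf.
  by apply: contra_eq_neq e => ->; rewrite mulr0 eq_sym oner_eq0.
rewrite !frE // mulrAC addf_div ?inj // !rmorphM; congr (_ / _); congr (_ + _).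
by rewrite mulrAC.
Qed.

Lemma fun_poly_coordy_free a b :
  fun_poly a + fun_poly b * coordy E = 0 -> a = 0 /\ b = 0.
Proof.
have -> : fun_poly a + fun_poly b * coordy E
  = in_qpoly W ((a%:F)%:P + (b%:F)%:P * 'X).
  by rewrite in_qpolyD in_qpolyM.
move=> /(congr1 val) /=; rewrite Pdiv.CommonRing.rmodp_small; last first.
  rewrite mkW sizeW ltnS (leq_trans (size_polyD _ _)) // geq_max.
  rewrite (leq_trans (size_polyC_leq1 _)) //=.
  rewrite (leq_trans (size_polyMleq _ _)) // size_polyX addn2 /=.
  by rewrite ltnS size_polyC_leq1.
move=> e; have [e0 e1] := linear_poly_eq0 e.
by split; apply/eqP; rewrite -tofrac_eq0; apply/eqP.
Qed.


Lemma fun_poly_neq0 p : p != 0 -> fun_poly p != 0.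
Proof.
apply: contra_neq => e; have [] := @fun_poly_coordy_free p 0 => //.
by rewrite rmorph0 mul0r addr0.
Qed.

Lemma fun_poly_span (f : K) : exists a b d : {poly k},
  fun_poly d != 0 /\ f = (fun_poly a + fun_poly b * coordy E) / fun_poly d.
Proof.
have [a [b [d [d0 e]]]] := function_fieldP f.
by exists a, b, d; split=> //; exact: fun_poly_neq0.
Qed.

Definition standard : coord_field E :=
  @CoordField k E K fun_poly (coordy E) curve_equation fun_poly_span
    fun_poly_coordy_free.

End FunctionField.

(** * The Lame locus *)
Section Bridge.
Context {k : closedFieldType}.
Implicit Types E : elliptic_curve k.

Lemma regular_at_standard E (R : point E) (f : function_field E) :
  regular_at R f <-> regular (F := standard E) R f.
Proof. exact: (@regular_forP k E (standard E) R f). Qed.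

Lemma lame_standard E (P : point E) n :
  is_lame_curve_of_order P n = lame_for (standard E) P n.
Proof. by []. Qed.

Hypothesis char2 : 2%N \in [pchar k].
Let two0 : 2%:R = 0 :> k. Proof. exact: pcharf0. Qed.

Lemma supersingularP E : supersingular E <-> a1 E = 0.
Proof.
rewrite supersingular_j0 // /j_invariant.
have -> : c4 E = a1 E ^+ 4.
  rewrite /c4 /b2 /b4 (_ : 4%:R = 2%:R * 2%:R :> k); last by ring.
  rewrite (_ : 24%:R = 2%:R * 12%:R :> k); last by ring.
  by rewrite two0; ring.
split=> [/eqP|->]; last by rewrite !expr0n mul0r.
by rewrite mulf_eq0 invr_eq0 (negPf (discriminant_neq0 E)) orbF !expf_eq0 =>
  /eqP.
Qed.

Lemma isomorphic_supersingular E E' : a1 E = 0 -> a1 E' = 0 -> isomorphic E E'.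
Proof.
move=> a10 a10'; have [w [r [s [t adm]]]] := admissible_exists two0 a10 a10'.
have [phi [pC bphi pR]] :=
  cov_lift two0 a10 a10' (standard E) (standard E') adm.
exists (cov_point two0 a10 a10' adm), phi; split; last exact: val_inj.
split; [exact: cov_point_bij|exact: bphi|exact: pC|] => R f.
apply: (iff_trans (regular_at_standard _ _)); apply: (iff_trans (pR R f)).
by apply: iff_sym; exact: regular_at_standard.
Qed.

Lemma isomorphic_a1 E E' : isomorphic E E' -> a1 E = 0 -> a1 E' = 0.
Proof.
move=> [phi [phi_ [[b1 b2 pC pR] pO]]].
apply: (@a1_eq0_isomorphic _ _ _ (standard E) (standard E') char2 phi phi_ b1
  b2 pC _ pO).
move=> R f; apply: (iff_trans (iff_sym (regular_at_standard _ _))).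
by apply: (iff_trans (pR R f)); exact: regular_at_standard.
Qed.

Lemma isomorphic_refl E : isomorphic E E.
Proof.
have bid T : bijective (@idfun T) by exists idfun.
by exists idfun, idfun; split; [split;
  [exact: bid|exact: bid|move=> c|move=> R f]|].
Qed.

Lemma isomorphic_trans E E' E'' : isomorphic E E' -> isomorphic E' E'' ->
  isomorphic E E''.
Proof.
move=> [f [f_ [[b1 b2 fC fR] fO]]] [g [g_ [[b1' b2' gC gR] gO]]].
exists (g \o f), (f_ \o g_); split; last exact: etrans (congr1 g fO) gO.
split; [exact: bij_comp b1' b1|exact: bij_comp b2 b2'|move=> c|move=> R h].
  exact: etrans (congr1 f_ (gC c)) (fC c).
exact: iff_trans (gR (f R) h) (fR R (g_ h)).
Qed.

End Bridge.

Theorem corollary2p3 (k : closedFieldType) (iota : {rmorphism 'F_2 -> k})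
    (k_alg : forall z : k, algebraicOver iota z)
    (E0 : elliptic_curve k) (E0_ss : supersingular E0) :
  lame_locus k = forget_fiber (class1 E0).
Proof.
have char2 := pchar_F2 iota;
  have a10 : a1 E0 = 0 by apply/(supersingularP char2).
apply/seteqP; split=> [_ [x [n lame_x] <-]|_ [[x _ <-] fx]].
  split; first by exists x.
  rewrite /= forget_class2.
  rewrite lame_standard in lame_x.
  have a1x : a1 (curve x) = 0 := a1_eq0_of_lame_for char2 lame_x.
  by apply/seteqP; split=> E' h; apply: isomorphic_trans h;
    exact: isomorphic_supersingular.
exists x => //; rewrite /= forget_class2 in fx.
have : class1 (curve x) (curve x) by exact: isomorphic_refl.
rewrite fx => /(isomorphic_a1 char2) /(_ a10) a1x.
have [n on] := exact_order_exists k_alg (standard (curve x)) (marked x).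
exists n; rewrite lame_standard.
exact: (lame_for_a1_eq0 (standard (curve x)) char2 a1x (marked_neq0 x) on).
Qed.
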